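(* Let $R$ be a symmetric Poisson-CGL extension of length $N$. Assume that the generators $x_1,\dots,x_N$ of $R$ are normalized so that for every $i\in[1,N]$ with $s(i)\neq+\infty$ the leading coefficient $\pi_{[i,s(i)]}$ of $u_{[i,s(i)]}=x_ix_{s(i)}-y_{[i,s(i)]}$ equals $1$. Then for all $i\in[1,N]$ and $m\in\mathbb Z_{>0}$ such that $s^m(i)\in[1,N]$, $$y_{[s(i),s^m(i)]}=\begin{cases}Y_{[i,s(i)]}(e_{s(i)}-e_i)+Y_{[i,s(i)]}(g_{[i,s(i)]}-e_i),&\text{if }m=1,\\[2pt] Y_{[i,s^m(i)]}(e_{s^{m-1}(i)}+e_{s^m(i)}-e_i)+Y_{[i,s^m(i)]}(g_{[i,s^m(i)]}-e_i),&\text{if }m>1.\end{cases}$$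
   Context: $\mathbb K$ is a field of characteristic $0$; algebras are $\mathbb K$-algebras, derivations are $\mathbb K$-linear; $[j,k]=\{j,\dots,k\}$. A Poisson algebra is a commutative algebra with a Lie bracket $\{-,-\}$ that is a derivation in each variable. A Poisson action is an action by algebra automorphisms preserving the bracket. A Poisson derivation $\sigma$ of $B$ is a derivation for both product and bracket; a Poisson $\sigma$-derivation is a derivation $\delta$ for the product with $\delta(\{a,b\})=\{\delta(a),b\}+\{a,\delta(b)\}+\sigma(a)\delta(b)-\delta(a)\sigma(b)$. The Poisson-Ore extension $B[x;\sigma,\delta]_p$ is $B[x]$ with the unique Poisson bracket extending that of $B$ with $\{x,b\}=\sigma(b)x+\delta(b)$. For a rational action of a torus $\mathcal H\cong(\mathbb K^* )^r$, homogeneous elements are the $\mathcal H$-eigenvectors and $0$; $\mathrm{Lie}\,\mathcal H\cong\mathbb K^r$ acts by the differential: if $a$ is an $\mathcal H$-eigenvector with eigenvalue $h\mapsto h_1^{u_1}\cdots h_r^{u_r}$, then $\xi\cdot a=(u_1\xi_1+\dots+u_r\xi_r)a$. A Poisson-prime element of a Poisson domain $A$ is a nonzero $c$ with $\{c,A\}\subseteq Ac$ and $A/(c)$ a domain. A Poisson-CGL (P-CGL) extension of length $N$ is an iterated Poisson-Ore extension $R=\mathbb K[x_1]_p[x_2;\sigma_2,\delta_2]_p\cdots[x_N;\sigma_N,\delta_N]_p$ ($\sigma_1=\delta_1=0$; $R_k:=\mathbb K[x_1,\dots,x_k]$, $R_0=\mathbb K$) with a rational Poisson action of a torus $\mathcal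 H$ such that (i) each $x_k$ is an $\mathcal H$-eigenvector; (ii) for $k\in[2,N]$, $\delta_k$ is a locally nilpotent Poisson $\sigma_k$-derivation of $R_{k-1}$; (iii) for $k\in[1,N]$ there is $h_k\in\mathrm{Lie}\,\mathcal H$ with $\sigma_k=(h_k\cdot)|_{R_{k-1}}$ and $h_k\cdot x_k=\lambda_kx_k$, $\lambda_k\neq0$. Write $\sigma_k(x_j)=\lambda_{kj}x_j$ for $j<k$. For $\eta:[1,N]\to\mathbb Z$: $p(k)=\max\{j<k\mid\eta(j)=\eta(k)\}$, $s(k)=\min\{j>k\mid\eta(j)=\eta(k)\}$ ($\max\varnothing=-\infty$, $\min\varnothing=+\infty$; $s(+\infty)=+\infty$). For every P-CGL extension there exist $\eta$ and homogeneous $c_k\in R_{k-1}$ (for $p(k)\neq-\infty$) such that the elements $y_k:=y_{p(k)}x_k-c_k$ if $p(k)\ne-\infty$, $y_k:=x_k$ if $p(k)=-\infty$, are homogeneous and for every $k$ the set $\{y_j\mid j\in[1,k],\,s(j)>k\}$ is a list of the homogeneous Poisson-prime elements of $R_k$ up to scalar multiples; $p$ and $s$ are uniquely determined. Fix such $\eta,p,s$. Put $R_{[j,k]}=\mathbb K[x_i\mid j\le i\le k]$ ($=\mathbb K$ if $j>k$). $R$ is symmetric if (i) $\delta_k(x_j)\in R_{[j+1,k-1]}$ for all $j<k$; (ii) for every $j\in[1,N]$ there is $h_j^*\in\mathrm{Lie}\,\mathcal H$ with $h_j^*\cdot x_k=-\lambda_{kj}x_k$ for $k\in[j+1,N]$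 and $h_j^*\cdot x_j=\lambda_j^*x_j$ with $\lambda_j^*\ne0$. Leading terms (and leading coefficients) are taken in the basis of monomials $x^f=x_1^{m_1}\cdots x_N^{m_N}$, $f=(m_1,\dots,m_N)^T\in\mathbb Z_{\ge0}^N$, for the reverse lexicographic order: $(m'_i)\prec(m_i)$ iff for some $j$, $m'_j<m_j$ and $m'_k=m_k$ for $k>j$. For $i\in[1,N]$, $m\ge0$ with $s^m(i)\in[1,N]$, $y_{[i,s^m(i)]}$ is the unique homogeneous Poisson-prime element of $R_{[i,s^m(i)]}$ with leading term $x_ix_{s(i)}\cdots x_{s^m(i)}$; $y_\varnothing:=1$. Put $e_{[i,s^m(i)]}=e_i+e_{s(i)}+\dots+e_{s^m(i)}\in\mathbb Z^N$. For $m>0$ with $s^m(i)\in[1,N]$, put $u_{[i,s^m(i)]}=y_{[i,s^{m-1}(i)]}y_{[s(i),s^m(i)]}-y_{[s(i),s^{m-1}(i)]}y_{[i,s^m(i)]}$ (with $y_{[s(i),i]}=y_\varnothing=1$ when $m=1$); it is nonzero with leading term $\pi_{[i,s^m(i)]}x^{f_{[i,s^m(i)]}}$, $\pi_{[i,s^m(i)]}\in\mathbb K^*$, $f_{[i,s^m(i)]}\in\mathbb Z_{\ge0}^N$. For $j\le l$ let $O_-^j(l)=\max\{n\in\mathbb Z_{\ge0}\mid p^n(l)\ge j\}$. Let $P_{[i,s^m(i)]}=\{k\in[i,s^m(i)]\setminus\{i,s(i),\dots,s^m(i)\}\mid s(k)>s^m(i)\}$. There is a unique vector $g_{[i,s^m(i)]}=\sum_{k\in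 P_{[i,s^m(i)]}}m_ke_k$ with $m_k\in\mathbb Z_{\ge0}$ such that $f_{[i,s^m(i)]}=\sum_{k\in P_{[i,s^m(i)]}}m_k\,e_{[p^{O_-^{i+1}(k)}(k),\,k]}$. $Y_{[i,s^m(i)]}$ is the group homomorphism from $\mathbb Ze_i+\dots+\mathbb Ze_{s^m(i)}$ to $\mathrm{Fract}(R_{[i,s^m(i)]})^*$ with $Y_{[i,s^m(i)]}(e_k)=y_{[p^{O_-^{i+1}(k)}(k),\,k]}$ for $k\in[i+1,s^m(i)-1]$, $Y_{[i,s^m(i)]}(e_i)=y_{[i,s^{m-1}(i)]}$, and $Y_{[i,s^m(i)]}(e_{s^m(i)})=y_{[i,s^m(i)]}$. *)

(* Defs.v *)
From HB Require Import structures.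
From mathcomp Require Import all_boot all_order all_algebra.
From mathcomp Require Import mpoly.

Set Implicit Arguments.
Unset Strict Implicit.
Unset Printing Implicit Defensive.

Import GRing.Theory.
Local Open Scope ring_scope.

(* Conventions.  The variables are x_1, ..., x_N on paper and 'X_k, k : 'I_N,  *)
(* here, so all indices are shifted by one.  The functions p and s take values *)
(* in option 'I_N, with None for -oo and +oo.                                  *)

(* -------------------------------------------------------------------------- *)

(* Subalgebras are collective predicates B on an ambient algebra A; a map      *)
(* "on B" is a map on A of which only the values on B matter.                  *)
Section Poisson.

Variables (K : fieldType) (A : comAlgType K).
Implicit Types (br : A -> A -> A) (B : {pred A}) (sigma delta d : A -> A).

Definition poisson_bracket br : Prop :=
  [/\ forall (t : K) a b c, br (t *: a + b) c = t *: br a c + br b c,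
      forall a, br a a = 0,
      forall a b c, br a (br b c) + br b (br c a) + br c (br a b) = 0
    & forall a b c, br a (b * c) = br a b * c + b * br a c].

Definition derivation_on B d : Prop :=
  [/\ forall b, b \in B -> d b \in B,
      forall (t : K) a b, a \in B -> b \in B -> d (t *: a + b) = t *: d a + d b
    & forall a b, a \in B -> b \in B -> d (a * b) = d a * b + a * d b].

Definition poisson_derivation_on br B sigma : Prop :=
  derivation_on B sigma /\
  forall a b, a \in B -> b \in B ->
    sigma (br a b) = br (sigma a) b + br a (sigma b).

Definition poisson_sigma_derivation_on br B sigma delta : Prop :=
  derivation_on B delta /\
  forall a b, a \in B -> b \in B ->
    delta (br a b) =
      br (delta a) b + br a (delta b) + sigma a * delta b - delta a * sigma b.

Definition locally_nilpotent_on B d : Prop :=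
  forall b, b \in B -> exists n : nat, iter n d b = 0.

Definition principal_ideal B (c a : A) : Prop := exists2 b, b \in B & a = b * c.

(* B/(c) is a domain iff (c) is a proper prime ideal of B. *)
Definition poisson_prime br B (c : A) : Prop :=
  [/\ c \in B, c != 0,
      forall a, a \in B -> principal_ideal B c (br c a),
      ~ principal_ideal B c 1
    & forall a b, a \in B -> b \in B -> principal_ideal B c (a * b) ->
        principal_ideal B c a \/ principal_ideal B c b].

End Poisson.

(* -------------------------------------------------------------------------- *)

Section Torus.

Variables (K : fieldType) (r : nat).

(* The torus (K^* )^r is the set of h : {ffun 'I_r -> K} with in_torus h. *)
Definition in_torus (h : {ffun 'I_r -> K}) : bool := [forall i, h i != 0].

Definition torus_char (u : 'I_r -> int) (h : {ffun 'I_r -> K}) : K :=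
  \prod_i h i ^ u i.

(* Regular functions on the torus, i.e. Laurent polynomials. *)
Definition torus_regular (phi : {ffun 'I_r -> K} -> K) : Prop :=
  exists w : seq (K * ('I_r -> int)),
    forall h, in_torus h -> phi h = \sum_(t <- w) t.1 * torus_char t.2 h.

Variable A : comAlgType K.
Implicit Types (act : {ffun 'I_r -> K} -> A -> A).

(* Group action by K-algebra automorphisms preserving the bracket. *)
Definition poisson_action (br : A -> A -> A) act : Prop :=
  [/\ forall a, act [ffun=> 1] a = a,
      forall h h' a, in_torus h -> in_torus h' ->
        act [ffun i => h i * h' i] a = act h (act h' a),
      forall h (t : K) a b, in_torus h ->
        act h (t *: a + b) = t *: act h a + act h b,
      forall h, in_torus h ->
        act h 1 = 1 /\ forall a b, act h (a * b) = act h a * act h b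
    & forall h a b, in_torus h -> act h (br a b) = br (act h a) (act h b)].

(* Every element lies in a finite-dimensional stable subspace (with basis v)   *)
(* on which the torus acts through a morphism of algebraic groups.             *)
Definition rational_action act : Prop :=
  forall a, exists (n : nat) (v : 'I_n -> A)
                   (M : 'I_n -> 'I_n -> {ffun 'I_r -> K} -> K),
    [/\ forall w : 'I_n -> K, \sum_i w i *: v i = 0 -> forall i, w i = 0,
        exists w : 'I_n -> K, a = \sum_i w i *: v i,
        forall i j, torus_regular (M i j)
      & forall h j, in_torus h -> act h (v j) = \sum_i M i j h *: v i].

(* The H-eigenvectors and 0. *)
Definition homogeneous act (a : A) : Prop :=
  exists chi : {ffun 'I_r -> K} -> K,
    forall h, in_torus h -> act h a = chi h *: a.

Definition has_weight act (u : 'I_r -> int) (a : A) : Prop :=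
  forall h, in_torus h -> act h a = torus_char u h *: a.

(* lie xi a = xi . a for xi in Lie H = K^r; as A is spanned by eigenvectors    *)
(* when the action is rational, this determines lie.                           *)
Definition differential_action act (lie : {ffun 'I_r -> K} -> A -> A) : Prop :=
  (forall xi (t : K) a b, lie xi (t *: a + b) = t *: lie xi a + lie xi b) /\
  (forall xi u a, has_weight act u a ->
     lie xi a = (\sum_i (u i)%:~R * xi i) *: a).

End Torus.

(* -------------------------------------------------------------------------- *)

(* The polynomials in the variables 'X_i with j <= i < k.  With the index      *)
(* shift, R_k is Rint 0 k, and for a, b : 'I_N the subalgebra R_[a,b] is       *)
(* Rint a b.+1.                                                                *)
Definition Rint (K : fieldType) (N : nat) (j k : nat) : {pred {mpoly K[N]}} :=
  fun f => all (fun m : 'X_{1..N} =>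
    [forall i : 'I_N, (m i != 0%N) ==> (j <= i < k)%N]) (msupp f).

Arguments Rint {K N} j k.

Record PCGL (K : fieldType) (N : nat) := {
  rk : nat;
  br : {mpoly K[N]} -> {mpoly K[N]} -> {mpoly K[N]};
  sigma : 'I_N -> {mpoly K[N]} -> {mpoly K[N]};
  delta : 'I_N -> {mpoly K[N]} -> {mpoly K[N]};
  lambda : 'I_N -> 'I_N -> K;
  act : {ffun 'I_rk -> K} -> {mpoly K[N]} -> {mpoly K[N]};
  lie : {ffun 'I_rk -> K} -> {mpoly K[N]} -> {mpoly K[N]};

  br_poisson : poisson_bracket br;
  (* iterated Poisson-Ore extension; on R_0 = K derivations vanish, so that    *)
  (* the first variable needs no special treatment                             *)
  br_Rint (k : nat) a b :
    a \in Rint 0 k -> b \in Rint 0 k -> br a b \in Rint 0 k;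
  sigma_poisson (k : 'I_N) : poisson_derivation_on br (Rint 0 k) (sigma k);
  delta_poisson (k : 'I_N) :
    poisson_sigma_derivation_on br (Rint 0 k) (sigma k) (delta k);
  br_var (k : 'I_N) b :
    b \in Rint 0 k -> br 'X_k b = sigma k b * 'X_k + delta k b;

  act_poisson : poisson_action br act;
  act_rational : rational_action act;
  lie_act : differential_action act lie;

  act_var (k : 'I_N) : homogeneous act 'X_k;
  delta_nilpotent (k : 'I_N) : locally_nilpotent_on (Rint 0 k) (delta k);
  sigma_lie (k : 'I_N) : exists h : {ffun 'I_rk -> K},
    (forall b, b \in Rint 0 k -> sigma k b = lie h b) /\
    (exists2 l : K, l != 0 & lie h 'X_k = l *: 'X_k);
  lambdaP (j k : 'I_N) : (j < k)%N -> sigma k 'X_j = lambda k j *: 'X_j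
}.

Section PCGLTheory.

Variables (K : fieldType) (N : nat) (R : PCGL K N).

Definition homogeneous_poisson_prime (B : {pred {mpoly K[N]}})
    (c : {mpoly K[N]}) : Prop :=
  homogeneous (@act _ _ R) c /\ poisson_prime (br R) B c.

Definition symmetric_pcgl : Prop :=
  (forall j k : 'I_N, (j < k)%N -> delta R k 'X_j \in Rint j.+1 k) /\
  (forall j : 'I_N, exists h : {ffun 'I_(rk R) -> K},
     (forall k : 'I_N, (j < k)%N -> lie h 'X_k = - lambda R k j *: 'X_k) /\
     (exists2 l : K, l != 0 & lie h 'X_j = l *: 'X_j)).

Variable eta : 'I_N -> int.

Definition pfun (k : 'I_N) : option 'I_N :=
  [pick j : 'I_N | [&& (j < k)%N, eta j == eta k &
     [forall l : 'I_N, (l < k)%N && (eta l == eta k) ==> (l <= j)%N]]].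

Definition sfun (k : 'I_N) : option 'I_N :=
  [pick j : 'I_N | [&& (k < j)%N, eta j == eta k &
     [forall l : 'I_N, (k < l)%N && (eta l == eta k) ==> (j <= l)%N]]].

Definition piter (n : nat) (k : 'I_N) : option 'I_N :=
  iter n (obind pfun) (Some k).
Definition siter (n : nat) (k : 'I_N) : option 'I_N :=
  iter n (obind sfun) (Some k).

(* p^n(k) and s^n(k) as indices; meaningful only when they are finite. *)
Definition ppow (n : nat) (k : 'I_N) : 'I_N := odflt k (piter n k).
Definition spow (n : nat) (k : 'I_N) : 'I_N := odflt k (siter n k).

Definition s_gt (k l : 'I_N) : bool :=
  if sfun k is Some j then (l < j)%N else true.

Definition eta_admissible : Prop :=
  exists c y : 'I_N -> {mpoly K[N]},
    [/\ forall k, pfun k != None ->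
          homogeneous (@act _ _ R) (c k) /\ c k \in Rint 0 k,
        forall k, y k = if pfun k is Some j then y j * 'X_k - c k else 'X_k,
        forall k, homogeneous (@act _ _ R) (y k),
        forall k j : 'I_N, (j <= k)%N -> s_gt j k ->
          homogeneous_poisson_prime (Rint 0 k.+1) (y j)
      & forall (k : 'I_N) a, homogeneous_poisson_prime (Rint 0 k.+1) a ->
          exists (j : 'I_N) (t : K),
            [/\ (j <= k)%N, s_gt j k, t != 0 & a = t *: y j]].

(* O_-^j(l); the maximum is over n < N since p^n(l) is finite only if n <= l. *)
Definition Ominus (j : nat) (l : 'I_N) : nat :=
  \max_(n < N | if piter n l is Some k then (j <= k)%N else false) n.

(* p^{O_-^j(l)}(l) *)
Definition pO (j : nat) (l : 'I_N) : 'I_N := ppow (Ominus j l) l.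

(* {i, s(i), ..., l} for l = s^m(i) *)
Definition schain (i l : 'I_N) : {set 'I_N} :=
  [set k : 'I_N | (k <= l)%N && [exists n : 'I_N, siter n i == Some k]].

Definition evec (k : 'I_N) : 'cV[int]_N := delta_mx k 0.

(* e_[i,l] for l = s^m(i) *)
Definition eint (i l : 'I_N) : 'cV[int]_N := \sum_(k in schain i l) evec k.

(* Leading terms for the reverse lexicographic order, under which 0 is the     *)
(* smallest exponent.                                                          *)
Definition rlex_lt (m' m : 'X_{1..N}) : bool :=
  [exists j : 'I_N, (m' j < m j)%N &&
     [forall k : 'I_N, (j < k)%N ==> (m' k == m k)]].

Definition rlex_max (m1 m2 : 'X_{1..N}) : 'X_{1..N} :=
  if rlex_lt m1 m2 then m2 else m1.

Definition lead_mnm (f : {mpoly K[N]}) : 'X_{1..N} :=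
  \big[rlex_max/0%MM]_(m <- msupp f) m.

Definition lead_coeff (f : {mpoly K[N]}) : K := f@_(lead_mnm f).

Definition lead_exp (f : {mpoly K[N]}) : 'cV[int]_N :=
  \col_k (lead_mnm f k)%:Z.

(* Specifies y i l = y_[i,l] for l = s^m(i), m >= 0; the other values of y     *)
(* are unconstrained.                                                          *)
Definition interval_primes (y : 'I_N -> 'I_N -> {mpoly K[N]}) : Prop :=
  forall (i l : 'I_N) (m : nat), siter m i = Some l ->
    [/\ homogeneous_poisson_prime (Rint i l.+1) (y i l),
        lead_coeff (y i l) = 1
      & lead_exp (y i l) = eint i l].

Variable y : 'I_N -> 'I_N -> {mpoly K[N]}.

(* y_[j,k], with value 1 on the empty interval. *)
Definition yint (j k : 'I_N) : {mpoly K[N]} := if (j <= k)%N then y j k else 1.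

(* In the definitions below, i and m stand for the interval [i, s^m(i)], and   *)
(* are used when m > 0 and s^m(i) is finite.                                   *)

Definition uelt (i : 'I_N) (m : nat) : {mpoly K[N]} :=
  yint i (spow m.-1 i) * yint (spow 1 i) (spow m i)
  - yint (spow 1 i) (spow m.-1 i) * yint i (spow m i).

Definition pi_coeff (i : 'I_N) (m : nat) : K := lead_coeff (uelt i m).

Definition fvec (i : 'I_N) (m : nat) : 'cV[int]_N := lead_exp (uelt i m).

Definition Pset (i : 'I_N) (m : nat) : {set 'I_N} :=
  [set k : 'I_N | [&& (i <= k <= spow m i)%N,
                      k \notin schain i (spow m i) & s_gt k (spow m i)]].

Definition is_gvec (i : 'I_N) (m : nat) (g : 'cV[int]_N) : Prop :=
  exists mult : 'I_N -> nat,
    g = \sum_(k in Pset i m) evec k *+ mult k /\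
    fvec i m = \sum_(k in Pset i m) eint (pO i.+1 k) k *+ mult k.

Definition Ygen (i : 'I_N) (m : nat) (k : 'I_N) : {mpoly K[N]} :=
  if k == i then yint i (spow m.-1 i)
  else if k == spow m i then yint i (spow m i)
  else yint (pO i.+1 k) k.

(* Y_[i,s^m(i)], with values in Fract(R); coordinates of v outside             *)
(* [i, s^m(i)] are ignored.                                                    *)
Definition Yhom (i : 'I_N) (m : nat) (v : 'cV[int]_N) :
    {fraction {mpoly K[N]}} :=
  \prod_(k : 'I_N | (i <= k <= spow m i)%N) (tofrac (Ygen i m k)) ^ (v k 0).

End PCGLTheory.

(* Main.v *)
Require Import Defs.
From mathcomp Require Import all_boot all_order all_algebra.
From mathcomp Require Import mpoly ring zify.
From Stdlib Require Import Classical.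

Set Implicit Arguments.
Unset Strict Implicit.
Unset Printing Implicit Defensive.

Import GRing.Theory.
Local Open Scope ring_scope.

(** Write [y1] for [y_[s(i), s^(m-1)(i)]] (or [1] if [m = 1]), [y0] for
    [y_[i, s^(m-1)(i)]], [Y1] for [y_[s(i), s^m(i)]], [Y0] for [y_[i, s^m(i)]] and
    [l] for [s^m(i)], so that [u = y0 Y1 - y1 Y0].  The theorem is this equation
    solved for [Y1], once one knows that [u] is exactly the product of prime
    elements [Y(g)], without a scalar factor.  Two things must be shown: that [u]
    is a product of the prime elements indexed by [P_[i, l]] up to a scalar, and
    that the scalar is [1].

    The tool for the first is [normal_coef]: if a torus eigenvector [a] is
    Poisson-normal with respect to [x_t], its coefficients in [x_t] are, up to
    nonzero scalars, the iterates of the locally nilpotent derivation [delta_t]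
    on the top coefficient.  In degree one this forces the recursion
    [y_[q, t] = y_[q, p(t)] x_t - delta_t(y_[q, p(t)]) / lambda_t]
    ([recursive_all]).  Because [delta_t] maps [x_j] to later variables, this
    recursion is inherited by coefficients of the first variable; so the
    prime elements of truncated intervals are such coefficients of prime elements
    of the extension, and they are normal on every interval algebra that contains
    no further element of their class on either side ([yrec_normal]).  Comparing
    degrees in [x_t] with degrees for the filtration by the kernels of the powers
    of [delta_t], one finds by induction that every normal eigenvector of an
    interval algebra is a product of these prime elements ([normal_factorization]).

    The recursion gives [u = (y1 delta_l(y0) - y0 delta_l(y1)) / lambda_l].  Hence
    [u] involves neither [x_i] nor [x_l], it is normal, and [delta_l] kills it
    ([step_u]).  The kernel of [delta_l] is closed under factors and does not
    contain [y1], which is thereby excluded from the factorization of [u]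
    ([u_factorization]); the remaining primes are those indexed by [P_[i, l]].

    For the scalar, the products [u_[i, s^m(i)] u_[s(i), s^(m-1)(i)]] and
    [u_[i, s^(m-1)(i)] u_[s(i), s^m(i)]] are congruent modulo [y1].  The leading
    monomials of all these [u] avoid the variables of the chain of [i], whereas
    that of [y1] does not.  So the two leading coefficients agree, and the
    normalization for [m = 1] propagates ([lead_coeff_u]). *)

(** * Locally nilpotent derivations *)

Section LocallyNilpotent.

Variables (K : fieldType) (N : nat) (B : {pred {mpoly K[N]}}).
Variable d : {mpoly K[N]} -> {mpoly K[N]}.
Hypothesis charK : [pchar K] =i pred0.
Hypothesis d_der : derivation_on B d.
Hypothesis d_nil : locally_nilpotent_on B d.
Hypothesis B1 : 1 \in B.
Hypothesis BM : forall a b, a \in B -> b \in B -> a * b \in B.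

Implicit Types a b : {mpoly K[N]}.

Lemma natmul_eq0 n a : (a *+ n == 0) = (n == 0%N) || (a == 0).
Proof.
rewrite -scaler_nat scaler_eq0; congr (_ || _).
have := pcharf0P K; rewrite /= => H; exact: (proj1 H charK).
Qed.

Lemma der0 : d 0 = 0.
Proof.
case: d_der => _ dlin _; have := dlin (-1) 1 1 B1 B1.
by rewrite scaleN1r addNr scaleN1r addNr.
Qed.

Lemma iter_der0 n : iter n d 0 = 0.
Proof. by elim: n => //= n ->; exact: der0. Qed.

Lemma iter_der_mem n a : a \in B -> iter n d a \in B.
Proof. by move=> aB; elim: n => //= n IH; case: d_der => + _ _; exact. Qed.

Lemma der_add a b : a \in B -> b \in B -> d (a + b) = d a + d b.
Proof. by case: d_der => _ + _ aB bB => /(_ 1 a b aB bB); rewrite !scale1r. Qed.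

Lemma iter_derD n a b : a \in B -> b \in B ->
  iter n d (a + b) = iter n d a + iter n d b.
Proof.
by move=> aB bB; elim: n => //= n ->; rewrite der_add ?iter_der_mem.
Qed.

(** Leibniz' rule, of which only the term with both factors differentiated as
    often as possible survives. *)
Lemma iter_der_top n m a b : a \in B -> b \in B ->
  iter n.+1 d a = 0 -> iter m.+1 d b = 0 ->
  iter (n + m) d (a * b) = (iter n d a * iter m d b) *+ 'C(n + m, n).
Proof.
have dM : forall x z, x \in B -> z \in B -> d (x * z) = d x * z + x * d z.
  by case: d_der.
move eD: (n + m)%N => D; elim: D n m a b eD => [|D IH] n m a b eD aB bB da db.
  by move/eqP: eD; rewrite addn_eq0 => /andP[/eqP -> /eqP ->].
have dB x : x \in B -> d x \in B by exact: (@iter_der_mem 1).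
rewrite iterSr dM // iter_derD ?BM ?dB //.
case: n eD da => [|n] eD da.
  have da0 : d a = 0 by [].
  rewrite add0n in eD; subst m.
  rewrite da0 mul0r iter_der0 add0r (IH 0%N D) ?dB -?iterSr //.
  by rewrite !bin0.
case: m eD db => [|m] eD db.
  have db0 : d b = 0 by [].
  move: eD; rewrite addn0 => -[eD]; subst D.
  rewrite db0 mulr0 iter_der0 addr0 (IH n 0%N) ?addn0 ?dB -?iterSr //.
  by rewrite !binn.
have e1 : (n + m.+1)%N = D by move: eD; rewrite addSn => -[].
have e2 : (n.+1 + m)%N = D by rewrite addSnnS.
rewrite (IH n m.+1) ?(IH n.+1 m) ?dB -?iterSr //.
by rewrite binS mulrnDr addrC.
Qed.

(** The degree of [a] for the filtration by the kernels of the powers of [d]. *)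
Definition nil_degree a n := iter n d a != 0 /\ iter n.+1 d a = 0.

Lemma nil_degree_inj a n m : nil_degree a n -> nil_degree a m -> n = m.
Proof.
suff le x z : nil_degree a x -> nil_degree a z -> (x <= z)%N.
  by move=> Hn Hm; apply/eqP; rewrite eqn_leq !le.
case=> x0 _ [_ z1]; rewrite leqNgt; apply/negP => lt.
move: x0; rewrite -(subnK lt) iterD z1 iter_der0; by rewrite eqxx.
Qed.

Lemma nil_degree_exists a : a \in B -> a != 0 -> exists n, nil_degree a n.
Proof.
move=> aB a0; have [n] := d_nil aB; elim: n => [/eqP|n IH an]; first by rewrite (negbTE a0).
by have [/eqP/IH //|an0] := boolP (iter n d a == 0); exists n.
Qed.

Lemma nil_degreeM a b n m : a \in B -> b \in B ->
  nil_degree a n -> nil_degree b m -> nil_degree (a * b) (n + m).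
Proof.
move=> aB bB [an an1] [bm bm1]; split.
  rewrite iter_der_top // natmul_eq0 negb_or mulf_neq0 // andbT.
  by rewrite -lt0n bin_gt0 leq_addr.
have an2 : iter n.+2 d a = 0 by rewrite iterS an1 der0.
by rewrite -addSn iter_der_top // an1 mul0r mul0rn.
Qed.

Lemma nil_degreeX a n : a \in B -> nil_degree a 1 -> nil_degree (a ^+ n) n.
Proof.
move=> aB da; elim: n => [|n IH].
  rewrite expr0; split; rewrite /= ?oner_eq0 //.
  case: d_der => _ _ /(_ 1 1 B1 B1); rewrite !mulr1 mul1r => e.
  by apply/(addIr (d 1)); rewrite add0r -e.
rewrite exprS -add1n; apply: nil_degreeM => //.
by elim: (n) => [|k IHk]; rewrite ?expr0 // exprS BM.
Qed.

(** The kernel of [d] is factorially closed: degrees add up. *)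
Lemma der_factor a b : a \in B -> b \in B -> a * b != 0 ->
  d (a * b) = 0 -> d a = 0.
Proof.
move=> aB bB; rewrite mulf_eq0 negb_or => /andP[a0 b0] dab.
have [n an] := nil_degree_exists aB a0; have [m bm] := nil_degree_exists bB b0.
have ab0 : nil_degree (a * b) 0 by split; rewrite //= mulf_neq0.
have /eqP := nil_degree_inj (nil_degreeM aB bB an bm) ab0.
by rewrite addn_eq0 => /andP[/eqP n0 _]; rewrite n0 in an; case: an.
Qed.

(** A nonzero multiple of [a] has at least the degree of [a], whereas [d]
    lowers the degree. *)
Lemma der_eigen a b : a \in B -> b \in B -> d a = a * b -> d a = 0.
Proof.
move=> aB bB dab; apply/eqP; apply/negPn/negP => da0.
have := da0; rewrite {1}dab mulf_eq0 negb_or => /andP[a0 b0].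
have [n an] := nil_degree_exists aB a0; have [m bm] := nil_degree_exists bB b0.
have := nil_degreeM aB bB an bm; rewrite -dab => dan.
case: n an dan => [|n] [an an1] dan; first by rewrite /= in an1; rewrite an1 eqxx in da0.
have dan' : nil_degree (d a) n by split; rewrite -iterSr.
by have := nil_degree_inj dan dan' => /(congr1 (leq n.+1)); rewrite leq_addr ltnn.
Qed.

End LocallyNilpotent.

(** * Leading terms in the reverse lexicographic order *)

Section LeadingTerm.

Variables (K : fieldType) (N : nat).
Implicit Types (a b : {mpoly K[N]}) (m : 'X_{1..N}).

Lemma rlex_ltxx m : rlex_lt m m = false.
Proof. by apply/existsP => -[j /andP[]]; rewrite ltnn. Qed.

Lemma rlex_ltP m' m : reflect (exists2 j : 'I_N, (m' j < m j)%N &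
  forall k : 'I_N, (j < k)%N -> m' k = m k) (rlex_lt m' m).
Proof.
apply: (iffP existsP) => -[j].
  by case/andP=> lt /forallP H; exists j => // k /(implyP (H k))/eqP.
by move=> lt H; exists j; rewrite lt; apply/forallP => k; apply/implyP => /H ->.
Qed.

Lemma rlex_lt_trans m1 m2 m3 : rlex_lt m1 m2 -> rlex_lt m2 m3 -> rlex_lt m1 m3.
Proof.
move=> /rlex_ltP[j lj Hj] /rlex_ltP[k lk Hk]; apply/rlex_ltP.
have [ltjk|ltkj|/val_inj ejk] := ltngtP j k.
- exists k; first by rewrite Hj.
  by move=> x kx; rewrite Hj ?Hk // (ltn_trans ltjk).
- exists j; first by rewrite -Hk.
  by move=> x kx; rewrite Hj ?Hk // (ltn_trans ltkj).
subst k; exists j; first exact: ltn_trans lk.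
by move=> x kx; rewrite Hj ?Hk.
Qed.

Lemma rlex_ltNge m1 m2 : rlex_lt m1 m2 -> rlex_lt m2 m1 = false.
Proof.
move=> l1; apply: (introF idP) => l2; have := rlex_lt_trans l1 l2.
by rewrite rlex_ltxx.
Qed.

Lemma rlex_total m1 m2 : m1 != m2 -> rlex_lt m1 m2 || rlex_lt m2 m1.
Proof.
move=> ne; have [i0 ni0] : exists i, m1 i != m2 i.
  apply/existsP; rewrite -negb_forall; apply: contra ne => /forallP H.
  by apply/eqP/mnmP => i; apply/eqP.
case: (arg_maxnP (P := fun i => m1 i != m2 i) (fun i : 'I_N => val i) ni0) => j nj Hj.
have up (k : 'I_N) : (j < k)%N -> m1 k = m2 k.
  by move=> jk; apply/eqP/negPn/negP => /Hj; rewrite /= leqNgt jk.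
apply/orP; case: (ltngtP (m1 j) (m2 j)) nj => // lt _; [left|right];
  by apply/rlex_ltP; exists j => // k /up.
Qed.

Lemma rlex_ltD m1 m2 m : rlex_lt (m + m1)%MM (m + m2)%MM = rlex_lt m1 m2.
Proof.
apply/rlex_ltP/rlex_ltP => -[j lj Hj]; exists j; move: lj;
  rewrite ?mnmDE ?ltn_add2l // => _ k /Hj; rewrite ?mnmDE; first by move/addnI.
by move->.
Qed.

Definition is_lead a m :=
  m \in msupp a /\ forall m', m' \in msupp a -> m' = m \/ rlex_lt m' m.

Lemma is_lead_inj a m1 m2 : is_lead a m1 -> is_lead a m2 -> m1 = m2.
Proof.
move=> [in1 H1] [in2 H2]; have [//|l1] := H1 _ in2; have [//|l2] := H2 _ in1.
by have := rlex_lt_trans l1 l2; rewrite rlex_ltxx.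
Qed.

Lemma lead_mnmP a : a != 0 -> is_lead a (lead_mnm a).
Proof.
move=> a0; rewrite /lead_mnm /is_lead; have: msupp a != [::] by rewrite msupp_eq0.
have min0 m : m = 0%MM \/ rlex_lt 0%MM m.
  have [->|ne] := eqVneq m 0%MM; [by left|right].
  by have /orP[/rlex_ltP[j]|//] := rlex_total ne; rewrite mnm0E.
elim: (msupp a) => // x s IH _; rewrite big_cons /rlex_max.
have [->|s0] := eqVneq s [::].
  rewrite big_nil; have [->|lt] := min0 x.
    by rewrite rlex_ltxx inE eqxx; split=> // m'; rewrite inE => /eqP ->; left.
  rewrite (rlex_ltNge lt).
  by rewrite inE eqxx; split=> // m'; rewrite inE => /eqP ->; left.
have [ins Hs] := IH s0; set t := \big[_/_]_(_ <- _) _ in ins Hs *.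
case: ifP => lt.
  rewrite inE ins orbT; split=> // m'; rewrite inE => /orP[/eqP ->|/Hs //].
  by right.
rewrite inE eqxx; split=> // m'; rewrite inE => /orP[/eqP ->|/Hs H]; first by left.
have [xt|/rlex_total] := eqVneq x t; first by move: H; rewrite xt.
rewrite lt /= => lt'; right; case: H => [->//|H].
exact: rlex_lt_trans lt'.
Qed.

Lemma lead_mnm_eq a m : is_lead a m -> lead_mnm a = m.
Proof.
move=> H; apply: (is_lead_inj (lead_mnmP _) H); apply/eqP => a0.
by case: H; rewrite a0 msupp0.
Qed.

Lemma lead_coeff_neq0 a : a != 0 -> lead_coeff a != 0.
Proof. by move=> /lead_mnmP[]; rewrite mcoeff_msupp. Qed.

(** The order is compatible with addition of exponents, so that only the two
    leading terms contribute to the sum of the leading monomials. *)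
Lemma lead_mul a b : a != 0 -> b != 0 ->
  lead_mnm (a * b) = (lead_mnm a + lead_mnm b)%MM /\
  lead_coeff (a * b) = lead_coeff a * lead_coeff b.
Proof.
move=> a0 b0; have [ina Ha] := lead_mnmP a0; have [inb Hb] := lead_mnmP b0.
have addlt m1 m2 : m1 \in msupp a -> m2 \in msupp b ->
    (m1 = lead_mnm a /\ m2 = lead_mnm b) \/
    rlex_lt (m1 + m2)%MM (lead_mnm a + lead_mnm b)%MM.
  move=> /Ha[->|l1] /Hb[->|l2]; [by left|by right; rewrite rlex_ltD|right..].
    by rewrite ![(_ + lead_mnm b)%MM]addmC rlex_ltD.
  apply: (@rlex_lt_trans _ (lead_mnm a + m2)%MM); last by rewrite rlex_ltD.
  by rewrite ![(_ + m2)%MM]addmC rlex_ltD.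
have E : (a * b)@_(lead_mnm a + lead_mnm b)%MM = lead_coeff a * lead_coeff b.
  have -> : a * b = (\sum_(m <- msupp a) a@_m *: 'X_[m]) *
    (\sum_(m <- msupp b) b@_m *: 'X_[m]) by rewrite -!mpolyE.
  rewrite mulr_suml raddf_sum /=.
  rewrite (bigD1_seq (lead_mnm a)) ?msupp_uniq //= mulr_sumr raddf_sum /=.
  rewrite (bigD1_seq (lead_mnm b)) ?msupp_uniq //=.
  rewrite -scalerAl -scalerAr -mpolyXD scalerA mcoeffZ mcoeffX eqxx mulr1.
  rewrite [X in _ + X + _]big1_seq ?[X in _ + _ + X]big1_seq ?addr0 //.
    move=> m1 /andP[ne in1]; rewrite mulr_sumr raddf_sum /= big1_seq // => m2 in2.
    rewrite -scalerAl -scalerAr -mpolyXD !mcoeffZ mcoeffX.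
    case: eqP => [eq|]; rewrite ?mulr0 //.
    have [[e _]|] := addlt m1 m2 in1 in2; first by rewrite e eqxx in ne.
    by rewrite eq rlex_ltxx.
  move=> m2 /andP[ne in2].
  rewrite -scalerAl -scalerAr -mpolyXD !mcoeffZ mcoeffX.
  case: eqP => [eq|]; rewrite ?mulr0 //.
  have [[_ e]|] := addlt _ m2 ina in2; first by rewrite e eqxx in ne.
  by rewrite eq rlex_ltxx.
have L : lead_mnm (a * b) = (lead_mnm a + lead_mnm b)%MM.
  apply: lead_mnm_eq; split.
    by rewrite mcoeff_msupp E mulf_neq0 ?lead_coeff_neq0.
  move=> m' /msuppM_le /allpairsP[[m1 m2] /= [in1 in2 ->]].
  by have [[-> ->]|] := addlt _ _ in1 in2; [left|right].
by split=> //; rewrite {1}/lead_coeff L.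
Qed.

Lemma lead_mnmC (c : K) : c != 0 -> lead_mnm c%:MP_[N] = 0%MM /\ lead_coeff c%:MP_[N] = c.
Proof.
move=> c0; have L : lead_mnm c%:MP_[N] = 0%MM.
  apply: lead_mnm_eq; rewrite /is_lead msuppC (negbTE c0) inE eqxx; split=> // m'.
  by rewrite inE => /eqP; left.
by split=> //; rewrite /lead_coeff L mcoeffC eqxx mulr1.
Qed.

Lemma lead_mnmX m : lead_mnm ('X_[m] : {mpoly K[N]}) = m /\
  lead_coeff ('X_[m] : {mpoly K[N]}) = 1.
Proof.
have L : lead_mnm ('X_[m] : {mpoly K[N]}) = m.
  apply: lead_mnm_eq; rewrite /is_lead msuppX inE eqxx; split=> // m'.
  by rewrite inE => /eqP; left.
by split=> //; rewrite /lead_coeff L mcoeffX eqxx.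
Qed.

Lemma lead_exprn a n : a != 0 ->
  lead_mnm (a ^+ n) = (lead_mnm a *+ n)%MM /\ lead_coeff (a ^+ n) = lead_coeff a ^+ n.
Proof.
move=> a0; elim: n => [|n [IH1 IH2]].
  by rewrite !expr0 mulm0n -mpolyC1; apply: lead_mnmC; rewrite oner_eq0.
have [L C] := lead_mul a0 (expf_neq0 n a0).
by rewrite !exprS L C IH1 IH2 mulmS.
Qed.

Lemma lead_prod (I : finType) (P : pred I) (F : I -> {mpoly K[N]}) :
  (forall i, P i -> F i != 0) -> (forall i, P i -> lead_coeff (F i) = 1) ->
  [/\ \prod_(i | P i) F i != 0,
      forall k, lead_mnm (\prod_(i | P i) F i) k = (\sum_(i | P i) lead_mnm (F i) k)%N
    & lead_coeff (\prod_(i | P i) F i) = 1].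
Proof.
move=> F0 F1; pose Q a (f : 'I_N -> nat) :=
  [/\ a != 0, forall k, lead_mnm a k = f k & lead_coeff a = 1].
suff: Q (\prod_(i | P i) F i) (fun k => (\sum_(i | P i) lead_mnm (F i) k)%N) by [].
rewrite unlock /reducebig; elim: (index_enum I) => [|i s [IH1 IH2 IH3]] /=.
  have [L C] := @lead_mnmC 1 (oner_neq0 K); rewrite mpolyC1 in L C.
  by split; rewrite ?oner_eq0 // => k; rewrite L mnm0E.
case: ifP => // Pi; have [L C] := lead_mul (F0 _ Pi) IH1.
split; first by rewrite mulf_neq0 ?F0.
  by move=> k; rewrite L mnmDE IH2.
by rewrite C IH3 F1 ?mulr1.
Qed.

(** If the leading coefficients of [a] and [b] differed, the leading monomial of
    [a - b] would be that of [a] or that of [b].  Neither contains the variable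
    [x], but the leading monomial of a nonzero multiple of [c] does. *)
Lemma lead_coeff_congr a b c w (x : 'I_N) : a != 0 -> b != 0 ->
  a - b = c * w -> lead_mnm a x = 0%N -> lead_mnm b x = 0%N ->
  (0 < lead_mnm c x)%N -> lead_coeff a = lead_coeff b.
Proof.
move=> a0 b0 ab ax bx cx; have [ina Ha] := lead_mnmP a0; have [inb Hb] := lead_mnmP b0.
have [ab0|ab0] := eqVneq (a - b) 0.
  by move/eqP: ab0; rewrite subr_eq0 => /eqP ->.
have dx : (0 < lead_mnm (a - b) x)%N.
  have := ab0; rewrite ab mulf_eq0 negb_or => /andP[c0 w0].
  by have [-> _] := lead_mul c0 w0; rewrite mnmDE ltn_addr.
have notl m : m x = 0%N -> ~ is_lead (a - b) m.
  by move=> mx /lead_mnm_eq e; rewrite e mx in dx.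
have low m' : m' \in msupp (a - b) ->
    (m' = lead_mnm a \/ rlex_lt m' (lead_mnm a)) \/
    (m' = lead_mnm b \/ rlex_lt m' (lead_mnm b)).
  by move/msuppB_le; rewrite mem_cat => /orP[/Ha|/Hb]; [left|right].
have [eab|/rlex_total/orP[lt|lt]] := eqVneq (lead_mnm a) (lead_mnm b).
- apply/eqP; rewrite -subr_eq0; apply/negPn/negP => ne; apply: (notl _ ax); split.
    by rewrite mcoeff_msupp mcoeffB {2}eab.
  by move=> m' /low; rewrite -eab => -[].
- case: (notl _ bx); split.
    rewrite mcoeff_msupp mcoeffB (@memN_msupp_eq0 _ _ a) ?sub0r ?oppr_eq0 -?mcoeff_msupp //.
    apply/negP => /Ha[e|]; last by rewrite rlex_ltNge.
    by rewrite e rlex_ltxx in lt.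
  move=> m' /low[|//] H; right; case: H => [-> //|H]; exact: rlex_lt_trans lt.
case: (notl _ ax); split.
  rewrite mcoeff_msupp mcoeffB (@memN_msupp_eq0 _ _ b) ?subr0 -?mcoeff_msupp //.
  apply/negP => /Hb[e|]; last by rewrite rlex_ltNge.
  by rewrite e rlex_ltxx in lt.
move=> m' /low[//|] H; right; case: H => [-> //|H]; exact: rlex_lt_trans lt.
Qed.

End LeadingTerm.

(** * Interval subalgebras and expansion in one variable *)

Section Interval.

Variables (K : fieldType) (N : nat).
Implicit Types (a b f : {mpoly K[N]}) (m : 'X_{1..N}) (t i : 'I_N).

Lemma RintP j k f : reflect (forall m, m \in msupp f -> forall i, m i != 0%N ->
  (j <= i < k)%N) (f \in Rint j k).
Proof.
apply: (iffP allP) => H m mf.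
  by move=> i mi; have /forallP/(_ i)/implyP/(_ mi) := H m mf.
by apply/forallP => i; apply/implyP => /(H m mf).
Qed.

Lemma Rint_sub j k j' k' f : (j' <= j)%N -> (k <= k')%N ->
  f \in Rint j k -> f \in Rint j' k'.
Proof.
move=> jj kk /RintP H; apply/RintP => m mf i mi.
by have /andP[ji ik] := H m mf i mi; rewrite (leq_trans jj) // (leq_trans ik).
Qed.

Lemma Rint1 j k : 1 \in Rint (K := K) (N := N) j k.
Proof.
apply/RintP => m; rewrite -mpolyC1 msuppC oner_eq0 inE => /eqP -> i.
by rewrite mnm0E.
Qed.

Lemma Rint_lin j k (c : K) a b :
  a \in Rint j k -> b \in Rint j k -> c *: a + b \in Rint j k.
Proof.
move=> /RintP Ha /RintP Hb; apply/RintP => m /msuppD_le; rewrite mem_cat.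
by move=> /orP[/msuppZ_le/Ha|/Hb].
Qed.

Lemma RintM j k a b : a \in Rint j k -> b \in Rint j k -> a * b \in Rint j k.
Proof.
move=> /RintP Ha /RintP Hb; apply/RintP => m /msuppM_le.
move=> /allpairsP[[m1 m2] /= [in1 in2 ->]] i; rewrite mnmDE addn_eq0 negb_and.
by move=> /orP[/(Ha _ in1)|/(Hb _ in2)].
Qed.

Lemma Rint0 j k : 0 \in Rint (K := K) (N := N) j k.
Proof. by rewrite -[0](addNr 1) -scaleN1r Rint_lin ?Rint1. Qed.

Lemma RintD j k a b : a \in Rint j k -> b \in Rint j k -> a + b \in Rint j k.
Proof. by rewrite -{2}[a]scale1r; exact: Rint_lin. Qed.

Lemma RintZ j k (c : K) a : a \in Rint j k -> c *: a \in Rint j k.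
Proof. by move=> aR; rewrite -[c *: a]addr0 Rint_lin ?Rint0. Qed.

Lemma RintN j k a : a \in Rint j k -> - a \in Rint j k.
Proof. by rewrite -scaleN1r; exact: RintZ. Qed.

Lemma RintB j k a b : a \in Rint j k -> b \in Rint j k -> a - b \in Rint j k.
Proof. by move=> aR bR; rewrite RintD ?RintN. Qed.

Lemma RintX j k a n : a \in Rint j k -> a ^+ n \in Rint j k.
Proof. by move=> aR; elim: n => [|n IH]; rewrite ?expr0 ?Rint1 // exprS RintM. Qed.

Lemma Rint_sum j k (I : Type) (r : seq I) (P : pred I) (F : I -> {mpoly K[N]}) :
  (forall x, P x -> F x \in Rint j k) -> \sum_(x <- r | P x) F x \in Rint j k.
Proof. by move=> H; elim/big_ind: _ => //; [exact: Rint0|exact: RintD]. Qed.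

Lemma Rint_prod j k (I : Type) (r : seq I) (P : pred I) (F : I -> {mpoly K[N]}) :
  (forall x, P x -> F x \in Rint j k) -> \prod_(x <- r | P x) F x \in Rint j k.
Proof. by move=> H; elim/big_ind: _ => //; [exact: Rint1|exact: RintM]. Qed.

Lemma Rint_var j k i : (j <= i < k)%N -> 'X_i \in Rint (K := K) j k.
Proof.
move=> ik; apply/RintP => m; rewrite msuppX inE => /eqP -> i'.
by rewrite mnm1E; have [<-|] := eqVneq i i'.
Qed.

Lemma X_neq0 t : 'X_t != 0 :> {mpoly K[N]}.
Proof. by rewrite -msupp_eq0 msuppX. Qed.

Lemma Rint_ind (P : {mpoly K[N]} -> Prop) j k :
  P 1 -> (forall (c : K) a b, a \in Rint j k -> b \in Rint j k ->
    P a -> P b -> P (c *: a + b)) ->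
  (forall a b, a \in Rint j k -> b \in Rint j k -> P a -> P b -> P (a * b)) ->
  (forall i, (j <= i < k)%N -> P 'X_i) ->
  forall f, f \in Rint j k -> P f.
Proof.
move=> P1 Plin PM PX f /RintP Hf; rewrite [f]mpolyE.
have P0 : P 0.
  by have := Plin (-1) 1 1 (Rint1 _ _) (Rint1 _ _) P1 P1; rewrite scaleN1r addNr.
pose Q a := a \in Rint j k /\ P a.
suff [] : Q (\sum_(m <- msupp f) f@_m *: 'X_[m]) by [].
have QM a b : Q a -> Q b -> Q (a * b).
  by move=> [aR Pa] [bR Pb]; split; [exact: RintM|exact: PM].
rewrite big_seq; elim/big_ind: _ => [|a b [aR Pa] [bR Pb]|m mf].
- by split; rewrite ?Rint0.
- by rewrite -[a]scale1r; split; [exact: Rint_lin|exact: Plin].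
have [XR PXm] : Q 'X_[m].
  rewrite mpolyXE_id; elim/big_ind: _ => // [|i _]; first by split; rewrite ?Rint1.
  have [->|mi] := eqVneq (m i) 0%N; first by rewrite expr0; split; rewrite ?Rint1.
  have ik := Hf _ mf _ mi.
  elim: (m i) => [|n IH]; first by rewrite expr0; split; rewrite ?Rint1.
  by rewrite exprS; apply: QM => //; split; [exact: Rint_var|exact: PX].
rewrite -[_ *: _]addr0; split.
  by apply: Rint_lin; rewrite ?Rint0.
by apply: Plin; rewrite ?Rint0.
Qed.

Fact uni_key : unit. Proof. exact: tt. Qed.

(** [f] as a polynomial in the single variable [x_t]; its coefficients do not
    contain [x_t]. *)
Definition uni t : {mpoly K[N]} -> {poly {mpoly K[N]}} :=
  locked_with uni_key
    (mmap (polyC \o @mpolyC N K) (fun i => if i == t then 'X else ('X_i)%:P)).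

Lemma uniE t : uni t =
  mmap (polyC \o @mpolyC N K) (fun i => if i == t then 'X else ('X_i)%:P).
Proof. by rewrite /uni unlock. Qed.

Lemma uni1 t : uni t 1 = 1.
Proof. by rewrite uniE; exact: rmorph1. Qed.

Lemma uniD t a b : uni t (a + b) = uni t a + uni t b.
Proof. by rewrite uniE; exact: raddfD. Qed.

Lemma uniM t a b : uni t (a * b) = uni t a * uni t b.
Proof. by rewrite uniE; exact: rmorphM. Qed.

Lemma uniZ t (c : K) f : uni t (c *: f) = c%:MP *: uni t f.
Proof. by rewrite uniE mmapZ /= -mul_polyC. Qed.

Lemma uniX t i : uni t 'X_i = if i == t then 'X else ('X_i)%:P.
Proof. by rewrite uniE mmapX mmap1U. Qed.

Lemma uniC t (c : K) : uni t c%:MP = (c%:MP)%:P.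
Proof. by rewrite uniE mmapC. Qed.

(** Evaluation at [0] sets [x_t = 0]. *)
Lemma uni_at0 t f m : m t != 0%N -> ((uni t f).[0])@_m = 0.
Proof.
move=> mt; rewrite uniE /mmap horner_sum raddf_sum /= big1 // => m' _.
rewrite hornerM hornerC mul_mpolyC mcoeffZ /mmap1 horner_prod.
rewrite (bigD1 t) //= eqxx hornerXn.
have [e|ne] := eqVneq (m' t) 0%N; last first.
  by rewrite expr0n (negbTE ne) mul0r mcoeff0 mulr0.
rewrite e expr0 mul1r (eq_bigr (fun i => 'X_i ^+ m' i)) => [|i it]; last first.
  by rewrite (negbTE it) -polyC_exp hornerC.
have -> : \prod_(i < N | i != t) 'X_i ^+ m' i = 'X_[m'] :> {mpoly K[N]}.
  by rewrite mpolyXE_id [RHS](bigD1 t) //= e expr0 mul1r.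
rewrite mcoeffX; case: eqP => [em|]; last by rewrite mulr0.
by rewrite -em e in mt.
Qed.

Lemma uniXn t a n : uni t (a ^+ n) = uni t a ^+ n.
Proof. by elim: n => [|n IH]; rewrite ?expr0 ?uni1 // !exprS uniM IH. Qed.

Lemma uni0 t : uni t 0 = 0.
Proof. by rewrite -mpolyC0 uniC mpolyC0 polyC0. Qed.

Lemma all_Rint f : f \in Rint 0 N.
Proof. by apply/RintP => m _ i _; rewrite ltn_ord. Qed.

Lemma uni_eval t f : (uni t f).['X_t] = f.
Proof.
apply: (@Rint_ind (fun f => (uni t f).['X_t] = f) 0 N _ _ _ _ f (all_Rint f)).
- by rewrite uni1 hornerC.
- move=> c a b _ _ Ha Hb; rewrite uniD uniZ hornerD hornerZ.
  by rewrite [X in _ * X]Ha [X in _ + X]Hb mul_mpolyC.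
- by move=> a b _ _ Ha Hb; rewrite uniM hornerM [X in X * _]Ha [X in _ * X]Hb.
by move=> i _; rewrite uniX; case: eqP => [->|_]; rewrite ?hornerX ?hornerC.
Qed.

Lemma uni_inj t : injective (uni t).
Proof. by move=> a b e; rewrite -(uni_eval t a) -(uni_eval t b) e. Qed.

Lemma uni_sum t f n : (size (uni t f) <= n)%N ->
  f = \sum_(i < n) (uni t f)`_i * 'X_t ^+ i.
Proof. by move=> le; rewrite -{1}(uni_eval t f) (horner_coef_wide _ le). Qed.

Lemma uni_free j k t f : f \in Rint j k -> ~~ (j <= t < k)%N -> uni t f = f%:P.
Proof.
move=> fR tR; apply: (@Rint_ind (fun f => uni t f = f%:P) j k _ _ _ _ f fR).
- by rewrite uni1.
- move=> c a b _ _ Ha Hb; rewrite uniD uniZ Ha Hb.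
  by rewrite polyCD -mul_polyC -polyCM mul_mpolyC.
- by move=> a b _ _ Ha Hb; rewrite uniM Ha Hb polyCM.
by move=> i ik; rewrite uniX; case: eqP => [e|//]; rewrite -e ik in tR.
Qed.

Lemma uni_low t b : b \in Rint 0 t -> uni t b = b%:P.
Proof. by move=> bR; rewrite (uni_free bR) // ltnn andbF. Qed.

Lemma uni_neq0 t a : a != 0 -> uni t a != 0.
Proof. by apply: contraNneq => e; apply/eqP/(@uni_inj t); rewrite uni0. Qed.

Lemma uni_const t f : uni t f = f%:P -> forall m, m \in msupp f -> m t = 0%N.
Proof.
move=> e m mf; apply/eqP; apply: contraLR mf => /(uni_at0 f).
by rewrite e hornerC mcoeff_msupp => ->; rewrite eqxx.
Qed.

Lemma Rint_uni j k f :
  (forall t, ~~ (j <= t < k)%N -> uni t f = f%:P) -> f \in Rint j k.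
Proof.
move=> H; apply/RintP => m mf i; apply: contraR => iR.
by rewrite (uni_const (H _ iR) mf).
Qed.

Lemma uni_size1 t f : (size (uni t f) <= 1)%N -> uni t f = f%:P.
Proof.
move=> /size1_polyC e; rewrite e; congr (_%:P).
by rewrite -{2}(uni_eval t f) e hornerC coefC.
Qed.

(** Degrees in each variable add up, so divisors involve no new variables. *)
Lemma Rint_divisor j k a b : a != 0 -> a \in Rint j k -> a * b \in Rint j k ->
  b \in Rint j k.
Proof.
move=> a0 aR abR; apply: Rint_uni => t tR; apply: uni_size1.
have := uni_free abR tR; rewrite uniM (uni_free aR tR) => e.
have [b0|b0] := eqVneq (uni t b) 0; first by rewrite b0 size_poly0.
have := congr1 (fun p : {poly _} => size p) e; rewrite size_Cmul // => ->.
by rewrite size_polyC leq_b1.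
Qed.

Lemma uni_coef_Rint j t f n : f \in Rint j t.+1 -> (uni t f)`_n \in Rint j t.
Proof.
move=> fR.
apply: (@Rint_ind (fun f => forall n, (uni t f)`_n \in Rint j t) j t.+1 _ _ _ _ f fR n).
- by move=> i; rewrite uni1 coef1; case: eqP; rewrite ?Rint1 ?Rint0.
- move=> c a b _ _ Ha Hb i; rewrite uniD coefD uniZ coefZ mul_mpolyC.
  by rewrite Rint_lin.
- move=> a b _ _ Ha Hb i; rewrite uniM coefM Rint_sum // => i' _.
  by rewrite RintM.
move=> i /andP[ji it] n'; rewrite uniX; case: eqP => [_|ne].
  by rewrite coefX; case: eqP; rewrite ?Rint1 ?Rint0.
rewrite coefC; case: eqP => _; rewrite ?Rint0 // Rint_var // ji /=.
by rewrite ltnS leq_eqVlt in it; case/orP: it => // /eqP/val_inj.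
Qed.

Lemma uni_coefE t n (F : nat -> {mpoly K[N]}) j x :
  (forall x', F x' \in Rint j t) ->
  (uni t (\sum_(x' < n) F x' * 'X_t ^+ x'))`_x = if (x < n)%N then F x else 0.
Proof.
move=> FR; rewrite (big_morph (uni t) (uniD t) (uni0 t)) coef_sum.
have E (x' : 'I_n) : (uni t (F x' * 'X_t ^+ x'))`_x = if x' == x :> nat then F x else 0.
  rewrite uniM uniXn uniX eqxx (uni_free (FR _)); last by rewrite ltnn andbF.
  by rewrite coefCM coefXn eq_sym; case: eqP => [->|]; rewrite ?mulr1 ?mulr0.
rewrite (eq_bigr _ (fun x' _ => E x')); case: ifP => lt.
  rewrite (bigD1 (Ordinal lt)) //= eqxx big1 ?addr0 // => x' /eqP ne.
  by case: eqP => // e; case: ne; apply: val_inj.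
by rewrite big1 // => x' _; case: eqP => // e; rewrite -e ltn_ord in lt.
Qed.

End Interval.

Arguments Rint0 {K N} j k.
Arguments Rint1 {K N} j k.
Arguments uni0 {K N} t.

Section LeadUni.

Variables (K : fieldType) (N : nat).
Implicit Types (a : {mpoly K[N]}) (t : 'I_N).

Lemma Rint_mnm j k a m (i : 'I_N) : a \in Rint j k -> m \in msupp a ->
  ~~ (j <= i < k)%N -> m i = 0%N.
Proof. by move=> /RintP H ma; apply: contraNeq => /(H m ma). Qed.

Lemma Rint_const j k a : (k <= j)%N -> a \in Rint j k -> exists c, a = c%:MP.
Proof.
move=> kj; apply: (@Rint_ind _ _ (fun a => exists c : K, a = c%:MP)).
- by exists 1; rewrite mpolyC1.
- move=> c x z _ _ [c1 ->] [c2 ->]; exists (c * c1 + c2).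
  by rewrite mpolyCD mpolyCM mul_mpolyC.
- by move=> x z _ _ [c1 ->] [c2 ->]; exists (c1 * c2); rewrite mpolyCM.
by move=> i; lia.
Qed.

(** The exponent of the last variable is compared first. *)
Lemma lead_lead_coef t a : a \in Rint 0 t.+1 -> a != 0 ->
  let P := uni t a in
  lead_mnm a = (lead_mnm (lead_coef P) + U_(t) *+ (size P).-1)%MM /\
  lead_coeff a = lead_coeff (lead_coef P).
Proof.
move=> aR a0 P; rewrite lead_coefE; set n := (size P).-1.
have PR x : P`_x \in Rint 0 t by exact: uni_coef_Rint.
have P0 : P != 0 by exact: uni_neq0.
have sP : size P = n.+1 by rewrite /n prednK // lt0n size_poly_eq0.
have Pn : P`_n != 0 by rewrite /n -lead_coefE lead_coef_eq0.
have suppX x m : m \in msupp (P`_x * 'X_t ^+ x) ->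
    m t = x /\ forall i : 'I_N, (t < i)%N -> m i = 0%N.
  rewrite mpolyXn => /msuppM_le/allpairsP[[m1 m2] /= [in1 in2 ->]].
  move: in2; rewrite msuppX inE => /eqP ->; split.
    by rewrite mnmDE mulmnE mnm1E eqxx mul1n (Rint_mnm (PR x) in1) ?ltnn ?andbF.
  move=> i ti; rewrite mnmDE mulmnE mnm1E.
  rewrite (Rint_mnm (PR x) in1) ?(ltnNge i) ?(ltnW ti) ?andbF //.
  by case: eqP => [e|_]; [move: ti; rewrite e ltnn|rewrite mul0n].
set M := (lead_mnm P`_n + U_(t) *+ n)%MM.
have [LM CM] : lead_mnm (P`_n * 'X_t ^+ n) = M /\
    lead_coeff (P`_n * 'X_t ^+ n) = lead_coeff P`_n.
  have [LX CX] := @lead_mnmX K N (U_(t) *+ n)%MM.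
  have X0 : 'X_[(U_(t) *+ n)%MM] != 0 :> {mpoly K[N]} by rewrite -msupp_eq0 msuppX.
  by rewrite mpolyXn; have [-> ->] := lead_mul Pn X0; rewrite LX CX mulr1.
have top0 : P`_n * 'X_t ^+ n != 0 by rewrite mulf_neq0 ?expf_neq0 ?X_neq0.
have [inM HM] := lead_mnmP top0; rewrite LM in inM HM.
have [Mt Mi] := suppX _ _ inM.
set r := \sum_(x < n) P`_x * 'X_t ^+ x.
have aE : a = r + P`_n * 'X_t ^+ n.
  by rewrite {1}(uni_sum (leqnn (size (uni t a)))) -/P sP big_ord_recr.
have rlow m : m \in msupp r -> (m t < n)%N /\ forall i : 'I_N, (t < i)%N -> m i = 0%N.
  move=> /msupp_sum_le/flattenP[s /mapP[x _ es] ms].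
  by move: ms; rewrite es => /suppX[-> H]; split.
have Mr : r@_M = 0.
  by apply: memN_msupp_eq0; apply/negP => /rlow[]; rewrite Mt ltnn.
have aM : a@_M = lead_coeff P`_n by rewrite {1}aE mcoeffD Mr add0r -CM /lead_coeff LM.
have La : lead_mnm a = M.
  apply: lead_mnm_eq; split; first by rewrite mcoeff_msupp aM lead_coeff_neq0.
  move=> m; rewrite aE => /msuppD_le; rewrite mem_cat => /orP[/rlow[lt H]|/HM //].
  right; apply/rlex_ltP; exists t; first by rewrite Mt.
  by move=> k tk; rewrite H // Mi.
by rewrite La {1}/lead_coeff La aM.
Qed.

End LeadUni.

(** * Torus weights and the action of the Lie algebra *)

Section Weights.

Variables (K : fieldType) (r : nat).
Implicit Types (h : {ffun 'I_r -> K}) (u : 'I_r -> int).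

Lemma in_torusP h : reflect (forall i, h i != 0) (in_torus h).
Proof. exact: forallP. Qed.

Lemma in_torusM h h' : in_torus h -> in_torus h' -> in_torus [ffun i => h i * h' i].
Proof.
by move=> /in_torusP H /in_torusP H'; apply/in_torusP => i; rewrite ffunE mulf_neq0.
Qed.

Lemma torus_charM u h h' :
  torus_char u [ffun i => h i * h' i] = torus_char u h * torus_char u h'.
Proof.
rewrite /torus_char -big_split /=; apply: eq_bigr => i _.
by rewrite ffunE expfzMl.
Qed.

Lemma torus_charD u u' h : in_torus h ->
  torus_char (fun i => u i + u' i) h = torus_char u h * torus_char u' h.
Proof.
move=> /in_torusP h0; rewrite /torus_char -big_split /=; apply: eq_bigr => i _.
by rewrite expfzDr.
Qed.

(** Artin's argument for the linear independence of characters: a shortest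
    expression of [chi] by the [t.2] has only one term. *)
Lemma multiplicative_regular_char (chi : {ffun 'I_r -> K} -> K) :
  chi [ffun=> 1] = 1 ->
  (forall h h', in_torus h -> in_torus h' ->
     chi [ffun i => h i * h' i] = chi h * chi h') ->
  torus_regular chi ->
  exists u, forall h, in_torus h -> chi h = torus_char u h.
Proof.
move=> chi1 chiM [w]; elim: {w}(size w) {-2}w (leqnn (size w)) => [|n IH] w.
  case: w => // _ Hw; have t1 : in_torus ([ffun=> 1] : {ffun 'I_r -> K}).
    by apply/in_torusP => i; rewrite ffunE oner_eq0.
  by have /eqP := Hw _ t1; rewrite big_nil chi1 oner_eq0.
case: w => [_|t w /= sz] Hw; first by apply: (IH [::]).
have [Ht|] := classic (forall h, in_torus h -> chi h = torus_char t.2 h).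
  by exists t.2.
move=> /not_all_ex_not[h0 ne'].
have [th0 ne] := imply_to_and _ _ ne'.
have c0 : chi h0 - torus_char t.2 h0 != 0 by rewrite subr_eq0; apply/eqP.
pose c := chi h0 - torus_char t.2 h0.
pose F (s : K * ('I_r -> int)) :=
  (s.1 * (torus_char s.2 h0 - torus_char t.2 h0) / c, s.2).
apply: (IH (map F w)); first by rewrite size_map.
move=> h th; apply: (mulfI c0); rewrite big_map mulr_sumr.
have E : chi h0 * chi h - torus_char t.2 h0 * chi h =
    \sum_(s <- w) s.1 * (torus_char s.2 h0 - torus_char t.2 h0) * torus_char s.2 h.
  rewrite -chiM // Hw ?in_torusM // [chi h]Hw // !big_cons torus_charM.
  rewrite mulrDr mulrCA opprD addrACA subrr add0r mulr_sumr -sumrB.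
  by apply: eq_bigr => s _; rewrite torus_charM; ring.
rewrite mulrBl E; apply: eq_bigr => s _ /=.
by rewrite -/c mulrA; congr (_ * _); rewrite [RHS]mulrC divfK.
Qed.

End Weights.

Section LieAction.

Variables (K : fieldType) (N : nat) (R : PCGL K N).
Implicit Types (a b : {mpoly K[N]}) (m : 'X_{1..N}) (t : 'I_N).
Implicit Types xi h : {ffun 'I_(rk R) -> K}.

Lemma act_lin h (t : K) a b : in_torus h ->
  act h (t *: a + b) = t *: act h a + act (p := R) h b.
Proof. by case: (act_poisson R) => _ _ H _ _; exact: H. Qed.

Lemma act_add h a b : in_torus h -> act h (a + b) = act h a + act (p := R) h b.
Proof. by move=> th; rewrite -{1}[a]scale1r act_lin // scale1r. Qed.

Lemma act0 h : in_torus h -> act (p := R) h 0 = 0.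
Proof. by move=> th; apply: (addrI (act h 0)); rewrite -act_add // !addr0. Qed.

Lemma act_scale h (t : K) a : in_torus h -> act h (t *: a) = t *: act (p := R) h a.
Proof. by move=> th; rewrite -[t *: a]addr0 act_lin // act0 // addr0. Qed.

Lemma actM h a b : in_torus h -> act h (a * b) = act h a * act (p := R) h b.
Proof. by case: (act_poisson R) => _ _ _ H _ /H[]. Qed.

(** The character by which the torus acts on [x_k] is a linear combination of
    matrix coefficients, hence regular. *)
Lemma var_weight (k : 'I_N) : exists u, has_weight (act (p := R)) u 'X_k.
Proof.
have [chi chiP] := act_var R k.
have scaleI (c c' : K) : c *: 'X_k = c' *: 'X_k :> {mpoly K[N]} -> c = c'.
  move/eqP; rewrite -subr_eq0 -scalerBl scaler_eq0 (negbTE (X_neq0 K k)) orbF subr_eq0.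
  by move/eqP.
have [act1 actMM _ _ _] := act_poisson R.
have [n [v [M [v_free [w Xw] M_reg vM]]]] := act_rational R 'X_k.
have [i0 wi0] : exists i0, w i0 != 0.
  apply/existsP; rewrite -negb_forall; apply/negP => /forallP w0.
  have := X_neq0 K k; rewrite Xw big1 ?eqxx // => i _.
  by rewrite (eqP (w0 i)) scale0r.
have chiE h : in_torus h -> chi h = \sum_j w j / w i0 * M i0 j h.
  move=> th; have := chiP h th; rewrite {1}Xw.
  rewrite (big_morph _ (fun x y => act_add x y th) (act0 th)) => e.
  have : \sum_i (chi h * w i - \sum_j w j * M i j h) *: v i = 0.
    under eq_bigr => i _ do rewrite scalerBl -scalerA scaler_suml.
    rewrite sumrB -scaler_sumr -Xw -e; apply/eqP; rewrite subr_eq0; apply/eqP.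
    rewrite exchange_big /=; apply: eq_bigr => j _.
    rewrite act_scale // vM // scaler_sumr; apply: eq_bigr => i _.
    by rewrite scalerA.
  move=> /v_free/(_ i0)/eqP; rewrite subr_eq0 => /eqP e0.
  apply: (mulIf wi0); rewrite e0 mulr_suml; apply: eq_bigr => j _.
  by rewrite mulrAC divfK.
have reg : torus_regular chi.
  have [W HW] : exists W : 'I_n -> seq (K * ('I_(rk R) -> int)),
      forall j h, in_torus h -> M i0 j h = \sum_(z <- W j) z.1 * torus_char z.2 h.
    by apply: (@fin_all_exists _ _ (fun j (s : seq (K * ('I_(rk R) -> int))) =>
         forall h, in_torus h -> M i0 j h = \sum_(z <- s) z.1 * torus_char z.2 h)) => j;
    exact: M_reg.
  exists (flatten [seq [seq (w j / w i0 * z.1, z.2) | z <- W j] | j <- enum 'I_n]).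
  move=> h th; rewrite big_flatten /= big_map big_enum /= chiE //.
  apply: eq_bigr => j _; rewrite big_map HW // mulr_sumr; apply: eq_bigr => z _ /=.
  by rewrite mulrA.
have [||u Hu] := multiplicative_regular_char _ _ reg.
- apply: scaleI; rewrite -chiP ?act1 ?scale1r //.
  by apply/in_torusP => i; rewrite ffunE oner_eq0.
- move=> h h' th th'; apply: scaleI; rewrite -chiP ?in_torusM // actMM //.
  by rewrite chiP // act_scale // chiP // scalerA mulrC.
by exists u => h th; rewrite chiP // Hu.
Qed.

Lemma has_weightM a b u u' : has_weight (act (p := R)) u a ->
  has_weight (act (p := R)) u' b ->
  has_weight (act (p := R)) (fun i => u i + u' i) (a * b).
Proof.
move=> Ha Hb h th; rewrite actM // Ha // Hb // torus_charD //.
by rewrite -scalerAl -scalerAr scalerA.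
Qed.

Lemma has_weight1 : has_weight (act (p := R)) (fun=> 0) 1.
Proof.
move=> h th; case: (act_poisson R) => _ _ _ /(_ h th)[-> _] _.
by rewrite /torus_char big1 ?scale1r.
Qed.

Lemma monomial_weight m : exists u, has_weight (act (p := R)) u 'X_[m].
Proof.
have XM a b : (exists u, has_weight (act (p := R)) u a) ->
    (exists u, has_weight (act (p := R)) u b) ->
    exists u, has_weight (act (p := R)) u (a * b).
  by move=> [u Hu] [u' Hu']; eexists; exact: has_weightM Hu Hu'.
have X1 : exists u, has_weight (act (p := R)) u 1 by eexists; exact: has_weight1.
rewrite mpolyXE_id; elim/big_ind: _ => // i _.
by elim: (m i) => [|n IH]; rewrite ?expr0 // exprS; apply: XM => //; exact: var_weight.
Qed.

Lemma homogeneous_weight a : a != 0 -> homogeneous (act (p := R)) a ->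
  exists u, has_weight (act (p := R)) u a.
Proof.
move=> a0 [chi chiP]; have [m0 m0a] : exists m0, m0 \in msupp a.
  move: a0; rewrite -msupp_eq0; case: (msupp a) => // m0 s _.
  by exists m0; rewrite inE eqxx.
have [u Hu] := monomial_weight m0; exists u => h th; rewrite chiP //.
congr (_ *: _); have := congr1 (mcoeff m0) (chiP h th).
rewrite {1}[a]mpolyE (big_morph _ (fun x y => act_add x y th) (act0 th)) raddf_sum /=.
rewrite (bigD1_seq m0) ?msupp_uniq //= big1_seq ?addr0 => [|m /andP[ne _]].
  rewrite act_scale // Hu // !mcoeffZ mcoeffX eqxx mulr1 mulrC => /mulIf -> //.
  by rewrite -mcoeff_msupp.
have [u' Hu'] := monomial_weight m.
by rewrite act_scale // Hu' // !mcoeffZ mcoeffX (negbTE ne) !mulr0.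
Qed.

Lemma lie_lin xi (t : K) a b : lie xi (t *: a + b) = t *: lie xi a + lie (p := R) xi b.
Proof. by case: (lie_act R) => H _; exact: H. Qed.

Lemma lie_add xi a b : lie xi (a + b) = lie xi a + lie (p := R) xi b.
Proof. by rewrite -{1}[a]scale1r lie_lin scale1r. Qed.

Lemma lie0 xi : lie (p := R) xi 0 = 0.
Proof. by apply: (addrI (lie xi 0)); rewrite -lie_add !addr0. Qed.

Lemma lie_scale xi (t : K) a : lie xi (t *: a) = t *: lie (p := R) xi a.
Proof. by rewrite -[t *: a]addr0 lie_lin lie0 addr0. Qed.

Lemma lie_weight xi u a : has_weight (act (p := R)) u a ->
  lie (p := R) xi a = (\sum_i (u i)%:~R * xi i) *: a.
Proof. by case: (lie_act R) => _ H; exact: H. Qed.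

Lemma lie1 xi : lie (p := R) xi 1 = 0.
Proof.
rewrite (lie_weight xi has_weight1) big1 ?scale0r // => i _.
by rewrite mul0r.
Qed.

Lemma lieM xi a b : lie xi (a * b) = lie xi a * b + a * lie (p := R) xi b.
Proof.
apply: (@Rint_ind _ _ (fun b => forall a,
  lie xi (a * b) = lie xi a * b + a * lie (p := R) xi b) 0 N _ _ _ _ b (all_Rint b)) => {a b}.
- by move=> a; rewrite !mulr1 lie1 mulr0 addr0.
- move=> c a b _ _ Ha Hb f.
  rewrite lie_lin !mulrDr -scalerAr lie_add lie_scale Ha Hb -!scalerAr.
  by rewrite scalerDr addrACA.
- move=> a b _ _ Ha Hb f; rewrite mulrA !Hb Ha; ring.
move=> i _ a; have [u Hu] := var_weight i.
rewrite [a]mpolyE mulr_suml !(big_morph _ (lie_add xi) (lie0 xi)) mulr_suml mulr_suml.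
rewrite -big_split /=; apply: eq_bigr => m _.
have [u' Hu'] := monomial_weight m.
rewrite -scalerAl !lie_scale (lie_weight xi (has_weightM Hu' Hu)) (lie_weight xi Hu).
rewrite (lie_weight xi Hu') -!scalerAl -!scalerAr -scalerDr; congr (_ *: _).
rewrite -scalerDl -big_split /=; congr (_ *: _); apply: eq_bigr => j _.
by rewrite intrD mulrDl.
Qed.

Definition lie_hom a := forall xi, exists c, lie (p := R) xi a = c *: a.

Lemma homogeneous_lie a : homogeneous (act (p := R)) a -> lie_hom a.
Proof.
move=> Ha xi; have [->|a0] := eqVneq a 0; first by exists 0; rewrite lie0 scaler0.
have [u Hu] := homogeneous_weight a0 Ha.
by exists (\sum_i (u i)%:~R * xi i); exact: lie_weight.
Qed.

Lemma lie_var k : lie_hom 'X_k.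
Proof. exact/homogeneous_lie/act_var. Qed.

Lemma lie_homM a b : lie_hom a -> lie_hom b -> lie_hom (a * b).
Proof.
move=> Ha Hb xi; have [c Hc] := Ha xi; have [c' Hc'] := Hb xi.
by exists (c + c'); rewrite lieM Hc Hc' -scalerAl -scalerAr scalerDl.
Qed.

Lemma lie_homX a n : lie_hom a -> lie_hom (a ^+ n).
Proof.
move=> Ha; elim: n => [|n IH].
  by move=> xi; exists 0; rewrite expr0 lie1 scale0r.
by rewrite exprS; exact: lie_homM.
Qed.

Lemma lie_Rint xi j k a : a \in Rint j k -> lie (p := R) xi a \in Rint j k.
Proof.
apply: (@Rint_ind _ _ (fun a => lie (p := R) xi a \in Rint j k)).
- by rewrite lie1 Rint0.
- by move=> c x z _ _ Hx Hz; rewrite lie_lin Rint_lin.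
- by move=> x z xR zR Hx Hz; rewrite lieM RintD ?RintM.
by move=> i ik; have [c ->] := lie_var i xi; rewrite RintZ ?Rint_var.
Qed.

Lemma lie_exp xi t c n : lie (p := R) xi 'X_t = c *: 'X_t ->
  lie (p := R) xi ('X_t ^+ n) = (c *+ n) *: 'X_t ^+ n.
Proof.
move=> Ht; elim: n => [|n IH]; first by rewrite expr0 lie1 mulr0n scale0r.
by rewrite exprS lieM IH Ht -scalerAl -scalerAr -scalerDl mulrS.
Qed.

(** Every term [a_n x_t^n] of a weight vector [a] has the weight of [a]. *)
Lemma lie_coef xi t a c ct j n : a \in Rint j t.+1 ->
  lie (p := R) xi a = c *: a -> lie (p := R) xi 'X_t = ct *: 'X_t ->
  lie (p := R) xi (uni t a)`_n = (c - ct *+ n) *: (uni t a)`_n.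
Proof.
move=> aR Ha Ht; have coefR i := uni_coef_Rint i aR.
have [lt|le] := ltnP n (size (uni t a)); last by rewrite nth_default // lie0 scaler0.
have E : lie (p := R) xi a = \sum_(i < size (uni t a))
    (lie (p := R) xi (uni t a)`_i + (ct *+ i) *: (uni t a)`_i) * 'X_t ^+ i.
  rewrite {1}(uni_sum (leqnn (size (uni t a)))) (big_morph _ (lie_add xi) (lie0 xi)).
  apply: eq_bigr => i _.
  by rewrite lieM (lie_exp _ Ht) mulrDl -scalerAl -scalerAr.
have := @uni_coefE _ _ t (size (uni t a)) (fun i =>
    lie (p := R) xi (uni t a)`_i + (ct *+ i) *: (uni t a)`_i) j n.
rewrite -E Ha uniZ coefZ mul_mpolyC lt => e.
rewrite scalerBl e ?addrK // => i.
by rewrite RintD ?RintZ ?lie_Rint.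
Qed.

Lemma lie_hom_coef t a j n : a \in Rint j t.+1 -> lie_hom a ->
  lie_hom (uni t a)`_n.
Proof.
move=> aR Ha xi; have [c Hc] := Ha xi; have [ct Hct] := lie_var t xi.
by eexists; exact: lie_coef aR Hc Hct.
Qed.

End LieAction.

(** * Antisymmetry of Poisson brackets *)

Section Bracket.

Variables (K : fieldType) (N : nat).
Hypothesis charK : [pchar K] =i pred0.
Variable br : {mpoly K[N]} -> {mpoly K[N]} -> {mpoly K[N]}.
Hypothesis brP : poisson_bracket br.
Implicit Types (a b c f g : {mpoly K[N]}).

Lemma br_linl (x : K) a b f : br (x *: a + b) f = x *: br a f + br b f.
Proof. by case: brP. Qed.

Lemma br_xx a : br a a = 0.
Proof. by case: brP. Qed.

Lemma br_jacobi a b c : br a (br b c) + br b (br c a) + br c (br a b) = 0.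
Proof. by case: brP. Qed.

Lemma brMr a b c : br a (b * c) = br a b * c + b * br a c.
Proof. by case: brP. Qed.

Lemma brDl a b f : br (a + b) f = br a f + br b f.
Proof. by rewrite -{1}[a]scale1r br_linl scale1r. Qed.

Lemma br0l f : br 0 f = 0.
Proof. by apply: (addrI (br 0 f)); rewrite -brDl !addr0. Qed.

Lemma brZl (x : K) a f : br (x *: a) f = x *: br a f.
Proof. by rewrite -[x *: a]addr0 br_linl br0l addr0. Qed.

Lemma brNl a f : br (- a) f = - br a f.
Proof. by rewrite -scaleN1r brZl scaleN1r. Qed.

Lemma br0r a : br a 0 = 0.
Proof. by have := brMr a 0 0; rewrite mul0r mulr0 mul0r addr0. Qed.

Lemma brCr a (x : K) : br a x%:MP = 0.
Proof.
have [->|a0] := eqVneq a 0; first exact: br0l.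
have [->|x0] := eqVneq x 0; first by rewrite mpolyC0 br0r.
have /eqP := br_xx (x *: a); rewrite brZl scaler_eq0 (negbTE x0) /=.
by rewrite -mul_mpolyC brMr br_xx mulr0 addr0 mulf_eq0 (negbTE a0) orbF => /eqP.
Qed.

Lemma brZr (x : K) a b : br a (x *: b) = x *: br a b.
Proof. by rewrite -!mul_mpolyC brMr brCr mul0r add0r. Qed.

Lemma br_mul2r a b : br a (b *+ 2) = br a b *+ 2.
Proof. by rewrite -!scaler_nat brZr. Qed.

Let mul2_eq0 a : a *+ 2 = 0 -> a = 0.
Proof. by move/eqP; rewrite (natmul_eq0 charK) => /eqP. Qed.

(** The failure of [br^~ b] to be a derivation at [f]. *)
Let q b f := br (f * f) b - (f * br f b) *+ 2.

Let br_square f : br (f * f) f = 0.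
Proof.
have [->|f0] := eqVneq f 0; first by rewrite mul0r br0l.
apply: (mulfI f0); rewrite mulr0; apply: mul2_eq0.
rewrite -(br_xx (f * f)) brMr; ring.
Qed.

(** Subtract [2 f] times the Jacobi identity for [f], [b], [f] from that for [f],
    [b], [f^2]. *)
Let q_br f b : q (br f b) f = 0.
Proof.
have J2 := br_jacobi f b (f * f); have J1 := br_jacobi f b f.
have e : br f (br b (f * f)) = (f * br f (br b f)) *+ 2.
  have -> : br b (f * f) = (f * br b f) *+ 2 by rewrite brMr; ring.
  by rewrite br_mul2r brMr br_xx mul0r add0r.
rewrite br_square br0r addr0 e in J2; rewrite br_xx br0r addr0 in J1.
have e2 : br (f * f) (br f b) = - ((f * br f (br b f)) *+ 2).
  by apply/eqP; rewrite -addr_eq0 addrC J2.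
have e1 : br f (br b f) = - br f (br f b).
  by apply/eqP; rewrite -addr_eq0 J1.
by rewrite /q e2 e1; ring.
Qed.

(** Replacing [b] by its square in [q_br] isolates [q b f]. *)
Let br_q f b : br f b = 0 \/ q b f = 0.
Proof.
have qu := q_br f b; have := q_br f (b * b); set u := br f b in qu *.
have -> : br f (b * b) = (b * u) *+ 2 by rewrite brMr -/u; ring.
rewrite /q !br_mul2r !brMr -/u => e.
have : (u * q b f) *+ 2 = 0.
  transitivity (((br (f * f) b * u + b * br (f * f) u) *+ 2
      - (f * ((u * u + b * br f u) *+ 2)) *+ 2) - (b * q u f) *+ 2).
    by rewrite /q -/u; ring.
  by rewrite e qu mulr0 mul0rn subr0.
by move/mul2_eq0/eqP; rewrite mulf_eq0 => /orP[] /eqP; [left|right].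
Qed.

Let q_add b f g (x : K) : q b (f + x *: g) = q b f +
  x *: (br (f * g) b - (f * br g b + g * br f b)) *+ 2 + x ^+ 2 *: q b g.
Proof.
rewrite /q; have -> : (f + x *: g) * (f + x *: g) =
    x ^+ 2 *: (g * g) + (x *: (f * g) + (x *: (f * g) + f * f)).
  rewrite -!mul_mpolyC expr2 mpolyCM; ring.
rewrite !brDl !brZl -!mul_mpolyC expr2 mpolyCM; ring.
Qed.

(** The quadratic form [q b] vanishes outside the kernel of [br^~ b].  If this is
    a proper subspace, its complement is large enough to force [q b = 0]. *)
Let q0 b f : q b f = 0.
Proof.
have [[g bg]|H] := classic (exists g, br g b <> 0); last first.
  have H0 g : br g b = 0 by apply: NNPP => bg; apply: H; exists g.
  by rewrite /q !H0 mulr0 mul0rn subr0.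
have [bf|//] := br_q f b.
have qx (x : K) : x != 0 -> q b (f + x *: g) = 0.
  move=> x0; have [/eqP|//] := br_q (f + x *: g) b.
  by rewrite brDl bf add0r brZl scaler_eq0 (negbTE x0) /= => /eqP.
have qg : q b g = 0 by have [|] := br_q g b.
have e1 := qx 1 (oner_neq0 _).
have e2 : q b (f + (-1) *: g) = 0 by apply: qx; rewrite oppr_eq0 oner_eq0.
apply: mul2_eq0; rewrite -[RHS]addr0 -{1}e1 -e2 !q_add qg !scaler0 scale1r scaleN1r.
ring.
Qed.

(** The axioms ask for linearity in the first variable and for Leibniz' rule in
    the second.  Polarizing [q b = 0] gives Leibniz' rule in the first variable,
    from which antisymmetry follows. *)
Lemma brMl a b c : br (a * b) c = br a c * b + a * br b c.
Proof.
have := q_add c a b 1; rewrite !q0 !scaler0 add0r addr0 scale1r => /esym/mul2_eq0/eqP.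
by rewrite subr_eq0 => /eqP ->; ring.
Qed.

Lemma br_anti a b : br a b = - br b a.
Proof.
(* The Jacobi identity for [g], [h], [f^2] minus [2 f] times that for [g], [h], [f]. *)
have key f g h : br h f * (br g f + br f g) = 0.
  have J1 := br_jacobi g h f; have J2 := br_jacobi g h (f * f).
  apply: mul2_eq0.
  transitivity (br g (br h (f * f)) + br h (br (f * f) g) + br (f * f) (br g h)
     - (f * (br g (br h f) + br h (br f g) + br f (br g h))) *+ 2); last first.
    by rewrite J1 J2; ring.
  have -> : br h (f * f) = (f * br h f) *+ 2 by rewrite brMr; ring.
  have -> : br (f * f) g = (f * br f g) *+ 2 by rewrite brMl; ring.
  rewrite !br_mul2r !brMr brMl; ring.
apply/eqP; rewrite -addr_eq0; apply/eqP.
have [z|nz] := eqVneq (br a b) 0; last first.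
  by have /eqP := key b a a; rewrite mulf_eq0 (negbTE nz) => /eqP.
have /eqP := key a b b; rewrite mulf_eq0 z addr0.
by rewrite orbb => /eqP ->; rewrite addr0.
Qed.

Lemma brDr a b f : br f (a + b) = br f a + br f b.
Proof. by rewrite br_anti brDl opprD -!(br_anti f). Qed.

End Bracket.

(** * Chains of indices with the same value of [eta] *)

Section Chains.

Variables (N : nat) (eta : 'I_N -> int).
Implicit Types (i j k l q : 'I_N) (m n : nat).

Lemma sfunP k : match sfun eta k with
  | Some j => [/\ (k < j)%N, eta j = eta k &
      forall l, (k < l)%N -> eta l = eta k -> (j <= l)%N]
  | None => forall l, (k < l)%N -> eta l <> eta k end.
Proof.
rewrite /sfun; case: pickP => [j /and3P[kj /eqP ej /forallP H]|H].
  by split=> // l kl el; have := H l; rewrite kl el eqxx.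
move=> l kl el; pose P (l : 'I_N) := (k < l)%N && (eta l == eta k).
have Pl : P l by rewrite /P kl el eqxx.
case: (arg_minnP (fun j : 'I_N => val j) Pl) => j /andP[kj ej] Hj.
have /negP[] := H j; rewrite kj ej; apply/forallP => x.
by apply/implyP => /andP[kx ex]; apply: Hj; rewrite /P kx ex.
Qed.

Lemma pfunP k : match pfun eta k with
  | Some j => [/\ (j < k)%N, eta j = eta k &
      forall l, (l < k)%N -> eta l = eta k -> (l <= j)%N]
  | None => forall l, (l < k)%N -> eta l <> eta k end.
Proof.
rewrite /pfun; case: pickP => [j /and3P[kj /eqP ej /forallP H]|H].
  by split=> // l kl el; have := H l; rewrite kl el eqxx.
move=> l kl el; pose P (l : 'I_N) := (l < k)%N && (eta l == eta k).
have Pl : P l by rewrite /P kl el eqxx.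
case: (arg_maxnP (fun j : 'I_N => val j) Pl) => j /andP[kj ej] Hj.
have /negP[] := H j; rewrite kj ej; apply/forallP => x.
by apply/implyP => /andP[kx ex]; apply: Hj; rewrite /P kx ex.
Qed.

Lemma pfun_sfun j k : (pfun eta k = Some j) <-> (sfun eta j = Some k).
Proof.
split=> e.
  have := pfunP k; rewrite e => -[jk ej Hj]; have := sfunP j.
  case: (sfun eta j) => [k'|]; last by move=> H; case: (H k jk).
  case=> jk' ek' Hk'; congr Some; apply/val_inj/eqP; rewrite eqn_leq /=.
  rewrite Hk' //= leqNgt; apply/negP => lt.
  by have := Hj _ lt; rewrite ek' ej leqNgt jk' => /(_ erefl).
have := sfunP j; rewrite e => -[jk ek Hk]; have := pfunP k.
case: (pfun eta k) => [j'|]; last by move=> H; case: (H j jk).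
case=> jk' ek' Hk'; congr Some; apply/val_inj/eqP; rewrite eqn_leq /=.
rewrite Hk' // andbT leqNgt; apply/negP => lt.
by have := Hk _ lt; rewrite ek' ek leqNgt jk' => /(_ erefl).
Qed.

Lemma siterS m i : siter eta m.+1 i = obind (sfun eta) (siter eta m i).
Proof. by []. Qed.

Lemma siterSr m i :
  siter eta m.+1 i = if sfun eta i is Some j then siter eta m j else None.
Proof.
rewrite /siter iterSr /=; case: (sfun eta i) => [//|].
by elim: m => //= m ->.
Qed.

Lemma siter_eta m i l : siter eta m i = Some l -> eta l = eta i /\ (i + m <= l)%N.
Proof.
elim: m l => [|m IH] l; first by case=> <-; rewrite addn0.
rewrite siterS; case: (siter eta m i) IH => //= k /(_ k erefl)[ek ik] e.
have := sfunP k; rewrite e => -[kl el _]; split; first by rewrite el.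
by rewrite addnS (leq_ltn_trans ik).
Qed.

Lemma siter_exists i l : (i <= l)%N -> eta i = eta l ->
  exists m, siter eta m i = Some l.
Proof.
have [n] := ubnP (l - i)%N; elim: n i => // n IH i lt il el.
have [/val_inj ->|ne] := eqVneq (val i) (val l); first by exists 0%N.
have {}il : (i < l)%N by rewrite ltn_neqAle ne.
have := sfunP i; case e: (sfun eta i) => [j|]; last by move=> H; case: (H l il).
case=> ij ej /(_ l il (esym el)) jl; have [||m Hm] := IH j _ jl.
- by lia.
- by rewrite ej.
by exists m.+1; rewrite siterSr e.
Qed.

Lemma spowE m i l : siter eta m i = Some l -> spow eta m i = l.
Proof. by rewrite /spow => ->. Qed.

Lemma schainE i l k : (k \in schain eta i l) = (i <= k <= l)%N && (eta k == eta i).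
Proof.
rewrite inE; apply/andP/andP => [[kl /existsP[n /eqP e]]|[/andP[ik kl] /eqP e]].
  by have [-> le] := siter_eta e; rewrite eqxx kl (leq_trans (leq_addr _ _) le).
split=> //; have [m Hm] := siter_exists ik (esym e).
have [_ le] := siter_eta Hm; have lt : (m < N)%N by have := ltn_ord k; lia.
by apply/existsP; exists (Ordinal lt); rewrite /= Hm.
Qed.

Lemma eintE i l k : eint eta i l k 0 = ((i <= k <= l)%N && (eta k == eta i))%:Z.
Proof.
rewrite /eint summxE -schainE.
rewrite (eq_bigr (fun x => (x == k)%:Z)) => [|x _]; last first.
  by rewrite /evec mxE eqxx andbT eq_sym natz.
have [kin|kout] := boolP (k \in schain eta i l).
  by rewrite (bigD1 k) //= eqxx big1 ?addr0 // => x /andP[_ /negbTE ->].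
by rewrite big1 // => x xin; case: eqP => // e; rewrite -e xin in kout.
Qed.

Lemma piter_eta n l k : piter eta n l = Some k -> eta k = eta l /\ (k + n <= l)%N.
Proof.
elim: n k => [|n IH] k; first by case=> <-; rewrite addn0.
rewrite /piter iterS -/(piter eta n l).
case: (piter eta n l) IH => //= j /(_ j erefl)[ej jl] e.
have := pfunP j; rewrite e => -[kj ek _]; split; first by rewrite ek.
by lia.
Qed.

Lemma piter_exists k l : (k <= l)%N -> eta k = eta l -> exists n, piter eta n l = Some k.
Proof.
have [n] := ubnP (l - k)%N; elim: n l => // n IH l lt kl ek.
have [/val_inj ->|ne] := eqVneq (val k) (val l); first by exists 0%N.
have {}kl : (k < l)%N by rewrite ltn_neqAle ne.
have := pfunP l; case e: (pfun eta l) => [j|]; last by move=> H; case: (H k kl).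
case=> jl ej /(_ k kl ek) kj; have [||m Hm] := IH j _ kj.
- by lia.
- by rewrite ej.
exists m.+1; rewrite /piter iterSr /= e; exact: Hm.
Qed.

Lemma pOP (j : nat) l : (j <= l)%N ->
  [/\ (j <= pO eta j l <= l)%N, eta (pO eta j l) = eta l &
      forall k, (j <= k)%N -> eta k = eta l -> (pO eta j l <= k)%N].
Proof.
move=> jl; pose P k := (j <= k)%N && (eta k == eta l).
have Pl : P l by rewrite /P jl eqxx.
case: (arg_minnP (fun k : 'I_N => val k) Pl) => q /andP[jq /eqP eq] Hq.
have ql : (q <= l)%N by exact: Hq.
have [n Hn] := piter_exists ql eq; have [_ le] := piter_eta Hn.
have nN : (n < N)%N by have := ltn_ord l; lia.
have En : Ominus eta j l = n.
  apply/eqP; rewrite eqn_leq; apply/andP; split.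
    apply/bigmax_leqP => n'; case e: (piter eta n' l) => [k|] // jk.
    rewrite leqNgt; apply/negP => lt; have [ek kl] := piter_eta e.
    have /Hq /= qk : P k by rewrite /P jk ek eqxx.
    have := e; rewrite -(subnK (ltnW lt)) /piter iterD -/(piter eta n l) Hn => e'.
    have [_] := piter_eta e'; lia.
  apply: (leq_bigmax_cond (Ordinal nN)); by rewrite /= Hn.
have -> : pO eta j l = q by rewrite /pO En /ppow Hn.
by split=> //; [rewrite jq|move=> k jk ek; apply: Hq; rewrite /P jk ek eqxx].
Qed.

Lemma pO_eq (j : nat) l q : (j <= q <= l)%N -> eta q = eta l ->
  (forall k, (j <= k)%N -> eta k = eta l -> (q <= k)%N) -> pO eta j l = q.
Proof.
move=> /andP[jq ql] eq Hq; have [/andP[j' l'] e H] := pOP (leq_trans jq ql).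
by apply/val_inj/eqP; rewrite eqn_leq H //= Hq.
Qed.

End Chains.

(** * Poisson-normal elements *)

Section Extension.

Variables (K : fieldType) (N : nat) (R : PCGL K N).
Hypothesis charK : [pchar K] =i pred0.
Hypothesis delta_left :
  forall j k : 'I_N, (j < k)%N -> delta R k 'X_j \in Rint j.+1 k.
Variables (xi : 'I_N -> {ffun 'I_(rk R) -> K}) (lam : 'I_N -> K).
Hypothesis sigma_xi :
  forall (t : 'I_N) b, b \in Rint 0 t -> sigma R t b = lie (xi t) b.
Hypothesis lie_xi : forall t, lie (xi t) 'X_t = lam t *: 'X_t.
Hypothesis lam_neq0 : forall t, lam t != 0.

Implicit Types (a b c f z : {mpoly K[N]}) (t i p q l k : 'I_N).
Local Notation br := (br R).
Local Notation delta := (delta R).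
Local Notation lie_hom := (lie_hom R).
Let brP := br_poisson R.

Lemma delta_der t : derivation_on (Rint 0 t) (delta t).
Proof. by case: (delta_poisson R t). Qed.

Lemma delta_Rint0 t b : b \in Rint 0 t -> delta t b \in Rint 0 t.
Proof. by case: (delta_der t) => + _ _; exact. Qed.

Lemma delta_lin t (x : K) a b : a \in Rint 0 t -> b \in Rint 0 t ->
  delta t (x *: a + b) = x *: delta t a + delta t b.
Proof. by case: (delta_der t) => _ + _; exact. Qed.

Lemma deltaD t a b : a \in Rint 0 t -> b \in Rint 0 t ->
  delta t (a + b) = delta t a + delta t b.
Proof. by move=> aR bR; rewrite -{1}[a]scale1r delta_lin // scale1r. Qed.

Lemma delta0 t : delta t 0 = 0.
Proof. exact: (der0 (delta_der t) (Rint1 _ _)). Qed.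

Lemma deltaZ t (x : K) a : a \in Rint 0 t -> delta t (x *: a) = x *: delta t a.
Proof. by move=> aR; rewrite -[x *: a]addr0 delta_lin ?Rint0 // delta0 addr0. Qed.

Lemma deltaM t a b : a \in Rint 0 t -> b \in Rint 0 t ->
  delta t (a * b) = delta t a * b + a * delta t b.
Proof. by case: (delta_der t) => _ _; exact. Qed.

Lemma delta1 t : delta t 1 = 0.
Proof.
have := deltaM (Rint1 0 t) (Rint1 0 t); rewrite !mulr1 mul1r => e.
by apply: (addrI (delta t 1)); rewrite -e addr0.
Qed.

Lemma delta_Rint t j b : b \in Rint j t -> delta t b \in Rint j t.
Proof.
have sub0 c : c \in Rint j t -> c \in Rint 0 t by exact: Rint_sub.
move=> bR; apply: (@Rint_ind _ _ (fun b => delta t b \in Rint j t) j t _ _ _ _ b bR).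
- by rewrite delta1 Rint0.
- by move=> x a c aR cR Ha Hc; rewrite delta_lin ?Rint_lin ?sub0.
- by move=> a c aR cR Ha Hc; rewrite deltaM ?RintD ?RintM ?sub0.
move=> i /andP[ji it]; apply: Rint_sub (delta_left it) => //; exact: leqW.
Qed.

Lemma br_var_low t b : b \in Rint 0 t ->
  br 'X_t b = lie (xi t) b * 'X_t + delta t b.
Proof. by move=> bR; rewrite br_var // sigma_xi. Qed.

Lemma lie_xi_var t i : (i < t)%N -> lie (xi t) 'X_i = lambda R t i *: 'X_i.
Proof. by move=> it; rewrite -sigma_xi ?Rint_var // lambdaP. Qed.

Lemma br_Rint2 (j k : nat) a b : a \in Rint j k -> b \in Rint j k -> br a b \in Rint j k.
Proof.
have X2 i1 i2 : (j <= i1 < k)%N -> (j <= i2 < k)%N -> (i2 < i1)%N ->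
    br 'X_i1 'X_i2 \in Rint j k.
  move=> r1 r2 lt; rewrite br_var_low ?Rint_var // lie_xi_var //.
  apply: RintD; first by rewrite RintM ?RintZ ?Rint_var.
  case/andP: r1 => _ r1; case/andP: r2 => r2 _.
  by apply: Rint_sub (delta_left lt); [exact: leqW|exact: ltnW].
move=> aR bR.
apply: (@Rint_ind _ _ (fun a => br a b \in Rint j k) j k _ _ _ _ a aR) => {a aR}.
- by rewrite (br_anti charK brP) -mpolyC1 (brCr brP) oppr0 Rint0.
- by move=> x a c _ _ Ha Hc; rewrite (br_linl brP) Rint_lin.
- by move=> a c aR cR Ha Hc; rewrite (brMl charK brP) RintD ?RintM.
move=> i ir.
apply: (@Rint_ind _ _ (fun b => br 'X_i b \in Rint j k) j k _ _ _ _ b bR) => {b bR}.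
- by rewrite -mpolyC1 (brCr brP) Rint0.
- by move=> x a c _ _ Ha Hc; rewrite (brDr charK brP) (brZr brP) Rint_lin.
- by move=> a c aR cR Ha Hc; rewrite (brMr brP) RintD ?RintM.
move=> i' ir'; have [lt|lt|/val_inj ->] := ltngtP i i'; last by rewrite (br_xx brP) Rint0.
  by rewrite (br_anti charK brP) RintN ?X2.
exact: X2.
Qed.

(** Normality is recorded one variable at a time, because the elements considered
    are normal on interval algebras of different extent. *)
Definition normal a i := exists z, br a 'X_i = a * z.

Lemma normalM a b i : normal a i -> normal b i -> normal (a * b) i.
Proof.
move=> [z Hz] [z' Hz']; exists (z + z'); rewrite (brMl charK brP) Hz Hz'; ring.
Qed.

Lemma normalX a n i : normal a i -> normal (a ^+ n) i.
Proof.
move=> Ha; elim: n => [|n IH]; last by rewrite exprS; exact: normalM.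
exists 0; by rewrite expr0 (br_anti charK brP) -mpolyC1 (brCr brP) oppr0 mulr0.
Qed.

Lemma normalZ (x : K) a i : normal a i -> normal (x *: a) i.
Proof. by move=> [z Hz]; exists z; rewrite (brZl brP) Hz scalerAl. Qed.

Lemma normal_var i : normal 'X_i i.
Proof. by exists 0; rewrite (br_xx brP) mulr0. Qed.

(** For a torus eigenvector [a = sum_i a_i x_t^i] of degree [n] in [x_t],
    normality with respect to [x_t] means that [a] is determined by its top
    coefficient: up to scalars, [a_(n - i)] is the [i]-th power of [delta_t]
    applied to [a_n]. Comparing coefficients in [{x_t, a} = a * z] gives this
    up to multiples of the constant term [z_0] of [z]; at the lowest nonzero
    coefficient [b] it says [delta_t b = b * z_0], whence [z_0 = 0] because
    [delta_t] is locally nilpotent. *)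
Lemma normal_coef t a : a \in Rint 0 t.+1 -> lie_hom a -> normal a t ->
  let P := uni t a in let n := (size P).-1 in
  delta t P`_0 = 0 /\
  forall x, (x < n)%N -> delta t P`_x.+1 = - (lam t *+ (n - x)) *: P`_x.
Proof.
move=> aR a_hom [z0 Hz] P n.
have [a0|a0] := eqVneq a 0.
  by rewrite /n /P a0 uni0 size_poly0 coef0 delta0; split.
have P0 : P != 0 by exact: uni_neq0.
have sP : size P = n.+1 by rewrite /n prednK // lt0n size_poly_eq0.
have PR x : P`_x \in Rint 0 t by exact: uni_coef_Rint.
have [c Hc] := a_hom (xi t).
have lieP x : lie (xi t) P`_x = (c - lam t *+ x) *: P`_x by exact: lie_coef aR Hc (lie_xi t).
pose z := - z0; have {}Hz : br 'X_t a = a * z by rewrite (br_anti charK brP) Hz mulrN.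
have zR : z \in Rint 0 t.+1.
  apply: (Rint_divisor a0 aR); rewrite -Hz br_Rint2 // Rint_var //=.
have E : P * uni t z = \poly_(x < n.+1) ((c - lam t *+ x) *: P`_x) * 'X +
    \poly_(x < n.+1) delta t P`_x.
  rewrite -uniM -Hz {1}(uni_sum (leqnn (size (uni t a)))) -/P sP.
  rewrite (big_morph _ (fun x y => brDr charK brP x y 'X_t) (br0r brP 'X_t)).
  rewrite (big_morph _ (uniD t) (uni0 t)) !poly_def mulr_suml -big_split /=.
  apply: eq_bigr => x _; rewrite (brMr brP).
  have -> : br 'X_t ('X_t ^+ x) = 0.
    elim: (x : nat) => [|m IH]; first by rewrite expr0 -mpolyC1 (brCr brP).
    by rewrite exprS (brMr brP) (br_xx brP) IH mul0r mulr0 addr0.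
  rewrite mulr0 addr0 br_var_low // lieP mulrDl uniD !uniM uniXn !uniX eqxx.
  rewrite (@uni_free _ _ 0 t t ((c - lam t *+ x) *: P`_x)) ?RintZ ?ltnn ?andbF //.
  rewrite (@uni_free _ _ 0 t t (delta t P`_x)) ?delta_Rint0 ?ltnn ?andbF //.
  by rewrite -!mul_polyC mulrAC.
set Q := uni t z in E.
have sQ : (size Q <= 2)%N.
  have [->|Q0] := eqVneq Q 0; first by rewrite size_poly0.
  have : (size (P * Q)%R <= n.+2)%N.
    rewrite E (leq_trans (size_polyD _ _)) // geq_max; apply/andP; split.
      have [->|nz] := eqVneq (\poly_(x < n.+1) ((c - lam t *+ x) *: P`_x)) 0.
        by rewrite mul0r size_poly0.
      by rewrite size_mulX // ltnS size_poly.
    by rewrite (leq_trans (size_poly _ _)).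
  by rewrite size_mul // sP addSn -[n.+2]addn2 leq_add2l.
have EQ : Q = (Q`_0)%:P + (Q`_1)%:P * 'X.
  apply/polyP => x; rewrite coefD coefC coefMX coefC.
  case: x => [|[|x]] /=; rewrite ?addr0 ?add0r //.
  by rewrite nth_default // (leq_trans sQ).
have EC x : P`_x * Q`_0 + (if x is x'.+1 then P`_x' * Q`_1 else 0) =
    (if x is x'.+1 then (c - lam t *+ x') *: P`_x' else 0) + delta t P`_x.
  have := congr1 (fun p : {poly {mpoly K[N]}} => p`_x) E.
  rewrite {1}EQ mulrDr mulrA !coefD !coefMC !coefMX !coef_poly.
  have dP y : (if (y < n.+1)%N then delta t P`_y else 0) = delta t P`_y.
    by case: ltnP => // le; rewrite nth_default ?sP // delta0.
  have lP y : (if (y < n.+1)%N then (c - lam t *+ y) *: P`_y else 0) =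
      (c - lam t *+ y) *: P`_y.
    by case: ltnP => // le; rewrite nth_default ?sP // scaler0.
  by rewrite dP; case: x => [|x] /=; rewrite ?coefMC ?lP.
have Pn : P`_n != 0 by rewrite /n -lead_coefE lead_coef_eq0.
have Pn1 : P`_n.+1 = 0 by rewrite nth_default ?sP.
have Q1 : Q`_1 = (c - lam t *+ n)%:MP.
  have := EC n.+1; rewrite Pn1 delta0 mul0r add0r addr0 -mul_mpolyC mulrC.
  exact: mulIf.
have Q0 : Q`_0 = 0.
  have exP : exists x, P`_x != 0 by exists n.
  case: (ex_minnP exP) => x0 Px0 min0.
  have H : delta t P`_x0 = P`_x0 * Q`_0.
    have := EC x0; case: x0 Px0 min0 => [|x0] Px0 min0; first by rewrite addr0 add0r.
    have -> : P`_x0 = 0.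
      by apply/eqP/negPn/negP => /min0; rewrite ltnn.
    by rewrite mul0r scaler0 addr0 add0r.
  have Q0R : Q`_0 \in Rint 0 t by exact: uni_coef_Rint.
  have := der_eigen charK (delta_der t) (@delta_nilpotent _ _ R t) (Rint1 _ _)
     (@RintM _ _ 0 t) (PR x0) Q0R H.
  by rewrite H => /eqP; rewrite mulf_eq0 (negbTE Px0) => /eqP.
split; first by have := EC 0%N; rewrite Q0 mulr0 add0r add0r.
move=> x xn; have := EC x.+1; rewrite Q0 mulr0 add0r Q1 mulrC mul_mpolyC => e.
rewrite -[LHS](addKr ((c - lam t *+ x) *: P`_x)) -e addrC -scalerBl; congr (_ *: _).
by rewrite opprB addrC addrA subrK mulrnBr ?(ltnW xn) // opprB.
Qed.

Lemma normal_delta_eq0 t a : a \in Rint 0 t -> lie_hom a -> normal a t ->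
  delta t a = 0.
Proof.
move=> aR a_hom a_nrm.
have [|] := normal_coef _ a_hom a_nrm; first exact: Rint_sub aR.
by rewrite (uni_free aR) ?ltnn ?andbF // coefC eqxx.
Qed.

Lemma lamMn_neq0 t n : (0 < n)%N -> lam t *+ n != 0.
Proof.
move=> n0; rewrite -mulr_natl mulf_neq0 ?lam_neq0 //.
by rewrite (proj1 (pcharf0P K) charK) -lt0n.
Qed.

(** By [normal_coef] each coefficient is a nonzero multiple of [delta_t] applied to
    the next higher one. *)
Lemma normal_top_inj t a b : a \in Rint 0 t.+1 -> b \in Rint 0 t.+1 ->
  lie_hom a -> lie_hom b -> normal a t -> normal b t ->
  size (uni t a) = size (uni t b) -> lead_coef (uni t a) = lead_coef (uni t b) ->
  a = b.
Proof.
move=> aR bR ah bh an bn sz lc.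
have [_ Ha] := normal_coef aR ah an; have [_ Hb] := normal_coef bR bh bn.
apply: (@uni_inj _ _ t); apply/polyP => x.
have [lt|le] := ltnP x (size (uni t a)); last by rewrite !nth_default -?sz.
set n := (size (uni t a)).-1; have lt' : (x <= n)%N by rewrite /n; lia.
rewrite -(subKn lt'); have: (n - x <= n)%N by rewrite leq_subr.
elim: {x lt lt'} (n - x)%N => [|x IH] xn.
  by rewrite subn0; move: lc; rewrite !lead_coefE -sz.
have e : (n - x)%N = (n - x.+1).+1 by lia.
have lt : (n - x.+1 < n)%N by lia.
have := IH (ltnW xn); rewrite e => /(congr1 (delta t)).
move=> e'; have Ha' := Ha _ lt; have Hb' := Hb (n - x.+1)%N.
rewrite -sz -/n in Hb'; rewrite e' (Hb' lt) in Ha'.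
move/eqP: Ha'; rewrite -subr_eq0 -scalerBr scaler_eq0 oppr_eq0.
by rewrite (negbTE (lamMn_neq0 _ _)) ?subn_gt0 //= subr_eq0 => /eqP.
Qed.

Lemma uni_linear t a c : a \in Rint 0 t -> c \in Rint 0 t -> a != 0 ->
  [/\ size (uni t (a * 'X_t - c)) = 2%N, (uni t (a * 'X_t - c))`_0 = - c
    & (uni t (a * 'X_t - c))`_1 = a].
Proof.
move=> aR cR a0.
have Fx x : (uni t (a * 'X_t - c))`_x =
    if (x < 2)%N then if x == 0%N then - c else a else 0.
  have FR x' : (if x' == 0%N then - c else a) \in Rint 0 t by case: eqP; rewrite ?RintN.
  rewrite -(uni_coefE 2 x FR); congr ((uni t _)`_x).
  by rewrite big_ord_recl big_ord1 /= expr0 mulr1 expr1 addrC.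
split; [|exact: Fx 0%N|exact: Fx 1%N].
apply/eqP; rewrite eqn_leq; apply/andP; split.
  by apply/leq_sizeP => x le; rewrite Fx ltnNge le.
rewrite ltnNge; apply/negP => /leq_sizeP/(_ 1%N (leqnn _)).
by rewrite Fx /= => /eqP; rewrite (negbTE a0).
Qed.

(** The case of degree one in [x_t] of [normal_coef]. *)
Lemma normal_linear t a c : a \in Rint 0 t -> c \in Rint 0 t -> a != 0 ->
  lie_hom (a * 'X_t - c) -> normal (a * 'X_t - c) t ->
  c = (lam t)^-1 *: delta t a /\ delta t c = 0.
Proof.
move=> aR cR a0 hom nrm; have [sU C0 C1] := uni_linear aR cR a0.
have YR : a * 'X_t - c \in Rint 0 t.+1.
  by rewrite RintB ?RintM ?Rint_var //=; [exact: Rint_sub aR|exact: Rint_sub cR].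
have [d0 d1] := normal_coef YR hom nrm; have := d1 0%N.
rewrite sU => /(_ isT); rewrite [X in delta t X = _]C1 [X in _ *: X]C0.
rewrite scalerN scaleNr opprK subn0 mulr1n => ->; rewrite [X in delta t X]C0 in d0.
split; first by rewrite scalerA mulVf ?scale1r ?lam_neq0.
move: d0; rewrite -[- c]scaleN1r deltaZ // => /eqP.
by rewrite scaler_eq0 oppr_eq0 oner_eq0 => /eqP.
Qed.

(** Termwise application of [{x_t, b} = (xi . b) x_t + delta_t b]: the first
    summand preserves the degree in [x_t], and the second lowers it by one. *)
Lemma uni_br t a b : a \in Rint 0 t.+1 -> b \in Rint 0 t ->
  let P := uni t a in
  uni t (br a b) = \poly_(x < size P) (br P`_x b + (lie (xi t) b * P`_x) *+ x)
    + P^`() * (delta t b)%:P.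
Proof.
move=> aR bR P; have PR x : P`_x \in Rint 0 t by exact: uni_coef_Rint.
have brX x : br ('X_t ^+ x) b = (lie (xi t) b * 'X_t + delta t b) * 'X_t ^+ x.-1 *+ x.
  elim: x => [|x IH].
    by rewrite expr0 (br_anti charK brP) -mpolyC1 (brCr brP) oppr0 mulr0n.
  rewrite exprS (brMl charK brP) IH br_var_low // [RHS]mulrS; congr (_ + _).
  case: x {IH} => [|x]; first by rewrite !mulr0n mulr0.
  by rewrite /= exprS mulrnAr; congr (_ *+ _); ring.
have fr f : f \in Rint 0 t -> uni t f = f%:P by exact: uni_low.
rewrite {1}(uni_sum (leqnn (size (uni t a)))) -/P.
rewrite (big_morph _ (fun x y => brDl brP x y b) (br0l brP b)).
rewrite (big_morph _ (uniD t) (uni0 t)).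
have -> : P^`() = \sum_(x < size P) (P`_x)%:P * ('X^(x.-1) *+ x).
  rewrite -{1}(coefK P) poly_def (big_morph (@deriv _) (@derivD _) (@deriv0 _)).
  by apply: eq_bigr => x _; rewrite derivZ derivXn mul_polyC.
rewrite poly_def mulr_suml -big_split /=; apply: eq_bigr => x _.
have uniMn f n : uni t (f *+ n) = uni t f *+ n.
  by elim: n => [|n IH]; rewrite ?uni0 // !mulrS uniD IH.
have LR : lie (xi t) b \in Rint 0 t by exact: lie_Rint.
have XE : uni t (('X_t ^+ x.-1 * (lie (xi t) b * 'X_t + delta t b)) *+ x) =
    ((lie (xi t) b)%:P * 'X^x + (delta t b)%:P * 'X^(x.-1)) *+ x.
  rewrite uniMn uniM uniD uniM uniXn uniX eqxx (fr _ LR) (fr _ (delta_Rint0 bR)).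
  case: (x : nat) => [|y]; first by rewrite !mulr0n.
  by rewrite /= exprS; congr (_ *+ _); ring.
rewrite (brMl charK brP) brX uniD uniM [X in _ + uni t (_ * (X *+ _))]mulrC uniM XE.
rewrite (fr _ (br_Rint2 (PR x) bR)) (fr _ (PR x)) uniXn uniX eqxx.
rewrite -mul_polyC polyCD polyCMn polyCM.
have aux (S : comNzRingType) (u1 u2 u3 u4 u5 u6 : S) n :
    u1 * u5 + u2 * ((u3 * u5 + u4 * u6) *+ n) =
    (u1 + (u3 * u2) *+ n) * u5 + u2 * (u6 *+ n) * u4.
  rewrite mulrDl -addrA !(mulrnAl, mulrnAr) -mulrnDl; congr (_ + _ *+ n); ring.
exact: aux.
Qed.

Lemma size_uni_mul t a z n : a != 0 -> size (uni t a) = n.+1 ->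
  (size (uni t (a * z)) <= n.+1)%N -> uni t z = z%:P.
Proof.
move=> a0 sP sPQ; apply: uni_size1; have [->|Q0] := eqVneq (uni t z) 0.
  by rewrite size_poly0.
have P0 : uni t a != 0 by rewrite -size_poly_eq0 sP.
by move: sPQ; rewrite uniM size_mul // sP addSn /= -[n.+1]addn1 leq_add2l.
Qed.

(** As [b] does not contain [x_t], the degree of [{a, b}] in [x_t] is at most that
    of [a], so that [z] does not contain [x_t] either.  The first conclusion
    compares top coefficients.  If [a_0 = 0] and [r] is the order of [a] in
    [x_t], then the coefficient of [x_t^(r-1)] in [a * z] vanishes, and in
    [{a, b}] it is [r a_r delta_t b]. *)
Lemma br_coef t a b z : a \in Rint 0 t.+1 -> b \in Rint 0 t -> a != 0 ->
  br a b = a * z -> let P := uni t a in let n := (size P).-1 in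
  P`_n * z = br P`_n b + (lie (xi t) b * P`_n) *+ n /\
  (P`_0 = 0 -> delta t b = 0).
Proof.
move=> aR bR a0 Hz P n; have := uni_br aR bR; rewrite Hz -/P => E.
have P0 : P != 0 by exact: uni_neq0.
have sP : size P = n.+1 by rewrite /n prednK // lt0n size_poly_eq0.
have sPQ : (size (uni t (a * z)) <= n.+1)%N.
  rewrite E (leq_trans (size_polyD _ _)) // geq_max sP size_poly /=.
  have [->|nz] := eqVneq (P^`() * (delta t b)%:P) 0; first by rewrite size_poly0.
  move: nz; rewrite mulf_eq0 negb_or polyC_eq0 => /andP[d0 nz].
  rewrite mulrC size_Cmul // ltnW // (leq_trans (lt_size_deriv P0)) //.
  by rewrite sP.
have zC := size_uni_mul a0 sP sPQ.
have EC x : P`_x * z = (if (x < n.+1)%N then br P`_x b + (lie (xi t) b * P`_x) *+ x else 0)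
    + (P`_x.+1 * delta t b) *+ x.+1.
  have := congr1 (fun p : {poly {mpoly K[N]}} => p`_x) E.
  by rewrite uniM zC coefMC coefD coef_poly sP coefMC coef_deriv mulrnAl.
split.
  by rewrite EC ltnSn (nth_default 0 (_ : size P <= n.+1)%N) ?sP // mul0r mul0rn addr0.
move=> P00; have exP : exists x, P`_x != 0.
  by exists n; rewrite /n -lead_coefE lead_coef_eq0.
case: (ex_minnP exP) => [[|x] Px min]; first by rewrite P00 eqxx in Px.
have Px0 y : (y <= x)%N -> P`_y = 0.
  by move=> yx; apply/eqP/negPn/negP => /min; rewrite leqNgt ltnS yx.
have := EC x; rewrite (Px0 x (leqnn _)) mul0r (br0l brP) mulr0 mul0rn addr0 if_same.
rewrite add0r => /esym/eqP; rewrite (natmul_eq0 charK) /= mulf_eq0.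
by rewrite (negbTE Px) => /eqP.
Qed.

Lemma normal_lead_coef t j a i : a \in Rint j t.+1 -> a != 0 -> (j <= i < t)%N ->
  normal a i -> normal (lead_coef (uni t a)) i.
Proof.
move=> aR a0 /andP[ji it] [z Hz].
have aR0 : a \in Rint 0 t.+1 by exact: Rint_sub aR.
have iR : 'X_i \in Rint (K := K) 0 t by rewrite Rint_var.
have [E _] := br_coef aR0 iR a0 Hz.
rewrite lead_coefE; set n := (size _).-1 in E *; set p := (uni t a)`_n in E *.
exists (z - (lie (xi t) 'X_i) *+ n).
by rewrite mulrBr E mulrnAr [p * _]mulrC addrK.
Qed.

(** In [{x_q, x_i}] with [q < i] the variable [x_q] occurs at most linearly,
    by the left-right symmetry of the extension; so the coefficient of [x_q]
    inherits normality as the coefficients of the highest variable do. *)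
Lemma normal_left_coef (q i : 'I_N) (k : nat) a b :
  a \in Rint q.+1 k -> b \in Rint q.+1 k ->
  (q < i < k)%N -> normal ('X_q * a + b) i -> normal a i.
Proof.
move=> aR bR qik [z Hz]; have [->|a0] := eqVneq a 0.
  by exists 0; rewrite (br0l brP) mulr0.
case/andP: (qik) => qi ik; set l := lambda R i q.
have iR : 'X_i \in Rint (K := K) q.+1 k by rewrite Rint_var.
pose A := br a 'X_i - l *: 'X_i * a.
pose B := br b 'X_i - delta i 'X_q * a.
have AR : A \in Rint q.+1 k by rewrite RintB ?RintM ?RintZ ?br_Rint2.
have dR : delta i 'X_q \in Rint q.+1 k by apply: Rint_sub (delta_left qi) => //; exact: ltnW.
have BR : B \in Rint q.+1 k by rewrite RintB ?RintM ?RintZ ?br_Rint2.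
have E : br ('X_q * a + b) 'X_i = 'X_q * A + B.
  rewrite (brDl brP) (brMl charK brP) (br_anti charK brP 'X_q) br_var_low ?Rint_var //.
  rewrite lie_xi_var // /A /B -/l -!mul_mpolyC; ring.
have fr f : f \in Rint q.+1 k -> uni q f = f%:P by move=> fR; rewrite (uni_free fR) ?ltnn.
have U f g : f \in Rint q.+1 k -> g \in Rint q.+1 k ->
    uni q ('X_q * f + g) = f%:P * 'X + g%:P.
  by move=> fR gR; rewrite uniD uniM uniX eqxx mulrC !fr.
have n0 : 'X_q * a + b != 0.
  apply: contraNneq a0 => e; have := U _ _ aR bR; rewrite e uni0 => /esym/eqP.
  by rewrite -size_poly_eq0 size_MXaddC polyC_eq0; case: ifP => [/andP[]|].
have s2 : size (uni q ('X_q * a + b)) = 2%N.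
  by rewrite U // size_MXaddC polyC_eq0 (negbTE a0) /= size_polyC a0.
have sA : (size (uni q (('X_q * a + b) * z)) <= 2)%N.
  rewrite -Hz E U // size_MXaddC; case: ifP => // _.
  by rewrite ltnS size_polyC; case: eqP.
have zC := size_uni_mul n0 s2 sA.
have coef1 (S : comNzRingType) (u v u' v' w : S) :
    u%:P * 'X + v%:P = (u'%:P * 'X + v'%:P) * w%:P -> u = u' * w.
  move=> /(congr1 (fun p : {poly S} => p`_1)).
  by rewrite coefMC !coefD !coefMX !coefC /= !addr0.
have EA : A = a * z.
  have EL := U _ _ AR BR; have ER := U _ _ aR bR.
  have EM := uniM q ('X_q * a + b) z; rewrite ER zC -Hz E EL in EM.
  exact: coef1 EM.
by exists (z + l *: 'X_i); rewrite mulrDr -EA /A -scalerAl -scalerAr [a * _]mulrC subrK.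
Qed.

(** * Prime elements of intervals *)

Variable eta : 'I_N -> int.
Hypothesis eta_adm : eta_admissible R eta.

(** The recursion that [normal_linear] imposes on the elements [y_[q, s^m(q)]]. *)
Fixpoint yrec q m : {mpoly K[N]} :=
  if m is m'.+1 then
    if siter eta m q is Some t then
      yrec q m' * 'X_t - (lam t)^-1 *: delta t (yrec q m')
    else 1
  else 'X_q.

Lemma yrecS q m t : siter eta m.+1 q = Some t ->
  yrec q m.+1 = yrec q m * 'X_t - (lam t)^-1 *: delta t (yrec q m).
Proof. by move=> /= ->. Qed.

Lemma siter_pred m q t : siter eta m.+1 q = Some t ->
  exists2 l, siter eta m q = Some l & [/\ sfun eta l = Some t, (q <= l)%N & (l < t)%N].
Proof.
rewrite siterS; case e: (siter eta m q) => [l|] //= st; exists l => //.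
have [_ ql] := siter_eta e; have := sfunP eta l; rewrite st => -[lt _ _].
by split=> //; exact: leq_trans (leq_addr _ _) ql.
Qed.

Lemma yrec_Rint q m l : siter eta m q = Some l ->
  yrec q m \in Rint q l.+1 /\ yrec q m != 0.
Proof.
elim: m l => [|m IH] l.
  by case=> <-; rewrite Rint_var ?leqnn // X_neq0.
move=> st; have [l' /IH[ZR Z0] [_ ql' l'l]] := siter_pred st.
have ZR' : yrec q m \in Rint q l by exact: Rint_sub ZR.
have ZR0 : yrec q m \in Rint 0 l by exact: Rint_sub ZR'.
have dR : (lam l)^-1 *: delta l (yrec q m) \in Rint q l.
  by rewrite RintZ ?delta_Rint.
have ql : (q <= l)%N by exact: leq_trans (ltnW l'l).
rewrite (yrecS st); split.
  have up f : f \in Rint q l -> f \in Rint q l.+1 by exact: Rint_sub.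
  by rewrite RintB ?RintM ?Rint_var ?ql ?leqnn //= ?up.
have [sz _ _] := uni_linear ZR0 (Rint_sub (leq0n _) (leqnn _) dR) Z0.
by apply/eqP => e; move: sz; rewrite e uni0 size_poly0.
Qed.

(** Since [delta_t] maps [x_p] to a polynomial in later variables, the recursion
    in [t] passes to the coefficient of [x_p]. *)
Lemma yrec_left p q m l : sfun eta p = Some q -> siter eta m q = Some l ->
  exists2 b, b \in Rint p.+1 l.+1 & yrec p m.+1 = 'X_p * yrec q m + b.
Proof.
move=> pq; have pl m' l' : siter eta m' q = Some l' -> siter eta m'.+1 p = Some l'.
  by rewrite siterSr pq.
have ltpq : (p < q)%N by have := sfunP eta p; rewrite pq => -[].
elim: m l => [|m IH] l ql; have := yrecS (pl _ _ ql).
  case: ql => <- E; exists (- ((lam q)^-1 *: delta q 'X_p)); last exact: E.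
  by apply/RintN/RintZ; apply: Rint_sub (delta_left ltpq).
move=> ->; have [l' ql' [_ _ l'l]] := siter_pred ql.
have [b bR ->] := IH _ ql'; have [ZR _] := yrec_Rint ql'.
have qR j' : (j' <= q)%N -> yrec q m \in Rint j' l by move=> jq; exact: Rint_sub ZR.
have bR' : b \in Rint p.+1 l by exact: Rint_sub bR.
have bR0 : b \in Rint 0 l by exact: Rint_sub bR'.
have [_ ql0] := siter_eta ql.
have pltl : (p < l)%N by apply: (leq_trans ltpq); exact: leq_trans (leq_addr _ _) ql0.
have pR : 'X_p \in Rint (K := K) 0 l by rewrite Rint_var.
rewrite (yrecS ql) deltaD ?deltaM ?RintM ?qR //.
exists (b * 'X_l - (lam l)^-1 *: (delta l 'X_p * yrec q m + delta l b)); last first.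
  by rewrite !scalerDr -!mul_mpolyC; ring.
have up f : f \in Rint p.+1 l -> f \in Rint p.+1 l.+1 by exact: Rint_sub.
rewrite RintB ?RintM ?Rint_var ?pltl ?leqnn //= ?(up b) //.
apply/up/RintZ.
apply: RintD; last by rewrite delta_Rint.
by apply: RintM; [exact: delta_left|exact: qR].
Qed.

(** For intervals that start at the first element of a class, [yrec] gives the
    given prime elements of the extension itself, by [normal_linear]. *)
Lemma admissible_yrec : exists y0 : 'I_N -> {mpoly K[N]},
  (forall q m l, pfun eta q = None -> siter eta m q = Some l -> y0 l = yrec q m) /\
  (forall l k, (l <= k)%N -> s_gt eta l k ->
        forall i, (i <= k)%N -> normal (y0 l) i).
Proof.
have [c [y0 [c_low y0E y0_hom y0_prime _]]] := eta_adm.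
have nrm l k : (l <= k)%N -> s_gt eta l k -> forall i, (i <= k)%N -> normal (y0 l) i.
  move=> lk sk i ik; have [_ [_ _ H _ _]] := y0_prime k l lk sk.
  have [|z _ Hz] := H 'X_i; first by rewrite Rint_var.
  by exists z; rewrite Hz mulrC.
have s_gtxx l : s_gt eta l l.
  by rewrite /s_gt; have := sfunP eta l; case: (sfun eta l) => [j []|].
exists y0; split=> // q m l pq; elim: m l => [|m IH] l.
  by case=> <-; rewrite y0E pq.
move=> st; have [l' ql' [ll' _ ltl]] := siter_pred st.
have pl : pfun eta l = Some l' by apply/pfun_sfun.
have YE : y0 l = yrec q m * 'X_l - c l by rewrite y0E pl (IH _ ql').
have [ZR Z0] := yrec_Rint ql'.
have ZR0 : yrec q m \in Rint 0 l by exact: Rint_sub ZR.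
have cR : c l \in Rint 0 l by case: (c_low l); rewrite // pl.
have [|| cE _] := normal_linear ZR0 cR Z0.
- by rewrite -YE; exact: homogeneous_lie.
- by rewrite -YE; apply: (nrm l l).
by rewrite YE cE (yrecS st).
Qed.

(** On an interval to the left of which no element of its class remains,
    [yrec q m] is one of the prime elements of the extension itself; cutting
    off further variables on the left means passing to coefficients of first
    variables. *)
Lemma yrec_normal q m l k i : siter eta m q = Some l -> (l <= k)%N ->
  s_gt eta l k -> (i <= k)%N -> (if pfun eta q is Some p then (p < i)%N else true) ->
  normal (yrec q m) i.
Proof.
move=> + lk sk ik; have [y0 [y0E nrm]] := admissible_yrec.
have [n] := ubnP q; elim: n q m => // n IH q m qn ql.
case e: (pfun eta q) => [p|] pi; last by rewrite -(y0E _ _ _ e ql); exact: nrm lk sk _ ik.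
have pq : sfun eta p = Some q by apply/pfun_sfun.
have [b bR E] := yrec_left pq ql; have [ZR _] := yrec_Rint ql.
have ltpq : (p < q)%N by have := sfunP eta p; rewrite pq => -[].
have ql' : (q <= l)%N by have [_] := siter_eta ql; exact: leq_trans (leq_addr _ _).
have pl : siter eta m.+1 p = Some l by rewrite siterSr pq.
apply: (normal_left_coef (q := p) (k := k.+1) (b := b)).
- exact: Rint_sub ZR.
- exact: Rint_sub bR.
- by rewrite pi.
rewrite -E; apply: IH pl _; first by exact: leq_trans ltpq _.
case e': (pfun eta p) => [p'|//]; have := pfunP eta p; rewrite e' => -[lt _ _].
exact: ltn_trans pi.
Qed.

(** * Factorization of normal elements *)

Variable y : 'I_N -> 'I_N -> {mpoly K[N]}.
Hypothesis y_primes : interval_primes R eta y.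

Lemma y_lead q l m : siter eta m q = Some l ->
  [/\ y q l != 0, lead_coeff (y q l) = 1 &
    forall x, lead_mnm (y q l) x = ((q <= x <= l)%N && (eta x == eta q))].
Proof.
move=> ql; have [[_ [_ y0 _ _ _]] c1 e] := y_primes ql; split=> // x.
have := congr1 (fun v : 'cV_N => v x 0) e; rewrite eintE mxE; by case.
Qed.

Lemma y_normal q l m : siter eta m q = Some l ->
  [/\ y q l \in Rint q l.+1, lie_hom (y q l) &
    forall i, (q <= i <= l)%N -> normal (y q l) i].
Proof.
move=> ql; have [[hom [yR _ H _ _]] _ _] := y_primes ql; split=> //.
  exact: homogeneous_lie.
move=> i iR; have [|z _ Hz] := H 'X_i; first by rewrite Rint_var.
by exists z; rewrite Hz mulrC.
Qed.

(** [ytrunc j l] is the prime element of the longest interval ending at [l] with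
    first index at least [j]. *)
Definition ytrunc (j : nat) l := y (pO eta j l) l.

Definition last_below (k : nat) l :=
  (l < k)%N && (if sfun eta l is Some s then (k <= s)%N else true).

(** Indexes the prime elements of the interval algebra in the variables from [j]
    to [k - 1]. *)
Definition prime_index (j k : nat) l := (j <= l)%N && last_below k l.

Lemma ytrunc_siter (j : nat) l : (j <= l)%N -> exists m, siter eta m (pO eta j l) = Some l.
Proof.
by move=> /(pOP eta)[/andP[_ le] e _]; exact: siter_exists.
Qed.

Lemma ytrunc_lead (j : nat) l : (j <= l)%N ->
  [/\ ytrunc j l != 0, lead_coeff (ytrunc j l) = 1 &
    forall x, lead_mnm (ytrunc j l) x = ((j <= x <= l)%N && (eta x == eta l))].
Proof.
move=> jl; have [m Hm] := ytrunc_siter jl; have [W0 c1 e] := y_lead Hm; split=> // x.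
rewrite /ytrunc e; have [/andP[jp pl] ep Hp] := pOP eta jl.
rewrite ep; have [ex|] := eqVneq (eta x) (eta l); rewrite ?andbF // !andbT.
case: (x <= l)%N; rewrite ?andbF // !andbT; congr nat_of_bool.
apply/idP/idP => [/(leq_trans jp) //|jx]; exact: Hp.
Qed.

Lemma lead_prod_ytrunc (j : nat) (Q : pred 'I_N) (e : 'I_N -> nat) :
  (forall l, Q l -> (j <= l)%N) ->
  [/\ \prod_(l | Q l) ytrunc j l ^+ e l != 0,
     forall x, lead_mnm (\prod_(l | Q l) ytrunc j l ^+ e l) x =
       (\sum_(l | Q l) ((j <= x <= l)%N && (eta x == eta l)) * e l)%N
   & lead_coeff (\prod_(l | Q l) ytrunc j l ^+ e l) = 1].
Proof.
move=> Qj.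
have [||n0 L C] := @lead_prod K N _ Q (fun l => ytrunc j l ^+ e l).
- by move=> l /Qj/ytrunc_lead[W0 _ _]; exact: expf_neq0.
- by move=> l /Qj/ytrunc_lead[W0 c _]; have [_ ->] := lead_exprn (e l) W0; rewrite c expr1n.
split=> // x; rewrite L; apply: eq_bigr => l /Qj jl.
have [W0 _ E] := ytrunc_lead jl; have [-> _] := lead_exprn (e l) W0.
by rewrite mulmnE E.
Qed.

Lemma last_below_max (k : nat) l (x : 'I_N) :
  last_below k l -> (l <= x < k)%N -> eta x = eta l -> x = l.
Proof.
case/andP=> lk H /andP[lx xk] ex; apply/val_inj/eqP; rewrite eqn_leq lx andbT leqNgt.
apply/negP => lt; have := sfunP eta l; case: (sfun eta l) H => [s ks|_ Hl].
  by case=> _ _ /(_ x lt ex); lia.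
exact: Hl lt ex.
Qed.

Lemma siter_step q l0 l m : siter eta m q = Some l0 -> siter eta m.+1 q = Some l ->
  sfun eta l0 = Some l /\ (l0 < l)%N.
Proof.
move=> ql0 ql; have [l0' e [sl0 _ lt]] := siter_pred ql.
by move: e; rewrite ql0 => -[->].
Qed.

Lemma last_below_chain q l0 l m k : siter eta m q = Some l0 ->
  siter eta m.+1 q = Some l -> last_below l k -> eta k = eta q -> k = l0.
Proof.
move=> ql0 ql bk ek; have [el0 _] := siter_eta ql0; have /andP[kl _] := bk.
have [sl0 l0l] := siter_step ql0 ql.
have bl0 : last_below l l0 by rewrite /last_below l0l sl0 /=.
have [le|lt] := leqP k l0.
  by apply/esym; apply: (last_below_max bk); rewrite ?le ?l0l // el0.
by apply: (last_below_max bl0); rewrite ?(ltnW lt) ?kl // el0.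
Qed.

(** For [l] last in its class below [k], the variable [x_l] occurs in the leading
    monomial of [ytrunc j l] and of no other factor. *)
Lemma lead_prod_ytrunc_index (j k : nat) (Q : pred 'I_N) e l :
  (forall x, Q x -> prime_index j k x) -> Q l ->
  lead_mnm (\prod_(l | Q l) ytrunc j l ^+ e l) l = e l.
Proof.
move=> QB Ql; have [|_ -> _] := @lead_prod_ytrunc j Q e; first by move=> x /QB/andP[].
have /andP[jl bl] := QB l Ql.
rewrite (bigD1 l) //= jl leqnn eqxx mul1n big1 ?addn0 // => x /andP[Qx xl].
have /andP[jx bx] := QB x Qx.
case: andP => [[/andP[_ lx] /eqP ex]|_]; last by rewrite mul0n.
case/eqP: xl; apply: last_below_max bl _ (esym ex); rewrite lx /=.
by case/andP: bx.
Qed.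

(** Holds for all [t] by [recursive_all], which is proved by strong induction: the
    property below [t] gives the factorization of normal elements below [t], and
    this in turn gives the property at [t]. *)
Definition recursive_at t := forall q m, siter eta m q = Some t ->
  y q t = yrec q m /\ forall m', m = m'.+1 -> delta t (yrec q m') != 0.

Lemma ytrunc_normal (j : nat) l (k : 'I_N) i : recursive_at l -> (j <= l <= k)%N ->
  s_gt eta l k -> (j <= i <= k)%N -> normal (ytrunc j l) i.
Proof.
move=> rl /andP[jl lk] sk /andP[ji ik]; have [m Hm] := ytrunc_siter jl.
rewrite /ytrunc (proj1 (rl _ _ Hm)).
apply: (yrec_normal Hm lk sk ik).
have [/andP[jp pl] ep Hp] := pOP eta jl.
case e: (pfun eta _) => [p|//]; have := pfunP eta (pO eta j l); rewrite e => -[lt ep' _].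
rewrite ltnNge; apply/negP => ip.
by have := Hp p (leq_trans ji ip); rewrite ep' => /(_ ep); rewrite leqNgt lt.
Qed.

Lemma ytrunc_Rint (j : nat) l : (j <= l)%N ->
  ytrunc j l \in Rint j l.+1 /\ lie_hom (ytrunc j l).
Proof.
move=> jl; have [m Hm] := ytrunc_siter jl; have [yR hom _] := y_normal Hm; split=> //.
by have [/andP[jp _] _ _] := pOP eta jl; apply: Rint_sub yR.
Qed.

Lemma lie_hom_scale (x : K) a : lie_hom a -> lie_hom (x *: a).
Proof.
by move=> Ha h; have [c Hc] := Ha h; exists c; rewrite lie_scale Hc !scalerA mulrC.
Qed.

Lemma lie_hom_prod (Q : pred 'I_N) (F : 'I_N -> {mpoly K[N]}) :
  (forall l, Q l -> lie_hom (F l)) -> lie_hom (\prod_(l | Q l) F l).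
Proof.
move=> H; elim/big_ind: _ => //; last by move=> a b; exact: lie_homM.
by move=> h; exists 0; rewrite lie1 scale0r.
Qed.

Lemma normal_prod (Q : pred 'I_N) (F : 'I_N -> {mpoly K[N]}) i :
  (forall l, Q l -> normal (F l) i) -> normal (\prod_(l | Q l) F l) i.
Proof.
move=> H; elim/big_ind: _ => //; last by move=> a b; exact: normalM.
by have := @normalX 'X_i 0 i (normal_var i); rewrite expr0.
Qed.

Lemma delta_eq0_Rint (j : nat) t b : (forall i, (j <= i < t)%N -> delta t 'X_i = 0) ->
  b \in Rint j t -> delta t b = 0.
Proof.
move=> H; have sub0 c : c \in Rint j t -> c \in Rint 0 t by exact: Rint_sub.
apply: (@Rint_ind _ _ (fun b => delta t b = 0)).
- exact: delta1.
- by move=> x a c aR cR Ha Hc; rewrite delta_lin ?sub0 // Ha Hc scaler0 addr0.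
- by move=> a c aR cR Ha Hc; rewrite deltaM ?sub0 // Ha Hc mul0r mulr0 addr0.
exact: H.
Qed.

(** When [x_t] is adjoined, the prime element ending at the predecessor of [t] is
    replaced by the one ending at [t], and the others remain. *)
Lemma prime_index_step (j : nat) t l : l != t ->
  prime_index j t.+1 l = prime_index j t l && (pfun eta t != Some l).
Proof.
move=> lt; rewrite /prime_index /last_below -!andbA; congr andb.
rewrite ltnS leq_eqVlt val_eqE (negbTE lt) /=; congr andb.
have -> : (pfun eta t == Some l) = (sfun eta l == Some t).
  apply/eqP/eqP => [|] H; first exact: (proj1 (pfun_sfun eta l t) H).
  exact: (proj2 (pfun_sfun eta l t) H).
case: (sfun eta l) => [s|//].
have -> : (Some s == Some t) = (s == t) by [].
by rewrite ltn_neqAle andbC eq_sym.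
Qed.

Lemma prime_index_last (j : nat) t : (j <= t)%N -> prime_index j t.+1 t.
Proof.
move=> jt; rewrite /prime_index /last_below jt leqnn /=.
by have := sfunP eta t; case: (sfun eta t) => [s []|].
Qed.

Lemma s_gt_prime_index (j : nat) t l : prime_index j t.+1 l -> s_gt eta l t.
Proof. by case/and3P => _ _; rewrite /s_gt; case: (sfun eta l). Qed.

(** By [normal_coef], iterating [delta_t] on the top coefficient runs through
    nonzero multiples of the lower coefficients down to the constant one. *)
Lemma normal_iter t a : a \in Rint 0 t.+1 -> a != 0 -> lie_hom a -> normal a t ->
  let P := uni t a in P`_0 != 0 -> nil_degree (delta t) (lead_coef P) (size P).-1.
Proof.
move=> aR a0 hom nrm P P00; rewrite lead_coefE; set n := (size P).-1.
have PR x : P`_x \in Rint 0 t by exact: uni_coef_Rint.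
have [d0 dS] := normal_coef aR hom nrm.
have it x : (x <= n)%N -> exists2 c : K, c != 0 & iter x (delta t) P`_n = c *: P`_(n - x).
  elim: x => [|x IH] xn; first by exists 1; rewrite ?oner_eq0 // subn0 scale1r.
  have [c c0 Hc] := IH (ltnW xn); have lt : (n - x.+1 < n)%N by lia.
  have e : (n - x)%N = (n - x.+1).+1 by lia.
  exists (c * - (lam t *+ (n - (n - x.+1)))).
    by rewrite mulf_neq0 // oppr_eq0 lamMn_neq0 //; lia.
  by rewrite iterS Hc deltaZ // e (dS _ lt) scalerA.
have [c c0 Hc] := it n (leqnn _); rewrite subnn in Hc; split.
  by rewrite Hc scaler_eq0 negb_or c0.
by rewrite iterS Hc deltaZ // [X in c *: X]d0 scaler0.
Qed.

Lemma prime_step t q m : recursive_at t -> siter eta m.+1 q = Some t ->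
  let a := yrec q m in let c := (lam t)^-1 *: delta t a in
  [/\ y q t = a * 'X_t - c, a \in Rint q t, a != 0, delta t a != 0 &
    delta t (delta t a) = 0].
Proof.
move=> rt st a c; have [e /(_ _ erefl) d0] := rt _ _ st.
have [l ql [_ _ lt]] := siter_pred st.
have [aR a0] := yrec_Rint ql.
have aR' : a \in Rint q t by exact: Rint_sub aR.
have aR0 : a \in Rint 0 t by exact: Rint_sub aR'.
have yE : y q t = a * 'X_t - c by rewrite e (yrecS st).
have [yR hom nrm] := y_normal st; have [_ qm] := siter_eta st.
have cR : c \in Rint 0 t by rewrite RintZ // delta_Rint0.
rewrite yE in hom nrm; split=> //.
have [|_] := normal_linear aR0 cR a0 hom.
  by apply: nrm; lia.
rewrite /c deltaZ ?delta_Rint0 // => /eqP.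
by rewrite scaler_eq0 invr_eq0 (negbTE (lam_neq0 _)) => /eqP.
Qed.

(** Here [x_t] is itself normal, so that [delta_t] vanishes on the interval algebra
    and [normal_coef] leaves only the top term. *)
Lemma factor_step_new (j : nat) t a : (j <= t)%N ->
  (if pfun eta t is Some p then (p < j)%N else true) ->
  a \in Rint j t.+1 -> a != 0 -> lie_hom a ->
  (forall i, (j <= i <= t)%N -> normal a i) ->
  a = lead_coef (uni t a) * 'X_t ^+ (size (uni t a)).-1.
Proof.
move=> jt pj aR a0 hom nrm; have aR0 : a \in Rint 0 t.+1 by exact: Rint_sub aR.
have d0 i : (j <= i < t)%N -> delta t 'X_i = 0.
  move=> /andP[ji it].
  have Zt : siter eta 0 t = Some t by [].
  have [||z Hz] := yrec_normal Zt
    (leqnn t) _ (ltnW it).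
  - by apply: (@s_gt_prime_index j); exact: prime_index_last.
  - by case: (pfun eta t) pj => // p pj; exact: leq_trans ji.
  have XR : 'X_t \in Rint (K := K) 0 t.+1 by rewrite Rint_var //=.
  have iR : 'X_i \in Rint (K := K) 0 t by rewrite Rint_var.
  have [_] := br_coef XR iR (X_neq0 _ _) Hz; apply.
  by rewrite uniX eqxx coefX.
rewrite lead_coefE; set P := uni t a; set n := (size P).-1.
have nt : normal a t by apply: nrm; rewrite jt leqnn.
have [_ dS] := normal_coef aR0 hom nt.
have P0 x : (x < n)%N -> P`_x = 0.
  move=> xn; have := dS _ xn; rewrite (delta_eq0_Rint d0); last exact: uni_coef_Rint.
  move=> /esym/eqP; rewrite scaler_eq0 oppr_eq0.
  by rewrite (negbTE (lamMn_neq0 _ _)) ?subn_gt0 //= => /eqP.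
have sP : size P = n.+1 by rewrite /n prednK // lt0n size_poly_eq0 uni_neq0.
rewrite {1}(uni_sum (leqnn (size (uni t a)))) -/P sP big_ord_recr /=.
by rewrite big1 ?add0r // => x _; rewrite P0 ?mul0r.
Qed.

(** Let [n] be the degree of [a] in [x_t].  Since [delta_t] does not vanish on the
    interval algebra, [x_t] does not divide [a] ([br_coef]); so by [normal_iter]
    the top coefficient [b * ytrunc j p ^+ e] has degree [n] for the filtration
    defined by [delta_t].  As [delta_t b = 0] and [ytrunc j p] has degree one, [n = e].
    Now [a] and [b * ytrunc j t ^+ e] have the same top term. *)
Lemma factor_step_old (j : nat) t p a b e : recursive_at t -> recursive_at p ->
  pfun eta t = Some p -> (j <= p)%N ->
  a \in Rint j t.+1 -> a != 0 -> lie_hom a ->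
  (forall i, (j <= i <= t)%N -> normal a i) ->
  b \in Rint j t -> b != 0 -> lie_hom b -> normal b t ->
  lead_coef (uni t a) = b * ytrunc j p ^+ e ->
  a = b * ytrunc j t ^+ e.
Proof.
move=> rt rp pt jp aR a0 a_hom a_nrm bR b0 b_hom b_nrm lcE.
have aR0 : a \in Rint 0 t.+1 by exact: Rint_sub aR.
have bR0 : b \in Rint 0 t by exact: Rint_sub bR.
have st : sfun eta p = Some t by apply/pfun_sfun.
have [ltpt et] : (p < t)%N /\ eta t = eta p by have := sfunP eta p; rewrite st => -[].
have [/andP[jq qp] eq Hq] := pOP eta jp; set q := pO eta j p in jq qp eq Hq *.
have jt : (j <= t)%N by exact: leq_trans (ltnW ltpt).
have qt : pO eta j t = q.
  apply: pO_eq; rewrite ?jq ?(leq_trans qp (ltnW ltpt)) ?et //.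
have [m qm] := ytrunc_siter jp; rewrite -/q in qm.
have qm1 : siter eta m.+1 q = Some t by rewrite siterS qm.
have [yE AR A0 dA ddA] := prime_step rt qm1.
have AE : ytrunc j p = yrec q m by rewrite /ytrunc -/q; have [] := rp _ _ qm.
have YE : ytrunc j t = y q t by rewrite /ytrunc qt.
move: yE AR A0 dA ddA lcE; rewrite -YE -AE.
set A := ytrunc j p; set Y := ytrunc j t => yE AR A0 dA ddA lcE.
have AR0 : A \in Rint 0 t by exact: Rint_sub AR.
have [YR Y_hom] := ytrunc_Rint jt; rewrite -/Y in YR Y_hom.
have YR0 : Y \in Rint 0 t.+1 by exact: Rint_sub YR.
have Y_nrm : normal Y t.
  have [_ _ H] := y_normal qm1; rewrite /Y YE; apply: H.
  by rewrite (leq_trans qp (ltnW ltpt)) leqnn.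
have der := delta_der t; have nilp := @delta_nilpotent _ _ R t.
have db : delta t b = 0 by exact: (normal_delta_eq0 bR0).
have P00 : (uni t a)`_0 != 0.
  apply/eqP => P00; move/eqP: dA; apply; apply: (@delta_eq0_Rint j); last first.
    by apply: Rint_sub AR.
  move=> i /andP[ji it]; have [|z Hz] := a_nrm i; first by rewrite ji ltnW.
  have iR : 'X_i \in Rint (K := K) 0 t by rewrite Rint_var.
  by have [_] := br_coef aR0 iR a0 Hz; apply.
have a_nt : normal a t by apply: a_nrm; rewrite jt leqnn.
have nd := normal_iter aR0 a0 a_hom a_nt P00.
have nd' : nil_degree (delta t) (b * A ^+ e) e.
  rewrite -[X in nil_degree _ _ X]add0n.
  apply: (nil_degreeM charK der (Rint1 0 t) (@RintM _ _ 0 t)); rewrite ?RintX //.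
  by apply: (nil_degreeX charK der (Rint1 0 t) (@RintM _ _ 0 t)).
have ne : (size (uni t a)).-1 = e.
  by apply: (nil_degree_inj der (Rint1 0 t) nd); rewrite lcE.
have cR : (lam t)^-1 *: delta t A \in Rint 0 t by rewrite RintZ // delta_Rint0.
have [sY _ Y1] := uni_linear AR0 cR A0; rewrite -yE in sY Y1.
have lY : lead_coef (uni t Y) = A by rewrite lead_coefE sY.
have Y0 : uni t Y != 0 by rewrite -size_poly_eq0 sY.
have U : uni t (b * Y ^+ e) = b%:P * uni t Y ^+ e by rewrite uniM uniXn uni_low.
apply: (normal_top_inj (t := t)) => //.
- by rewrite RintM ?RintX //; apply: Rint_sub bR0.
- by apply: lie_homM => //; exact: lie_homX.
- by apply: normalM => //; exact: normalX.
- have s1 : (0 < size (uni t a))%N by rewrite lt0n size_poly_eq0 uni_neq0.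
  have s2 : (0 < size (uni t Y ^+ e))%N by rewrite lt0n size_poly_eq0 expf_neq0.
  by rewrite U size_Cmul // -(prednK s1) -(prednK s2) ne size_exp sY mul1n.
by rewrite U lead_coefM lead_coefC lead_coef_exp lY.
Qed.

(** Induction on the number of variables: the top coefficient of [a] in the last
    variable is normal, and [factor_step_new] and [factor_step_old] lift its
    factorization to [a]. *)
Lemma normal_factorization (k j : nat) a : (k <= N)%N ->
  (forall t, (t < k)%N -> recursive_at t) ->
  a \in Rint j k -> a != 0 -> lie_hom a ->
  (forall i, (j <= i < k)%N -> normal a i) ->
  exists (c : K) (e : 'I_N -> nat),
    c != 0 /\ a = c *: \prod_(l | prime_index j k l) ytrunc j l ^+ e l.
Proof.
elim: k a => [|k IH] a kN rec aR a0 hom nrm.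
  have [c aE] := Rint_const (leq0n j) aR; exists c, (fun=> 0%N); split.
    by move: a0; rewrite aE mpolyC_eq0.
  by rewrite big1 // aE -[c *: 1]mul_mpolyC mulr1.
have [kj|jk] := ltnP k j.
  have [c aE] := Rint_const kj aR; exists c, (fun=> 0%N); split.
    by move: a0; rewrite aE mpolyC_eq0.
  by rewrite big1 // aE -[c *: 1]mul_mpolyC mulr1.
have [t tk] : exists t : 'I_N, k = t :> nat by exists (Ordinal kN).
move: kN jk aR rec nrm IH; rewrite tk => kN jk aR rec nrm IH.
have P0 := uni_neq0 t a0.
have an0 : lead_coef (uni t a) != 0 by rewrite lead_coef_eq0.
have anR : lead_coef (uni t a) \in Rint j t by rewrite lead_coefE; exact: uni_coef_Rint.
have an_hom : lie_hom (lead_coef (uni t a)).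
  by rewrite lead_coefE; apply: lie_hom_coef hom; exact: aR.
have [||c [e [c0 anE]]] := IH _ (ltnW kN) _ anR an0 an_hom.
- by move=> t' lt; apply: rec; rewrite ltnW.
- move=> i /andP[ji it]; apply: (normal_lead_coef aR a0).
    by rewrite ji.
  by apply: nrm; rewrite ji ltnW.
have split_t F : \prod_(l | prime_index j t.+1 l) F l =
    F t * \prod_(l | prime_index j t l && (pfun eta t != Some l)) F l :> {mpoly K[N]}.
  rewrite (bigD1 t) ?prime_index_last //=; congr (_ * _); apply: eq_bigl => l.
  have [->|lt] := eqVneq l t; last by rewrite andbT prime_index_step.
  by rewrite andbF /prime_index /last_below ltnn andbF.
have nrm' i : (j <= i <= t)%N -> normal a i by move=> H; apply: nrm; rewrite ltnS.
have [pj|pj] := boolP (if pfun eta t is Some p then (p < j)%N else true).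
  have tj (l : 'I_N) : (j <= l)%N -> eta l = eta t -> (t <= l)%N.
    move=> jl el; rewrite leqNgt; apply/negP => lt; have := pfunP eta t.
    case: (pfun eta t) pj => [p pj|_ H]; last exact: H lt el.
    by case=> _ _ /(_ l lt el); lia.
  have Wt : ytrunc j t = 'X_t.
    have tt : pO eta j t = t by apply: pO_eq; rewrite ?jk ?leqnn.
    have rt : recursive_at t by exact: rec.
    by rewrite /ytrunc tt; have [] := rt t 0%N erefl.
  exists c, (fun l => if l == t then (size (uni t a)).-1 else e l); split=> //.
  rewrite split_t eqxx Wt {1}(factor_step_new jk pj aR a0 hom nrm') anE.
  rewrite -scalerAl mulrC; congr (_ *: (_ * _)).
  apply: congr_big => // l.
    case: (boolP (prime_index j t l)) => //= /andP[jl _]; apply/esym/eqP => e'.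
    by move: pj; rewrite e' ltnNge jl.
  move=> /andP[_ /andP[lt _]]; case: eqP => // e'.
  by rewrite e' ltnn in lt.
case pt: (pfun eta t) pj split_t => [p|//]; rewrite -leqNgt => jp split_t.
have st : sfun eta p = Some t by apply/pfun_sfun.
have ltpt : (p < t)%N by have := sfunP eta p; rewrite st => -[].
have bp : prime_index j t p by rewrite /prime_index /last_below jp ltpt st /=.
pose Q l := prime_index j t l && (l != p).
have QS l : Q l -> [/\ (j <= l)%N, (l < t)%N & prime_index j t.+1 l].
  move=> /andP[bl lp]; have /andP[jl /andP[lt _]] := bl; split=> //.
  rewrite prime_index_step ?bl /=; first by rewrite pt; apply: contra lp => /eqP[->].
  by apply: contraTneq lt => ->; rewrite ltnn.
pose B := \prod_(l | Q l) ytrunc j l ^+ e l.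
have lcE : lead_coef (uni t a) = (c *: B) * ytrunc j p ^+ e p.
  by rewrite anE (bigD1 p) //= -scalerAl mulrC.
have BR : c *: B \in Rint j t.
  apply/RintZ/Rint_prod => l /QS[jl lt _]; apply: RintX.
  by have [WR _] := ytrunc_Rint jl; apply: Rint_sub WR.
have aE : a = c *: B * ytrunc j t ^+ e p.
  apply: (@factor_step_old j t p) => //.
  - exact: rec.
  - by apply: rec; exact: ltnW.
  - by apply: contraNneq an0 => B0; rewrite lcE B0 mul0r.
  - apply/lie_hom_scale/lie_hom_prod => l /QS[jl _ _]; apply: lie_homX.
    by have [_] := ytrunc_Rint jl.
  apply/normalZ/normal_prod => l /QS[jl lt bl]; apply: (normalX).
  apply: (@ytrunc_normal j l t t); rewrite ?jl ?jk ?leqnn //=.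
  - by apply: rec; exact: ltnW.
  - exact: ltnW.
  exact: s_gt_prime_index bl.
exists c, (fun l => if l == t then e p else e l); split=> //.
rewrite split_t eqxx {1}aE -scalerAl mulrC; congr (_ *: (_ * _)).
apply: congr_big => // l.
  rewrite /Q; congr andb; have -> : (Some p == Some l) = (p == l) by [].
  by rewrite eq_sym.
move=> /andP[/andP[_ /andP[lt _]] _]; case: eqP => // e'.
by rewrite e' ltnn in lt.
Qed.

Lemma y_top q m t : siter eta m q = Some t ->
  let P := uni t (y q t) in
  size P = 2%N /\ lead_coeff (lead_coef P) = 1 /\
  forall x : 'I_N, (x < t)%N ->
    lead_mnm (lead_coef P) x = ((q <= x)%N && (eta x == eta q)).
Proof.
move=> qt P; have [y0 c1 L] := y_lead qt; have [yR _ _] := y_normal qt.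
have [et qm] := siter_eta qt; have yR0 : y q t \in Rint 0 t.+1 by exact: Rint_sub yR.
have [La Ca] := lead_lead_coef yR0 y0; rewrite -/P in La Ca.
have PR : lead_coef P \in Rint 0 t by rewrite lead_coefE; exact: uni_coef_Rint.
have P0 : lead_coef P != 0 by rewrite lead_coef_eq0 uni_neq0.
have [inP _] := lead_mnmP P0.
have := L t; rewrite La mnmDE mulmnE mnm1E eqxx mul1n (Rint_mnm PR inP) ?ltnn ?andbF //.
rewrite et eqxx leqnn !andbT add0n (leq_trans (leq_addr _ _) qm) => n1.
split; first by rewrite -[size P]prednK ?n1 // lt0n size_poly_eq0 uni_neq0.
split; first by rewrite -Ca.
move=> x xt; have := L x; rewrite La mnmDE mulmnE mnm1E.
have -> : (t == x) = false by apply/eqP => e; rewrite e ltnn in xt.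
by rewrite mul0n addn0 => ->; rewrite (ltnW xt) andbT.
Qed.

(** The top coefficient [a] of [y q t] in [x_t] is a product of prime elements
    of the interval algebra from [q] to [t - 1], and by its leading term it is
    the one ending at the predecessor of [t], or [1]. Normality with respect to
    [x_t] yields the lower coefficient. If it vanished then [y q t] would be
    the product [a * 'X_t]. *)
Lemma recursive_all t : recursive_at t.
Proof.
have [n] := ubnP t; elim: n t => // n IH t tn q m qt.
have rec l : (l < t)%N -> recursive_at l by move=> lt; apply: IH; exact: leq_trans lt tn.
have [y0 c1 L] := y_lead qt; have [yR hom nrm] := y_normal qt.
have [sP [lc1 lcL]] := y_top qt; have [et qm] := siter_eta qt.
have qlt : (q <= t)%N by exact: leq_trans (leq_addr _ _) qm.
set P := uni t (y q t) in sP lc1 lcL.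
have PR x : P`_x \in Rint q t by exact: uni_coef_Rint.
set a := lead_coef P in lc1 lcL; have aP : a = P`_1 by rewrite /a lead_coefE sP.
have aR : a \in Rint q t by rewrite aP.
have aR0 : a \in Rint 0 t by exact: Rint_sub aR.
have a0 : a != 0 by rewrite lead_coef_eq0 uni_neq0.
pose c := - P`_0; have cR : c \in Rint 0 t.
  by rewrite /c RintN //; apply: Rint_sub (PR 0%N).
have yE : y q t = a * 'X_t - c.
  rewrite {1}(uni_sum (leqnn (size (uni t (y q t))))) -/P sP big_ord_recl big_ord1 /=.
  by rewrite expr0 mulr1 expr1 -aP /c opprK addrC.
have [||cE _] := normal_linear aR0 cR a0.
- by rewrite -yE.
- by rewrite -yE; apply: nrm; rewrite qlt leqnn.
have [||k [e [k0 aE]]] := @normal_factorization t q a (ltnW (ltn_ord t)) rec aR a0.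
- by rewrite aP; apply: lie_hom_coef hom; exact: yR.
- move=> i /andP[qi it]; apply: (normal_lead_coef yR y0).
    by rewrite qi.
  by apply: nrm; rewrite qi ltnW.
have [|B0 _ B1] := @lead_prod_ytrunc q (prime_index q t) e; first by move=> l /andP[].
set B := \prod_(l | _) _ in aE B0 B1.
have k1 : k = 1.
  have k0' : k%:MP != 0 :> {mpoly K[N]} by rewrite mpolyC_eq0.
  have [_ Ck] := lead_mnmC N k0; have [_] := lead_mul k0' B0.
  by rewrite mul_mpolyC -aE lc1 Ck B1 mulr1.
rewrite k1 scale1r in aE.
case: m qt qm => [|m] qt qm.
  case: qt => qt; split=> //; rewrite yE cE.
  have -> : a = 1.
    rewrite aE /B big_pred0 // => l; rewrite /prime_index /last_below qt.
    by case: (leqP t l) => //=.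
  by rewrite delta1 scaler0 subr0 mul1r qt.
have [p qp [st qlp ltpt]] := siter_pred qt; have [ep _] := siter_eta qp.
have bp : prime_index q t p by rewrite /prime_index /last_below qlp ltpt st /=.
have Wp : ytrunc q p = yrec q m.
  have -> : ytrunc q p = y q p.
    by rewrite /ytrunc; congr y; apply: pO_eq; rewrite ?leqnn.
  by have [] := rec _ ltpt _ _ qp.
have eE l : prime_index q t l -> e l = (l == p).
  move=> bl; have <- := @lead_prod_ytrunc_index q t (prime_index q t) e l (fun _ => id) bl.
  have /andP[ql /andP[lt _]] := bl.
  rewrite -/B -aE lcL // ql /=; congr nat_of_bool; apply/eqP/eqP => [el|-> //].
  have [lp|pl] := leqP l p.
    by apply/esym; apply: (@last_below_max t l p); rewrite ?lp ?ltpt ?ep //; case/andP: bl.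
  by apply: (@last_below_max t p l); rewrite ?(ltnW pl) ?lt ?ep //; case/andP: bp.
have aW : a = yrec q m.
  rewrite aE /B (bigD1 p) //= eE // eqxx expr1 Wp big1 ?mulr1 // => l /andP[bl lp].
  by rewrite eE // (negbTE lp) expr0.
split; first by rewrite yE cE (yrecS qt) aW.
move=> m' [<-]; rewrite -aW; apply/eqP => da0.
have [[_ [_ _ _ n1 prime]] _ _] := y_primes qt.
have aR' : a \in Rint q t.+1 by exact: Rint_sub aR.
have XR : 'X_t \in Rint (K := K) q t.+1 by rewrite Rint_var ?qlt /=.
have yaX : y q t = a * 'X_t by rewrite yE cE da0 scaler0 subr0.
have yI : principal_ideal (Rint q t.+1) (y q t) (a * 'X_t).
  by exists 1; rewrite ?Rint1 // mul1r yaX.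
have [[b bR bE]|[b bR bE]] := prime _ _ aR' XR yI.
  have b0 : b != 0 by apply: contraNneq a0 => b0; rewrite bE b0 mul0r.
  have := congr1 (fun f => size (uni t f)) bE.
  rewrite uniM size_mul ?uni_neq0 // sP uni_low // size_polyC a0 addn2 /= => -[e1].
  by have := uni_neq0 t b0; rewrite -size_poly_eq0 -e1.
have ba1 : b * a = 1.
  by apply: (mulIf (X_neq0 K t)); rewrite -mulrA -yaX -bE mul1r.
have b0 : b != 0.
  by apply: contraTneq (oner_neq0 {mpoly K[N]}) => b0; rewrite -ba1 b0 mul0r eqxx.
have [Lba _] := lead_mul b0 a0; have [L1 _] := lead_mnmC N (oner_neq0 K).
have := congr1 (fun m : 'X_{1..N} => m p) Lba; rewrite ba1 -mpolyC1 L1 mnm0E mnmDE.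
by rewrite lcL // qlp ep eqxx addn1.
Qed.

(** * The elements u *)

Lemma yintE q l : (q <= l)%N -> yint y q l = y q l.
Proof. by rewrite /yint => ->. Qed.

Lemma yint_empty q l : (l < q)%N -> yint y q l = 1.
Proof. by rewrite /yint ltnNge => /negbTE ->. Qed.

Lemma chain_le q m l : siter eta m q = Some l -> (q <= l)%N.
Proof. by move=> /siter_eta[_]; exact: leq_trans (leq_addr _ _). Qed.

Lemma ytrunc_succ i i1 l m : sfun eta i = Some i1 -> siter eta m i1 = Some l ->
  ytrunc i.+1 l = y i1 l.
Proof.
move=> ii1 i1l; rewrite /ytrunc; congr y; have [ei1 _] := siter_eta i1l.
have := sfunP eta i; rewrite ii1 => -[lti ei Hi1].
apply: pO_eq; rewrite ?lti ?(chain_le i1l) ?ei1 // => k ik ek.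
by apply: Hi1; rewrite // ek ei.
Qed.

Lemma ueltE i i1 l0 l m : sfun eta i = Some i1 -> siter eta m i = Some l0 ->
  siter eta m.+1 i = Some l ->
  uelt eta y i m.+1 = y i l0 * y i1 l - yint y i1 l0 * y i l.
Proof.
move=> ii1 il0 il; have i1l : siter eta m i1 = Some l by move: il; rewrite siterSr ii1.
have s1 : spow eta 1 i = i1 by apply: spowE; rewrite siterSr ii1.
rewrite /uelt s1 (spowE il0) (spowE il).
by rewrite (yintE (chain_le il0)) (yintE (chain_le il)) (yintE (chain_le i1l)).
Qed.

Lemma y_yrec_normal q m l (b k : 'I_N) : siter eta m q = Some l -> (l <= k)%N ->
  s_gt eta l k -> (b <= k)%N -> (if pfun eta q is Some p then (p < b)%N else true) ->
  normal (y q l) b.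
Proof.
move=> ql lk sk bk pb; have [-> _] := recursive_all ql.
exact: (yrec_normal ql lk sk).
Qed.

Lemma s_gtxx l : s_gt eta l l.
Proof. by apply: (@s_gt_prime_index 0); exact: prime_index_last. Qed.

(** For an interval from [i] to [l] with second element [i1] and last but one
    element [l0], this is used with [y0 = y i l0], [Y0 = y i l], [Y1 = y i1 l] and
    [y1 = y i1 l0], or [y1 = 1] if the interval has only two elements; listing the
    properties treats the two cases of [y1] alike. *)
Record step_data i l y0 y1 Y0 Y1 : Prop := StepData {
  step_lt : (i < l)%N;
  step_Y0 : Y0 = y0 * 'X_l - (lam l)^-1 *: delta l y0;
  step_Y1 : Y1 = y1 * 'X_l - (lam l)^-1 *: delta l y1;
  step_R0 : y0 \in Rint i l;
  step_R1 : y1 \in Rint i.+1 l;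
  step_n0 : y0 != 0;
  step_n1 : y1 != 0;
  step_d0 : delta l (delta l y0) = 0;
  step_d1 : delta l (delta l y1) = 0;
  step_left : exists2 r, r \in Rint i.+1 l & y0 = 'X_i * y1 + r;
  step_hom0 : lie_hom Y0;
  step_hom1 : lie_hom Y1;
  step_nrm0 : forall b : 'I_N, (i < b < l)%N -> normal Y0 b;
  step_nrm1 : forall b : 'I_N, (i < b < l)%N -> normal Y1 b }.

Lemma step_dataP i i1 l0 l m : sfun eta i = Some i1 -> siter eta m i = Some l0 ->
  siter eta m.+1 i = Some l ->
  step_data i l (y i l0) (yint y i1 l0) (y i l) (y i1 l).
Proof.
move=> ii1 il0 il; have i1l : siter eta m i1 = Some l by move: il; rewrite siterSr ii1.
have lti : (i < i1)%N by have := sfunP eta i; rewrite ii1 => -[].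
have i1l' := chain_le i1l; have lt : (i < l)%N by exact: leq_trans lti _.
have pi1 : pfun eta i1 = Some i by apply/pfun_sfun.
have [YE R0 n0 _ dd0] := prime_step (@recursive_all l) il.
have [y0E _] := recursive_all il0; rewrite -y0E in YE R0 n0 dd0.
have [_ hom0 _] := y_normal il.
have [_ hom1 _] := y_normal i1l.
have nrm0 (b : 'I_N) : (i < b < l)%N -> normal (y i l) b.
  move=> /andP[ib bl]; apply: (y_yrec_normal il (leqnn l) (s_gtxx l) (ltnW bl)).
  case e: (pfun eta i) => [p|//]; have := pfunP eta i; rewrite e => -[pi _ _].
  exact: ltn_trans ib.
have nrm1 (b : 'I_N) : (i < b < l)%N -> normal (y i1 l) b.
  move=> /andP[ib bl]; apply: (y_yrec_normal i1l (leqnn l) (s_gtxx l) (ltnW bl)).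
  by rewrite pi1.
case: m il0 il i1l y0E => [|m] il0 il i1l y0E.
  case: il0 => il0; subst l0; case: i1l => i1l; subst i1.
  have Yl : y l l = 'X_l by have [] := @recursive_all l l 0%N erefl.
  rewrite yint_empty //; split=> //.
  - by rewrite delta1 scaler0 subr0 mul1r.
  - exact: Rint1.
  - exact: oner_neq0.
  - by rewrite delta1 delta0.
  by exists 0; rewrite ?Rint0 // y0E /= mulr1 addr0.
have i1l0 : siter eta m i1 = Some l0 by move: il0; rewrite siterSr ii1.
have [Y1E R1 n1 _ dd1] := prime_step (@recursive_all l) i1l.
have [y1E _] := recursive_all i1l0; rewrite -y1E in Y1E R1 n1 dd1.
rewrite yintE ?(chain_le i1l0) //; split=> //.
  by apply: Rint_sub R1.
have [r rR E] := yrec_left ii1 i1l0; exists r.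
  have [l0' e [_ _ l0l]] := siter_pred il; move: e; rewrite il0 => -[e].
  by rewrite -e in l0l; apply: Rint_sub rR.
by rewrite y0E y1E.
Qed.

(** Both [y0 * Y1] and [y1 * Y0] are normal for the same derivation and of the
    same weight, so their difference [u] is normal and homogeneous. It involves
    neither the first nor the last variable, because the leading terms cancel,
    and it is a Wronskian for the derivation [delta_l], which kills it. *)
Lemma step_u i l y0 y1 Y0 Y1 : step_data i l y0 y1 Y0 Y1 ->
  let u := y0 * Y1 - y1 * Y0 in
  [/\ u \in Rint i.+1 l, lie_hom u, delta l u = 0 &
    forall b : 'I_N, (i < b < l)%N -> normal u b].
Proof.
case=> lt Y0E Y1E R0 R1 n0 n1 dd0 dd1 [r rR y0E] hom0 hom1 nrm0 nrm1 u.
have R00 : y0 \in Rint 0 l by exact: Rint_sub R0.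
have R10 : y1 \in Rint 0 l by exact: Rint_sub R1.
have D0 : delta l y0 \in Rint 0 l by exact: delta_Rint0.
have D1 : delta l y1 \in Rint 0 l by exact: delta_Rint0.
have uE : u = (lam l)^-1 *: (y1 * delta l y0 - y0 * delta l y1).
  by rewrite /u Y0E Y1E -!mul_mpolyC; ring.
have C0 : (lam l)^-1 *: delta l y0 \in Rint 0 l by rewrite RintZ.
have C1 : (lam l)^-1 *: delta l y1 \in Rint 0 l by rewrite RintZ.
have [s0 _ t0] := uni_linear R00 C0 n0; have [s1 _ t1] := uni_linear R10 C1 n1.
rewrite -Y0E in s0 t0; rewrite -Y1E in s1 t1.
have lR : 'X_l \in Rint (K := K) 0 l.+1 by rewrite Rint_var /=.
have up f : f \in Rint 0 l -> f \in Rint 0 l.+1 by exact: Rint_sub.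
have YR0 : Y0 \in Rint 0 l.+1 by rewrite Y0E RintB ?RintM ?lR //; exact: up.
have YR1 : Y1 \in Rint 0 l.+1 by rewrite Y1E RintB ?RintM ?lR //; exact: up.
split.
- rewrite uE; apply: RintZ.
  have XR : 'X_i \in Rint (K := K) 0 l by rewrite Rint_var.
  have rR0 : r \in Rint 0 l by exact: Rint_sub rR.
  have -> : y1 * delta l y0 - y0 * delta l y1 =
      y1 * y1 * delta l 'X_i + (y1 * delta l r - r * delta l y1).
    by rewrite y0E deltaD ?RintM // deltaM //; ring.
  have dX := delta_left lt.
  by rewrite RintD ?RintB ?RintM // ?delta_Rint.
- move=> h; have [k0 e0] := hom0 h; have [k1 e1] := hom1 h.
  have [th et] := lie_var (R := R) l h.
  have := lie_coef 1 YR0 e0 et; have := lie_coef 1 YR1 e1 et.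
  rewrite mulr1n t0 t1 => w1 w0; exists (k0 + k1 - th).
  rewrite /u -[- (y1 * Y0)]mulNr lie_add !lieM -[- y1]scaleN1r lie_scale w0 w1 e0 e1.
  rewrite -!mul_mpolyC !(mpolyCD, mpolyCB, mpolyCN); ring.
- rewrite uE deltaZ ?RintB ?RintM // -[- (y0 * _)]mulNr deltaD ?RintM ?RintN //.
  rewrite !deltaM ?RintN // dd0 dd1 -[- y0]scaleN1r deltaZ //.
  by rewrite !scaleN1r [X in _ *: X](_ : _ = 0) ?scaler0 //; ring.
move=> b ibl; have bl : (b < l)%N by case/andP: ibl.
have bR : 'X_b \in Rint (K := K) 0 l by rewrite Rint_var.
have Y0n : Y0 != 0 by apply/eqP => e; move: s0; rewrite e uni0 size_poly0.
have Y1n : Y1 != 0 by apply/eqP => e; move: s1; rewrite e uni0 size_poly0.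
have [z0 H0] := nrm0 b ibl; have [z1 H1] := nrm1 b ibl.
have [E0 _] := br_coef YR0 bR Y0n H0.
have [E1 _] := br_coef YR1 bR Y1n H1.
rewrite s0 /= mulr1n t0 in E0; rewrite s1 /= mulr1n t1 in E1.
exists (z0 + z1 - lie (xi l) 'X_b).
have B0 : br y0 'X_b = y0 * z0 - lie (xi l) 'X_b * y0 by rewrite E0 addrK.
have B1 : br y1 'X_b = y1 * z1 - lie (xi l) 'X_b * y1 by rewrite E1 addrK.
rewrite /u (brDl brP) (brNl brP) !(brMl charK brP) B0 B1 H0 H1; ring.
Qed.

Definition u_index i l l0 k := prime_index i.+1 l k && (k != l0).

(** By [normal_factorization], [u] is a product of prime elements.  The factor
    [y i1 l0] does not occur: [delta_l] kills [u], hence its factors, but not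
    [y i1 l0]. *)
Lemma u_factorization i i1 l0 l m : sfun eta i = Some i1 -> siter eta m i = Some l0 ->
  siter eta m.+1 i = Some l -> let u := uelt eta y i m.+1 in u != 0 ->
  exists e : 'I_N -> nat,
    u = lead_coeff u *: \prod_(k | u_index i l l0 k) ytrunc i.+1 k ^+ e k.
Proof.
move=> ii1 il0 il u u0; have SD := step_dataP ii1 il0 il.
have uE : u = y i l0 * y i1 l - yint y i1 l0 * y i l by exact: ueltE.
have [uR u_hom du u_nrm] := step_u SD; rewrite -uE in uR u_hom du u_nrm.
have rec' t : (t < l)%N -> recursive_at t by move=> _; exact: recursive_all.
have [c [e [c0 uP]]] := normal_factorization (ltnW (ltn_ord l)) rec' uR u0 u_hom u_nrm.
have [] := @lead_prod_ytrunc i.+1 (prime_index i.+1 l) e.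
  by move=> x /andP[].
move=> B0 _ B1.
have cE : lead_coeff u = c.
  have c0' : c%:MP != 0 :> {mpoly K[N]} by rewrite mpolyC_eq0.
  have [_ Cc] := lead_mnmC N c0; have [_] := lead_mul c0' B0.
  by rewrite mul_mpolyC -uP Cc B1 mulr1.
exists e; rewrite cE uP; congr (_ *: _).
have [bl0|bl0] := boolP (prime_index i.+1 l l0); last first.
  apply: eq_bigl => k; rewrite /u_index; case: eqVneq => [->|_]; last by rewrite andbT.
  by rewrite (negbTE bl0).
have [ltl0 _] := andP bl0.
case: m il0 il @u u0 uE uR u_hom du u_nrm uP cE SD =>
  [|m] il0 il u u0 uE uR u_hom du u_nrm uP cE SD.
  by case: il0 => e0; rewrite -e0 ltnn in ltl0.
have i1l0 : siter eta m i1 = Some l0 by move: il0; rewrite siterSr ii1.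
have i1l : siter eta m.+1 i1 = Some l by move: il; rewrite siterSr ii1.
have [_ R1 n1 d1 _] := prime_step (@recursive_all l) i1l.
have [y1E _] := recursive_all i1l0; rewrite -y1E in R1 n1 d1.
have Wl0 := ytrunc_succ ii1 i1l0.
rewrite (bigD1 l0) //=; have e0 : e l0 = 0%N.
  apply/eqP/negPn/negP => el0; have := d1.
  set B := \prod_(k | prime_index i.+1 l k && (k != l0)) ytrunc i.+1 k ^+ e k.
  have BR : B \in Rint 0 l.
    apply: Rint_prod => k /andP[/andP[ik /andP[kl _]] _]; apply: RintX.
    by have [WR _] := ytrunc_Rint ik; apply: Rint_sub WR.
  have R10 : y i1 l0 \in Rint 0 l by exact: Rint_sub R1.
  have uB : u = y i1 l0 * (y i1 l0 ^+ (e l0).-1 * (c *: B)).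
    rewrite uP (bigD1 l0) //= Wl0 -/B mulrA -exprS prednK ?lt0n //.
    by rewrite scalerAr.
  apply/negP/negPn/eqP.
  apply: (der_factor charK (delta_der l) (@delta_nilpotent _ _ R l) (Rint1 0 l)
     (@RintM _ _ 0 l) R10 (b := y i1 l0 ^+ (e l0).-1 * (c *: B))).
  - by rewrite RintM ?RintX ?RintZ.
  - by rewrite -uB.
  by rewrite -uB.
by rewrite e0 expr0 mul1r.
Qed.

(** No factor of [u] ends in the class of [i]. *)
Lemma lead_u i i1 l0 l m (x : 'I_N) : sfun eta i = Some i1 -> siter eta m i = Some l0 ->
  siter eta m.+1 i = Some l -> uelt eta y i m.+1 != 0 -> eta x = eta i ->
  lead_mnm (uelt eta y i m.+1) x = 0%N.
Proof.
move=> ii1 il0 il u0 ex; have [e uE] := u_factorization ii1 il0 il u0.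
have [] := @lead_prod_ytrunc i.+1 (u_index i l l0) e.
  by move=> k /andP[/andP[]].
set B := \prod_(k | _) _ in uE *; move=> B0 LB _.
have c0 := lead_coeff_neq0 u0.
have c0' : (lead_coeff (uelt eta y i m.+1))%:MP != 0 :> {mpoly K[N]} by rewrite mpolyC_eq0.
have [Lc _] := lead_mnmC N c0; have [L _] := lead_mul c0' B0.
rewrite uE -mul_mpolyC L Lc mnmDE mnm0E add0n LB big1 // => k /andP[bk kl0].
case: andP => [[/andP[ix xk] /eqP exk]|_]; last by rewrite mul0n.
have /andP[_ bk'] := bk; case/eqP: kl0; apply: (last_below_chain il0 il bk').
by rewrite -exk.
Qed.

(** Write [u(a, b)] for the element [u] of the part of the chain from position [a]
    to position [b], and let [c] be the prime element of the part from [1] to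
    [m].  Expanding the definitions gives
    [u(0, m+1) u(1, m) = u(0, m) u(1, m+1)] modulo [c].  The leading monomials of
    both sides contain no variable of the chain, and that of [c] does; so the
    leading coefficients agree ([lead_coeff_congr]), and by induction they are
    [1]. *)
Lemma lead_coeff_u i m l :
  (forall i, sfun eta i != None -> pi_coeff eta y i 1 = 1) ->
  siter eta m.+1 i = Some l ->
  uelt eta y i m.+1 != 0 /\ lead_coeff (uelt eta y i m.+1) = 1.
Proof.
move=> norm; have [n] := ubnP m; elim: n i m l => // n IH i m l mn il.
have := il; rewrite siterSr; case ii1: (sfun eta i) => [i1|//] i1l.
have [l0 il0 [sl0 _ l0l]] := siter_pred il.
case: m mn il i1l il0 => [|m] mn il i1l il0.
  have c1 : pi_coeff eta y i 1 = 1 by apply: norm; rewrite ii1.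
  split=> //; apply/eqP => u0; move: c1; rewrite /pi_coeff u0 /lead_coeff mcoeff0.
  by move/eqP; rewrite eq_sym oner_eq0.
have [l00 il00 [sl00 _ l00l0]] := siter_pred il0.
have := i1l; rewrite siterSr; case i1i2: (sfun eta i1) => [i2|//] i2l.
have i1l0 : siter eta m i1 = Some l0 by move: il0; rewrite siterSr ii1.
have lt1 : (i < i1)%N by have := sfunP eta i; rewrite ii1 => -[].
have lt2 : (i1 < i2)%N by have := sfunP eta i1; rewrite i1i2 => -[].
have eta1 : eta i1 = eta i by have := sfunP eta i; rewrite ii1 => -[].
have uE : uelt eta y i m.+2 = y i l0 * y i1 l - y i1 l0 * y i l.
  by rewrite (ueltE ii1 il0 il) (yintE (chain_le i1l0)).
have UAE : uelt eta y i m.+1 = y i l00 * y i1 l0 - yint y i1 l00 * y i l0.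
  exact: ueltE ii1 il00 il0.
have UBE : uelt eta y i1 m.+1 = y i1 l0 * y i2 l - yint y i2 l0 * y i1 l.
  exact: ueltE i1i2 i1l0 i1l.
have [UA0 UA1] := IH i m l0 mn il0; have [UB0 UB1] := IH i1 m l mn i1l.
have LA := lead_u ii1 il00 il0 UA0 eta1.
have LB := lead_u i1i2 i1l0 i1l UB0 (erefl _).
(* [U] is the element [u] of the inner interval, from [i1] to [l0], or [1] if
   [i1 = l0]. *)
have [U [h [U0 U1 UL UE]]] : exists U h, [/\ U != 0, lead_coeff U = 1,
    lead_mnm U i1 = 0%N & U = yint y i1 l00 * yint y i2 l0 - h * y i1 l0].
  case: m mn il00 i1l0 {il i1l i2l il0 uE UAE UBE UA0 UA1 UB0 UB1 LA LB} => [|m] mn il00 i1l0.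
    case: il00 => il00; case: i1l0 => i1l0; subst l00 l0.
    exists 1, 0; have [L C] := lead_mnmC N (oner_neq0 K); rewrite mpolyC1 in L C.
    by rewrite !yint_empty // oner_eq0 C L mnm0E mul0r subr0 mulr1.
  have i1l00 : siter eta m i1 = Some l00 by move: il00; rewrite siterSr ii1.
  have i2l0 : siter eta m i2 = Some l0 by move: i1l0; rewrite siterSr i1i2.
  have [U0 U1] := IH i1 m l0 (ltnW mn) i1l0.
  exists (uelt eta y i1 m.+1), (yint y i2 l00); split=> //.
    exact: lead_u i1i2 i1l00 i1l0 U0 (erefl _).
  by rewrite (ueltE i1i2 i1l00 i1l0) (yintE (chain_le i1l00)) (yintE (chain_le i2l0)).
set u := uelt _ _ _ _ in uE *; set UA := uelt _ _ _ _ in UAE UA0 UA1 LA.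
set UB := uelt _ _ _ _ in UBE UB0 UB1 LB.
have [w uw] : exists w, u * U - UA * UB = y i1 l0 * w.
  rewrite uE UE UAE UBE.
  set a := y i l0; set b := y i1 l; set c := y i1 l0; set d := y i l.
  set e := yint _ i1 l00; set f := yint _ i2 l0; set g := y i l00; set k := y i2 l.
  exists (- (a * b * h) - d * e * f + c * d * h - g * c * k + g * f * b + e * a * k).
  ring.
have [_ _ cL] := y_lead i1l0.
have c_pos : (0 < lead_mnm (y i1 l0) i1)%N by rewrite cL leqnn (chain_le i1l0) eqxx.
have [LAB CAB] := lead_mul UA0 UB0.
have AB0 : UA * UB != 0 by rewrite mulf_neq0.
have zAB : lead_mnm (UA * UB) i1 = 0%N by rewrite LAB mnmDE LA LB.
have u0 : u != 0.
  apply/eqP => u0; move: uw; rewrite u0 mul0r sub0r => uw.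
  have AB : UA * UB = y i1 l0 * - w by rewrite mulrN -uw opprK.
  have := AB0; rewrite AB mulf_eq0 negb_or => /andP[c0 w0].
  by move: zAB; rewrite AB; have [-> _] := lead_mul c0 w0; rewrite mnmDE; lia.
split=> //; have [LU CU] := lead_mul u0 U0.
have uL := lead_u ii1 il0 il u0 eta1.
have := lead_coeff_congr (mulf_neq0 u0 U0) AB0 uw _ zAB c_pos.
by rewrite LU mnmDE uL UL CU U1 mulr1 CAB UA1 UB1 mulr1; apply.
Qed.

End Extension.

(** * The mutation formula *)

Section Mutation.

Variables (K : fieldType) (N : nat) (R : PCGL K N).
Variables (eta : 'I_N -> int) (y : 'I_N -> 'I_N -> {mpoly K[N]}).
Hypothesis y_primes : interval_primes R eta y.
Variables (i l l0 : 'I_N) (m : nat).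
Hypothesis il0 : siter eta m i = Some l0.
Hypothesis il : siter eta m.+1 i = Some l.

Implicit Types (k : 'I_N) (v w : 'cV[int]_N).
Local Notation ytrunc := (ytrunc eta y).

Let sl0 : sfun eta l0 = Some l. Proof. by have [] := siter_step il0 il. Qed.

Let l0l : (l0 < l)%N. Proof. by have [] := siter_step il0 il. Qed.

Let il0' : (i <= l0)%N. Proof. exact: chain_le il0. Qed.

Lemma PsetE k : (k \in Pset eta i m.+1) = u_index eta i l l0 k.
Proof.
have [el0 _] := siter_eta il0; have [el _] := siter_eta il.
rewrite inE (spowE il) schainE /u_index /prime_index /last_below -!andbA.
apply/and4P/and4P => [[ik kl nk sk]|[ik kl bk kl0]].
  move: nk; rewrite ik kl /= => nk.
  have ki : k != i by apply: contraNneq nk => ->.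
  have kl' : k != l by apply: contraNneq nk => ->; rewrite el.
  have kl0 : k != l0 by apply: contraNneq nk => ->; rewrite el0.
  split=> //.
  - by rewrite ltn_neqAle eq_sym -val_eqE in ki *; rewrite ki.
  - by rewrite ltn_neqAle -val_eqE in kl' *; rewrite kl'.
  by move: sk; rewrite /s_gt; case: (sfun eta k) => // s /ltnW.
have bk' : last_below eta l k by rewrite /last_below kl bk.
split; [exact: ltnW|exact: ltnW| |].
  rewrite (ltnW ik) (ltnW kl) /=; apply: contra kl0 => /eqP ek.
  by apply/eqP; exact: (last_below_chain il0 il).
rewrite /s_gt; case e: (sfun eta k) bk => [s|//]; rewrite leq_eqVlt => /orP[/eqP es|//].
have es' : l = s by apply: val_inj.
rewrite -es' in e; have := proj2 (pfun_sfun eta k l) e.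
by rewrite (proj2 (pfun_sfun eta l0 l) sl0) => -[ek]; rewrite ek eqxx in kl0.
Qed.

Lemma Ygen_i : Ygen eta y i m.+1 i = y i l0.
Proof. by rewrite /Ygen eqxx (spowE il0) yintE. Qed.

Lemma Ygen_l : Ygen eta y i m.+1 l = y i l.
Proof.
rewrite /Ygen (spowE il) eqxx; case: eqP => [e|_]; last by rewrite (yintE _ (chain_le il)).
by move: l0l; rewrite e ltnNge il0'.
Qed.

Lemma Ygen_mid k : (i < k < l)%N -> Ygen eta y i m.+1 k = ytrunc i.+1 k.
Proof.
move=> /andP[ik kl]; rewrite /Ygen (spowE il).
have -> : (k == i) = false by apply/eqP => e; rewrite e ltnn in ik.
have -> : (k == l) = false by apply/eqP => e; rewrite e ltnn in kl.
by have [/andP[_ le] _ _] := pOP eta ik; rewrite yintE.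
Qed.

Lemma Ygen_neq0 k : (i <= k <= l)%N -> tofrac (Ygen eta y i m.+1 k) != 0.
Proof.
move=> /andP[ik kl]; rewrite tofrac_eq0.
have [->|ki] := eqVneq k i; first by rewrite Ygen_i; have [] := y_lead y_primes il0.
have [->|kl'] := eqVneq k l; first by rewrite Ygen_l; have [] := y_lead y_primes il.
have ik' : (i < k)%N by rewrite ltn_neqAle eq_sym ik -val_eqE in ki *; rewrite ki.
rewrite Ygen_mid ?ik' /=; first by have [] := ytrunc_lead y_primes ik'.
by rewrite ltn_neqAle kl -val_eqE in kl' *; rewrite kl'.
Qed.

Lemma YhomD v w : Yhom eta y i m.+1 (v + w) = Yhom eta y i m.+1 v * Yhom eta y i m.+1 w.
Proof.
rewrite /Yhom -big_split /=; apply: eq_bigr => k; rewrite (spowE il) => ik.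
by rewrite mxE expfzDr ?Ygen_neq0.
Qed.

Lemma Yhom0 : Yhom eta y i m.+1 0 = 1.
Proof. by rewrite /Yhom big1 // => k _; rewrite mxE expr0z. Qed.

Lemma Yhom_evec k : (i <= k <= l)%N ->
  Yhom eta y i m.+1 (evec k) = tofrac (Ygen eta y i m.+1 k).
Proof.
move=> ik; rewrite /Yhom (bigD1 k) /=; last by rewrite (spowE il).
rewrite /evec mxE !eqxx expr1z big1 ?mulr1 // => k' /andP[_ ne].
by rewrite mxE (negbTE ne) expr0z.
Qed.

Lemma YhomN v : Yhom eta y i m.+1 (- v) = (Yhom eta y i m.+1 v)^-1.
Proof.
have e : Yhom eta y i m.+1 v * Yhom eta y i m.+1 (- v) = 1 by rewrite -YhomD subrr Yhom0.
have n0 : Yhom eta y i m.+1 v != 0.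
  by apply: contraNneq (oner_neq0 {fraction {mpoly K[N]}}) => z; rewrite -e z mul0r.
by apply: (mulfI n0); rewrite e divff.
Qed.

Lemma YhomMn v n : Yhom eta y i m.+1 (v *+ n) = Yhom eta y i m.+1 v ^+ n.
Proof. by elim: n => [|n IH]; rewrite ?Yhom0 // mulrS exprS YhomD IH. Qed.

(** The homomorphism turns the exponent vector of [u] into its factorization. *)
Lemma Yhom_gvec (e : 'I_N -> nat) :
  Yhom eta y i m.+1 (\sum_(k in Pset eta i m.+1) evec k *+ e k) =
  tofrac (\prod_(k | u_index eta i l l0 k) ytrunc i.+1 k ^+ e k).
Proof.
rewrite (big_morph _ YhomD Yhom0) rmorph_prod /=; apply: eq_big => k.
  exact: PsetE.
rewrite PsetE => /andP[/andP[ik /andP[kl _]] _].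
by rewrite YhomMn Yhom_evec ?(ltnW ik) ?(ltnW kl) // Ygen_mid ?ik // rmorphXn.
Qed.

Lemma gvec_exponents (e mult : 'I_N -> nat) k :
  lead_exp (\prod_(k | u_index eta i l l0 k) ytrunc i.+1 k ^+ e k) =
    \sum_(k in Pset eta i m.+1) eint eta (pO eta i.+1 k) k *+ mult k ->
  u_index eta i l l0 k -> e k = mult k.
Proof.
move=> /(congr1 (fun v : 'cV_N => v k 0)) E kP; move: E; rewrite mxE.
rewrite (lead_prod_ytrunc_index y_primes (j := i.+1) (k := l)) //; last by move=> x /andP[].
have /andP[/andP[ik bk] _] := kP.
have cE x n : (eint eta (pO eta i.+1 x) x *+ n) k 0 = (eint eta (pO eta i.+1 x) x k 0) *+ n.
  by elim: n => [|n IH]; rewrite ?mulr0n ?mxE // !mulrS mxE IH.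
rewrite summxE (bigD1 k) ?PsetE //= cE eintE.
have [/andP[_ pk] ep _] := pOP eta ik.
rewrite pk leqnn ep eqxx /= big1 => [|x /andP[xP xk]].
  by rewrite addr0 natz; case.
rewrite cE eintE; move: xP; rewrite PsetE => /andP[/andP[ix bx] _].
have [_ epx _] := pOP eta ix; rewrite epx.
case: andP => [[/andP[_ kx] /eqP ekx]|_]; last by rewrite mul0rn.
case/eqP: xk; apply: (last_below_max bk); last by rewrite ekx.
by rewrite kx; case/andP: bx.
Qed.

End Mutation.

Theorem theorem9p5 (K : fieldType) (charK : [pchar K] =i pred0)
    (N : nat) (R : PCGL K N) (symR : symmetric_pcgl R)
    (eta : 'I_N -> int) (eta_adm : eta_admissible R eta)
    (y : 'I_N -> 'I_N -> {mpoly K[N]}) (y_primes : interval_primes R eta y)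
    (normalized : forall i : 'I_N, sfun eta i != None -> pi_coeff eta y i 1 = 1)
    (i : 'I_N) (m : nat) (m_gt0 : (0 < m)%N) (sm_fin : siter eta m i != None)
    (g : 'cV[int]_N) (g_def : is_gvec eta y i m g) :
  tofrac (yint y (spow eta 1 i) (spow eta m i)) =
    if m == 1%N then
      Yhom eta y i 1 (evec (spow eta 1 i) - evec i) + Yhom eta y i 1 (g - evec i)
    else
      Yhom eta y i m (evec (spow eta m.-1 i) + evec (spow eta m i) - evec i)
      + Yhom eta y i m (g - evec i).
Proof.
have [xl Hxl] : exists xl : 'I_N -> {ffun 'I_(rk R) -> K} * K, forall t : 'I_N,
    [/\ forall b, b \in Rint 0 t -> sigma R t b = lie (xl t).1 b,
        lie (xl t).1 'X_t = (xl t).2 *: 'X_t & (xl t).2 != 0].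
  apply: (@fin_all_exists _ _ (fun (t : 'I_N) (p : {ffun 'I_(rk R) -> K} * K) =>
    [/\ forall b, b \in Rint 0 t -> sigma R t b = lie p.1 b,
        lie p.1 'X_t = p.2 *: 'X_t & p.2 != 0])) => t.
  by have [h [Hs [c c0 Hc]]] := sigma_lie R t; exists (h, c).
pose xi t := (xl t).1; pose lam t := (xl t).2.
have sigma_xi (t : 'I_N) b : b \in Rint 0 t -> sigma R t b = lie (xi t) b.
  by have [H _ _] := Hxl t; exact: H.
have lie_xi t : lie (xi t) 'X_t = lam t *: 'X_t by have [] := Hxl t.
have lam0 t : lam t != 0 by have [] := Hxl t.
have [delta_left _] := symR.
case: m m_gt0 sm_fin g_def => // m _; case il: (siter eta m.+1 i) => [l|//] _ g_def.
have [l0 il0 [sl0 _ l0l]] := siter_pred il.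
have := il; rewrite siterSr; case ii1: (sfun eta i) => [i1|//] i1l.
have lti : (i < i1)%N by have := sfunP eta i; rewrite ii1 => -[].
have s1 : spow eta 1 i = i1 by apply: spowE; rewrite siterSr ii1.
have [u0 u1] := lead_coeff_u charK delta_left sigma_xi lie_xi lam0 eta_adm y_primes
  normalized il.
have [e uP] := u_factorization charK delta_left sigma_xi lie_xi lam0 eta_adm y_primes
  ii1 il0 il u0.
rewrite u1 scale1r in uP.
have Yg : Yhom eta y i m.+1 g = tofrac (uelt eta y i m.+1).
  have [mult [-> fE]] := g_def; rewrite (Yhom_gvec y_primes il0 il) uP; congr tofrac.
  rewrite /fvec uP in fE; apply: eq_bigr => k kP; congr (_ ^+ _).
  by apply/esym; exact: (gvec_exponents y_primes il0 il fE kP).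
have y0 : tofrac (y i l0) != 0 by rewrite tofrac_eq0; have [] := y_lead y_primes il0.
have il' := chain_le il; have il0' := chain_le il0.
have Yi : Yhom eta y i m.+1 (evec i) = tofrac (y i l0).
  by rewrite (Yhom_evec _ il) ?leqnn // (Ygen_i _ il0).
have Yl : Yhom eta y i m.+1 (evec l) = tofrac (y i l).
  by rewrite (Yhom_evec _ il) ?leqnn ?il' // (Ygen_l _ il0 il).
have uE := ueltE y ii1 il0 il.
rewrite s1 (spowE il) (yintE _ (chain_le i1l)).
have main (Y1 : {fraction {mpoly K[N]}}) : Y1 = tofrac (yint y i1 l0) ->
    tofrac (y i1 l) = Y1 * tofrac (y i l) / tofrac (y i l0) +
      tofrac (uelt eta y i m.+1) / tofrac (y i l0).
  move=> ->; rewrite uE rmorphB !rmorphM /= -mulrDl addrC subrK.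
  by rewrite [X in _ = X / _]mulrC mulfK.
have Yg' : Yhom eta y i m.+1 (g - evec i) = tofrac (uelt eta y i m.+1) / tofrac (y i l0).
  by rewrite (YhomD y_primes il0 il) (YhomN y_primes il0 il) Yg Yi.
case: m il il0 i1l {s1 u0 u1 uP g_def Yg} uE Yi Yl main Yg' =>
  [|m] il il0 i1l uE Yi Yl main Yg' /=.
  case: i1l => e1; subst i1; rewrite Yg' (YhomD y_primes il0 il) (YhomN y_primes il0 il) Yi Yl.
  rewrite -[tofrac (y i l)]mul1r; apply: main; case: il0 => <-.
  by rewrite yint_empty // rmorph1.
rewrite Yg' !(YhomD y_primes il0 il) (YhomN y_primes il0 il) Yi Yl (spowE il0).
have i1l0 : siter eta m i1 = Some l0 by move: il0; rewrite siterSr ii1.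
have il0'' : (i < l0)%N by exact: leq_trans lti (chain_le i1l0).
rewrite (Yhom_evec _ il) ?il0' ?(ltnW l0l) // (Ygen_mid _ il) ?il0'' //; apply: main.
by rewrite (ytrunc_succ _ ii1 i1l0) (yintE _ (chain_le i1l0)).
Qed.
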